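(* In the setting of the context, let $T\ge1$ be an integer and assume: (A4) $p\nmid u_1$ and $u_i\equiv u_1\bmod p^{n-1}$ for all $i$; (A5) the elements $x_i,\beta,\omega_i,\epsilon_i$ can be chosen so that $v_0(\epsilon_i)>-u_i+C_{n-1}$ for all $i$; (A6) $v_0(p)\ge C_n+T/p^n$. Then $p\nmid b_1$, $b_i\equiv b_1\bmod p^n$ for all $i$, and there exist $X_j\in K_j$ ($1\le j\le n$) with $v_j(X_j)=-b_j$ and $v_j((\sigma_j-1)X_j-1)>0$ such that for all $1\le i\le j\le n$ one can write $(\sigma_i-1)X_j=\mu_{i,j}+\epsilon_{i,j}$ with $\mu_{i,j}\in K_0$, $\mu_{j,j}=1$, $v_j(\mu_{i,j})=b_i-b_j<v_j(\epsilon_{i,j})$ and $$v_n(\epsilon_{i,j})-v_n(\mu_{i,j})\ge(p-1)\sum_{k=1}^{i-1}p^{n-k-1}b_k+(p^{n-i}-p^{n-j})b_i+T.$$ Consequently $K_n/K_0$ has a Galois scaffold of tolerance $T$ with shift parameters $b_1,\dots,b_n$.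
   Context: $K_0$ is complete with respect to a discrete valuation, with perfect residue field of characteristic $p>0$ (characteristic $0$ or $p$; in characteristic $p$, $v_0(p)=\infty$). $K_n/K_0$ is a totally ramified elementary abelian extension of degree $p^n$, $n>1$, $G=\mathrm{Gal}(K_n/K_0)$. $v_n$ normalized valuation of $K_n$, $\pi_n$ a prime, $\mathfrak{P}_n$ the maximal ideal, $G_t=\{\sigma:v_n(\sigma(\pi_n)-\pi_n)\ge t+1\}$. Chain $G=H_0\supset\cdots\supset H_n=\{e\}$, $|H_{i-1}:H_i|=p$, each $G_t$ among the $H_i$; $\sigma_i\in H_{i-1}\setminus H_i$; $K_i=K_n^{H_i}$ with normalized valuation $v_i$; $b_i=v_n((\sigma_i-1)\pi_n)-1$; $u_i=b_1+\sum_{k=2}^i(b_k-b_{k-1})/p^{k-1}$. $\wp(x)=x^p-x$. For each $i$ let $K_{(i)}$ be the fixed field of $\langle\sigma_j:j\ne i\rangle$, with normalized valuation $v_{(i)}$; then $K_{(i)}=K_0(x_i)$ with $\wp(x_i)\in K_0$, $v_{(i)}(x_i)=-u_i$, $v_{(i)}((\sigma_i-1)x_i-1)>0$. Put $\beta=\wp(x_1)$ and write $\wp(x_i)=\omega_i^{p^{n-1}}\beta+\epsilon_i$ with $\omega_i,\epsilon_i\in K_0$, $\omega_1=1$, $\epsilon_1=0$, $0=v_0(\omega_1)\ge v_0(\omega_2)\ge\cdots\ge v_0(\omega_n)$, $v_0(\epsilon_i)>-u_i$. $C_0=0$ and $C_i=u_i-b_i/p^i$ for $1\le i\le n$. Galois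 scaffold: for $0\le a<p^n$ with digits $a=\sum_i a_{(n-i)}p^{n-i}$, $\mathfrak{b}(a)=\sum_i a_{(n-i)}p^{n-i}b_i$; $\mathfrak{a}(t)$ is the unique $0\le a<p^n$ with $t\equiv-\mathfrak{b}(a)\bmod p^n$. $K_n/K_0$ has a Galois scaffold of tolerance $T$ with shift parameters $b_1,\dots,b_n$ if all $b_i$ are prime to $p$ and there exist $\lambda_t\in K_n$ ($t\in\mathbb{Z}$), $\Psi_1,\dots,\Psi_n\in K_0[G]$ with $v_n(\lambda_t)=t$, $\lambda_{t+p^n}=\pi_0\lambda_t$ for a prime $\pi_0$ of $K_0$, $\Psi_i(1)=0$, and $\Psi_i\lambda_j-c\,\lambda_{j+p^{n-i}b_i}\in\lambda_{j+p^{n-i}b_i}\mathfrak{P}_n^T$ where $c=1$ if $\mathfrak{a}(j)_{(n-i)}\ge1$, $c=0$ otherwise. *)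

(* Defs.v *)
From mathcomp Require Export all_boot all_order all_algebra all_fingroup.
From mathcomp Require Export all_solvable all_field.
From mathcomp Require Export archimedean constructive_ereal.

Set Implicit Arguments.
Unset Strict Implicit.
Unset Printing Implicit Defensive.

Import Order.TTheory GRing.Theory Num.Theory.

Local Open Scope ring_scope.

(* Valuations take values in \bar rat, so that v 0 = +oo and so that they can  *)
(* be compared with the rational numbers u_i and C_i.                          *)
Record normalized_valuation (K : fieldType) (v : K -> \bar rat) : Prop := {
  val_eq_pinfty : forall x, v x = +oo%E <-> x = 0;
  val_int : forall x : K, x != 0 -> exists m : int, v x = m%:~R%:E;
  val_onto : exists x, v x = 1%:E;
  val_mul : forall x y, v (x * y) = (v x + v y)%E;
  val_add : forall x y, (Order.min (v x) (v y) <= v (x + y))%O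
}.

Definition val_complete (K : fieldType) (v : K -> \bar rat) : Prop :=
  forall s : nat -> K,
    (forall M : int, exists N, forall k l, (N <= k)%N -> (N <= l)%N ->
       (M%:~R%:E <= v (s k - s l)%R)%E) ->
    exists a, forall M : int, exists N, forall k, (N <= k)%N ->
       (M%:~R%:E <= v (s k - a)%R)%E.

(* The residue field has characteristic p and a surjective Frobenius, written  *)
(* with representatives in the valuation ring.                                 *)
Definition perfect_residue_field (p : nat) (K : fieldType) (v : K -> \bar rat)
    : Prop :=
  [/\ prime p, (0 < v p%:R)%E &
      forall x, (0 <= v x)%E ->
        exists2 y, (0 <= v y)%E & (0 < v (x - y ^+ p)%R)%E].

Section Extension.

Variables (F : fieldType) (L : splittingFieldType F).

Local Notation gT := (gal_of {:L}).

Definition totally_ramified (v0 : F -> \bar rat) (vL : L -> \bar rat) : Prop :=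
  forall a : F, vL a%:A = ((\dim {:L})%:R%:E * v0 a)%E.

(* w, of which only the values on E matter, is the normalized valuation of E   *)
(* with respect to the valuation vL of L; e is the ramification index of L/E.  *)
Definition normalized_on (vL : L -> \bar rat) (E : {subfield L})
    (w : L -> \bar rat) : Prop :=
  normalized_valuation (fun x : subvs_of E => w (vsval x)) /\
  exists2 e : nat, (0 < e)%N & forall x, x \in E -> vL x = (e%:R%:E * w x)%E.

Definition ramification_group (vL : L -> \bar rat) (pi : L) (t : int)
    : {set gT} :=
  [set s in 'Gal({:L} / 1)%g | ((t%:~R + 1)%:E <= vL (s pi - pi)%R)%E].

Definition ramification_chain (p n : nat) (vL : L -> \bar rat) (pi : L)
    (H : nat -> {group gT}) : Prop :=
  [/\ H 0%N = 'Gal({:L} / 1)%G, H n = 1%G,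
      forall i, (1 <= i <= n)%N ->
        H i \subset H i.-1 /\ #|H i.-1 : H i|%g = p &
      forall t : int, exists2 i, (i <= n)%N &
        ramification_group vL pi t = H i].

(* K_(i), the fixed field of the subgroup generated by the sigma_j, j <> i.    *)
Definition partial_field (n : nat) (sigma : nat -> gT) (i : nat)
    : {subfield L} :=
  [aspace of fixedField
     <<\bigcup_(1 <= j < n.+1 | j != i) [set sigma j]>>%g].

Definition wp (p : nat) (x : L) : L := x ^+ p - x.

Definition upper_break (p : nat) (b : nat -> int) (i : nat) : rat :=
  (b 1%N)%:~R +
  \sum_(2 <= k < i.+1) ((b k)%:~R - (b k.-1)%:~R) / (p ^ k.-1)%:R.

Definition Cbound (p : nat) (b : nat -> int) (i : nat) : rat :=
  if i == 0%N then 0 else upper_break p b i - (b i)%:~R / (p ^ i)%:R.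

Definition congq (m : nat) (x y : rat) : Prop :=
  (x - y) / m%:R \is a Num.int.

(* v E is the normalized valuation of the intermediate field E. *)
Record artin_schreier_data (p n : nat) (v0 : F -> \bar rat)
    (v : {subfield L} -> L -> \bar rat) (sigma : nat -> gT) (b : nat -> int)
    (x : nat -> L) (beta : F) (omega eps : nat -> F) : Prop := {
  as_gen : forall i, (1 <= i <= n)%N ->
    <<1%VS; x i>>%VS = partial_field n sigma i;
  as_val : forall i, (1 <= i <= n)%N ->
    v (partial_field n sigma i) (x i) = (- upper_break p b i)%:E;
  as_galois : forall i, (1 <= i <= n)%N ->
    (0 < v (partial_field n sigma i) (sigma i (x i) - x i - 1)%R)%E;
  as_beta : wp p (x 1%N) = beta%:A;
  as_wp : forall i, (1 <= i <= n)%N ->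
    wp p (x i) = (omega i ^+ (p ^ n.-1) * beta + eps i)%:A;
  as_omega1 : omega 1%N = 1;
  as_eps1 : eps 1%N = 0;
  as_omega : forall i, (1 <= i < n)%N -> (v0 (omega i.+1) <= v0 (omega i))%E;
  as_eps : forall i, (1 <= i <= n)%N ->
    ((- upper_break p b i)%:E < v0 (eps i))%E
}.

(* An element of the group algebra F[G] is given by its coefficients. *)
Definition group_algebra_act (Psi : {ffun gT -> F}) (x : L) : L :=
  \sum_(s in 'Gal({:L} / 1)%g) Psi s *: s x.

Definition digit (p a k : nat) : nat := (a %/ p ^ k) %% p.

Definition frak_b (p n : nat) (b : nat -> int) (a : nat) : int :=
  \sum_(1 <= i < n.+1) (digit p a (n - i) * p ^ (n - i))%N%:Z * b i.

(* The a < p ^ n with t = - frak_b a modulo p ^ n; it exists and is unique     *)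
(* when all the b i are prime to p.                                            *)
Definition frak_a (p n : nat) (b : nat -> int) (t : int) : nat :=
  find (fun a => (t == - frak_b p n b a %[mod (p ^ n)%N])%Z) (iota 0 (p ^ n)).

Definition galois_scaffold (p n : nat) (v0 : F -> \bar rat)
    (vL : L -> \bar rat) (b : nat -> int) (T : nat) : Prop :=
  (forall i, (1 <= i <= n)%N -> coprimez (b i) p) /\
  exists (lambda : int -> L) (Psi : nat -> {ffun gT -> F}) (pi0 : F),
  [/\ forall t : int, vL (lambda t) = t%:~R%:E,
      v0 pi0 = 1%:E,
      forall t : int, lambda (t + (p ^ n)%N%:Z) = pi0 *: lambda t,
      forall i, (1 <= i <= n)%N -> group_algebra_act (Psi i) 1 = 0 &
      forall (i : nat) (j : int), (1 <= i <= n)%N ->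
        let l := lambda (j + (p ^ (n - i))%N%:Z * b i) in
        let c := (1 <= digit p (frak_a p n b j) (n - i))%N in
        exists2 y, (T%:R%:E <= vL y)%E &
          group_algebra_act (Psi i) (lambda j) - (if c then l else 0) = l * y].

End Extension.

(* Main.v *)
(** Adding to the Artin-Schreier generator x_i suitable F-multiples of x_1, ...,
    x_{i-1} raises its valuation step by step: at stage r the elements y_i
    (i >= r) satisfy wp(y_i) = w_i^(p^(n-r)) wp(y_r) + error, and
    y_i - w_i^(p^(n-r-1)) y_r satisfies a relation of the same shape with
    wp(w_i) / wp(w_{r+1}) in place of w_i.  Then X_r = y_r, and since sigma_i
    moves only x_i, (sigma_i - 1) X_j is mu_ij (1 + eta_i) with
    eta_i = (sigma_i - 1) x_i - 1, whose valuation is at least v(p) - (p-1) v(1/x_i).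
    That v(wp(w_i)) = p v(w_i), and the exact valuation of mu_ij, both
    follow from the behaviour of ramification numbers in quotients (Herbrand).
    For the scaffold, one corrects sigma_i - 1 by truncated powers
    (1 + Psi_j)^[-mu_ij], j > i, and lets it act on the products of binomials
    binom(X_j, a_j); Vandermonde's identity shows that the result lowers a_i
    by one, up to terms of high valuation. *)

Require Import Defs.
From mathcomp Require Import ring lra zify.
Import Order.TTheory GRing.Theory Num.Theory.
Local Open Scope ring_scope.

Set Implicit Arguments.
Unset Strict Implicit.
Unset Printing Implicit Defensive.

(** * Valuations *)

(** All valuations are measured in L, so an intermediate field enters only through the order of its
    group. The threshold in [A5] comes from the passage from stage r to r+1: the main term of
    wp(y_(r+1)) has valuation p^n (C_r - u_(r+1)), and the errors must lie above it. As C_r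
    increases with r, the last passage dictates C_(n-1); one bound serves all stages because the
    errors pass from stage to stage without loss. [A6] acts twice: that v(p) exceeds C_(n-1) puts
    the failure of Frobenius to be additive below these errors in size, and the full bound C_n +
    T/p^n leaves exactly T once the other terms in the estimate of eta_i have been compared. The
    delicate case is u_i = u_r: then w_i is a unit, and wp(w_i) would be too small if the residue of
    w_i lay in the prime field. In the scaffold, the products of binomials have valuations that
    represent each class modulo p^n once. They form an F-basis in which no cancellation can occur,
    so an element of the group algebra is controlled by its values on them. *)

Definition val_ge (K : fieldType) (v : K -> \bar rat) (x : K) (q : rat) : Prop :=
  (q%:E <= v x)%E.
Definition val_gt (K : fieldType) (v : K -> \bar rat) (x : K) (q : rat) : Prop :=
  (q%:E < v x)%E.
Definition val_is (K : fieldType) (v : K -> \bar rat) (x : K) (q : rat) : Prop :=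
  v x = q%:E.

Section Valuation.

Variables (K : fieldType) (v : K -> \bar rat).
Hypothesis v_val : normalized_valuation v.

Local Notation vge := (val_ge v).
Local Notation vgt := (val_gt v).
Local Notation veq := (val_is v).

Lemma val0 : v 0 = +oo%E. Proof. by apply/(val_eq_pinfty v_val). Qed.

Lemma vge0 q : vge 0 q. Proof. by rewrite /val_ge val0 leey. Qed.

Lemma vgt0 q : vgt 0 q. Proof. by rewrite /val_gt val0 ltry. Qed.

Lemma veq_neq0 x q : veq x q -> x != 0.
Proof. by move=> xq; apply/eqP => x0; move: xq; rewrite /val_is x0 val0. Qed.

Lemma val_cases x : x = 0 \/ exists m : int, veq x m%:~R.
Proof.
have [->|x0] := eqVneq x 0; first by left.
by right; apply: (val_int v_val).
Qed.

Lemma veq_ge x q : veq x q -> vge x q.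
Proof. by rewrite /val_ge => ->. Qed.

Lemma vgt_ge x q : vgt x q -> vge x q.
Proof. exact: ltW. Qed.

Lemma vgeW x q r : vge x q -> r <= q -> vge x r.
Proof. by move=> xq rq; apply: le_trans xq; rewrite lee_fin. Qed.

Lemma vge_gt x q r : vge x q -> r < q -> vgt x r.
Proof. by move=> xq rq; apply: lt_le_trans xq; rewrite lte_fin. Qed.

Lemma vgtW x q r : vgt x q -> r <= q -> vgt x r.
Proof. by move=> xq rq; apply: le_lt_trans xq; rewrite lee_fin. Qed.

Lemma veq_vge x q r : veq x q -> vge x r -> r <= q.
Proof. by rewrite /val_ge => ->; rewrite lee_fin. Qed.

Lemma veq_vgt x q r : veq x q -> vgt x r -> r < q.
Proof. by rewrite /val_gt => ->; rewrite lte_fin. Qed.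

Lemma veq_inj x q r : veq x q -> veq x r -> q = r.
Proof. by rewrite /val_is => -> []. Qed.

Lemma vgeNgt x q : ~ vgt x q -> exists2 m : int, veq x m%:~R & m%:~R <= q.
Proof.
move=> xq; case: (val_cases x) => [x0|[m xm]].
  by case: xq; rewrite x0; exact: vgt0.
by exists m => //; rewrite leNgt; apply/negP => qm; apply: xq; rewrite /val_gt xm lte_fin.
Qed.

Lemma veq_of_ge_ngt x q : vge x q -> ~ vgt x q -> veq x q.
Proof.
move=> xq /vgeNgt[m xm mq]; suff -> : q = m%:~R by [].
by apply/eqP; rewrite eq_le mq (veq_vge xm xq).
Qed.

Lemma vgtP x q : vgt x q -> x = 0 \/ exists2 m : int, veq x m%:~R & q < m%:~R.
Proof.
move=> xq; case: (val_cases x) => [|[m xm]]; [by left | right].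
by exists m => //; exact: veq_vgt xm xq.
Qed.

Lemma vge_or_lt x q : vge x q \/ exists2 m : int, veq x m%:~R & m%:~R < q.
Proof.
case: (val_cases x) => [->|[m xm]]; first by left; exact: vge0.
have [qm|mq] := leP q m%:~R; last by right; exists m.
by left; rewrite /val_ge xm lee_fin.
Qed.

Lemma veq1 : veq 1 0.
Proof.
case: (val_cases 1) => [/eqP|[m m1]]; first by rewrite oner_eq0.
have := val_mul v_val 1 1; rewrite mulr1 m1 => -[/eqP].
rewrite eq_sym -subr_eq0 addrK => /eqP m0.
by rewrite /val_is m1 m0.
Qed.

Lemma veqM x y q r : veq x q -> veq y r -> veq (x * y) (q + r).
Proof. by rewrite /val_is (val_mul v_val) => -> ->. Qed.

Lemma vgeM x y q r : vge x q -> vge y r -> vge (x * y) (q + r).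
Proof. by rewrite /val_ge (val_mul v_val) EFinD => xq yr; exact: leeD. Qed.

Lemma vgeM_gt x y q r : vge x q -> vgt y r -> vgt (x * y) (q + r).
Proof.
move=> xq yr; case: (vgtP yr) => [->|[m ym rm]].
  by rewrite mulr0; exact: vgt0.
by apply: (vge_gt (vgeM xq (veq_ge ym))); lra.
Qed.

Lemma vgeMl x y q : vge x 0 -> vge y q -> vge (x * y) q.
Proof. by move=> x0 yq; have := vgeM x0 yq; rewrite add0r. Qed.

Lemma veqX x q n : veq x q -> veq (x ^+ n) (n%:R * q).
Proof.
move=> xq; elim: n => [|n IH]; first by rewrite expr0 mul0r; exact: veq1.
by rewrite exprS mulrSr mulrDl mul1r addrC; exact: veqM.
Qed.

Lemma vgeX x q n : vge x q -> vge (x ^+ n) (n%:R * q).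
Proof.
move=> xq; elim: n => [|n IH]; first by rewrite expr0 mul0r; exact/veq_ge/veq1.
by rewrite exprS mulrSr mulrDl mul1r addrC; exact: vgeM.
Qed.

Lemma veqV x q : veq x q -> veq x^-1 (- q).
Proof.
move=> xq; have x0 := veq_neq0 xq; case: (val_cases x^-1) => [/eqP|[m xm]].
  by rewrite invr_eq0 (negPf x0).
have := veqM xq xm; rewrite mulfV // => h.
have := veq_inj h veq1 => /eqP; rewrite addrC addr_eq0 => /eqP mq.
by rewrite -mq.
Qed.

Lemma veqN1 : veq (-1) 0.
Proof.
case: (val_cases (-1)) => [/eqP|[m m1]]; first by rewrite oppr_eq0 oner_eq0.
have := veqM m1 m1; rewrite mulrNN mulr1 => /veq_inj /(_ veq1) /eqP.
by rewrite -mulr2n mulrn_eq0 /= => /eqP m0; rewrite m0 in m1.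
Qed.

Lemma veqN x q : veq x q -> veq (- x) q.
Proof. by move=> xq; rewrite -mulN1r -[q]add0r; apply: veqM => //; exact: veqN1. Qed.

Lemma vgeN x q : vge x q -> vge (- x) q.
Proof. by move=> xq; rewrite -mulN1r; apply: vgeMl => //; exact/veq_ge/veqN1. Qed.

Lemma vgeD x y q : vge x q -> vge y q -> vge (x + y) q.
Proof.
by move=> xq yq; apply: le_trans (val_add v_val x y); rewrite le_min; apply/andP.
Qed.

Lemma vgtD x y q : vgt x q -> vgt y q -> vgt (x + y) q.
Proof.
by move=> xq yq; apply: lt_le_trans (val_add v_val x y); rewrite lt_min; apply/andP.
Qed.

Lemma vgtN x q : vgt x q -> vgt (- x) q.
Proof.
move=> /vgtP[->|[m xm qm]]; first by rewrite oppr0; exact: vgt0.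
exact: vge_gt (veq_ge (veqN xm)) qm.
Qed.

Lemma vgeB x y q : vge x q -> vge y q -> vge (x - y) q.
Proof. by move=> xq yq; apply: vgeD => //; exact: vgeN. Qed.

Lemma vgtB x y q : vgt x q -> vgt y q -> vgt (x - y) q.
Proof. by move=> xq yq; apply: vgtD => //; exact: vgtN. Qed.

Lemma veqD x y q : veq x q -> vgt y q -> veq (x + y) q.
Proof.
move=> xq yq; apply: veq_of_ge_ngt.
  by apply: vgeD; [exact: veq_ge | exact: vgt_ge].
move=> xyq; have : vgt (x + y - y) q by exact: vgtB.
by rewrite addrK => /(veq_vgt xq); rewrite ltxx.
Qed.

Lemma vge_sum I (r : seq I) (P : pred I) (f : I -> K) q :
  (forall i, P i -> vge (f i) q) -> vge (\sum_(i <- r | P i) f i) q.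
Proof. by move=> fq; elim/big_ind: _ => //; [exact: vge0 | move=> x y; exact: vgeD]. Qed.

Lemma vgt_sum I (r : seq I) (P : pred I) (f : I -> K) q :
  (forall i, P i -> vgt (f i) q) -> vgt (\sum_(i <- r | P i) f i) q.
Proof. by move=> fq; elim/big_ind: _ => //; [exact: vgt0 | move=> x y; exact: vgtD]. Qed.

Lemma vge_nat m : vge m%:R 0.
Proof.
elim: m => [|m IH]; first exact: vge0.
by rewrite mulrSr; apply: vgeD => //; exact/veq_ge/veq1.
Qed.

Lemma vge_natM m x q : vge x q -> vge (m%:R * x) q.
Proof. by apply: vgeMl; exact: vge_nat. Qed.

Lemma veq_prod I (r : seq I) (P : pred I) (f : I -> K) (t : I -> rat) :
  (forall i, P i -> veq (f i) (t i)) ->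
  veq (\prod_(i <- r | P i) f i) (\sum_(i <- r | P i) t i).
Proof.
move=> ft; elim: r => [|i r IH]; first by rewrite !big_nil; exact: veq1.
by rewrite !big_cons; case: ifP => // Pi; apply: veqM => //; exact: ft.
Qed.

Lemma vge_prod I (r : seq I) (P : pred I) (f : I -> K) (t : I -> rat) :
  (forall i, P i -> vge (f i) (t i)) ->
  vge (\prod_(i <- r | P i) f i) (\sum_(i <- r | P i) t i).
Proof.
move=> ft; elim: r => [|i r IH]; first by rewrite !big_nil; exact/veq_ge/veq1.
by rewrite !big_cons; case: ifP => // Pi; apply: vgeM => //; exact: ft.
Qed.

Lemma vge_prodB I (r : seq I) (P : pred I) (f g : I -> K) (t : I -> rat) R :
  (forall i, P i -> vge (f i) (t i)) -> (forall i, P i -> vge (g i) (t i)) ->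
  (forall i, P i -> vge (f i - g i) (t i + R)) ->
  vge (\prod_(i <- r | P i) f i - \prod_(i <- r | P i) g i)
      (\sum_(i <- r | P i) t i + R).
Proof.
move=> ft gt fg; elim: r => [|i r IH]; first by rewrite !big_nil subrr; exact: vge0.
rewrite !big_cons; case: ifP => // Pi.
set A := \prod_(j <- r | P j) f j; set B := \prod_(j <- r | P j) g j.
have -> : f i * A - g i * B = f i * (A - B) + (f i - g i) * B by ring.
apply: vgeD; first by rewrite -addrA; apply: vgeM => //; exact: ft.
by rewrite -addrA [_ + R]addrC addrA; apply: vgeM; [exact: fg | exact: vge_prod].
Qed.

(** * The binomial theorem in residue characteristic p *)

Section ResidueCharacteristic.

Variable p : nat.
Hypotheses (p_pr : prime p) (vp0 : vgt p%:R 0).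

Lemma veq_nat m : coprime m p -> veq m%:R 0.
Proof.
move=> cop; apply: veq_of_ge_ngt; first exact: vge_nat.
move=> vm.
have m0 : (0 < m)%N.
  by case: m cop {vm} => //; rewrite /coprime gcd0n => /eqP p1; move: p_pr; rewrite p1.
case: (egcdnP p m0) => km kn e _.
move: cop; rewrite /coprime => /eqP g1; rewrite g1 in e.
have : vgt (km%:R * m%:R - kn%:R * p%:R) 0.
  by apply: vgtB; rewrite -[0]add0r; apply: vgeM_gt => //; exact: vge_nat.
by rewrite -!natrM e natrD addrC addKr => /(veq_vgt veq1); rewrite ltxx.
Qed.

Lemma veq_nat_lt m : (0 < m < p)%N -> veq m%:R 0.
Proof.
move=> /andP[m0 mp]; apply: veq_nat; rewrite coprime_sym prime_coprime //.
by apply/negP => /(dvdn_leq m0); rewrite leqNgt mp.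
Qed.

Variable P0 : rat.
Hypotheses (vp : vge p%:R P0) (P0_ge0 : 0 <= P0).

(** Every mixed term carries a binomial coefficient divisible by [p], and [B] bounds the monomial
    beside it. [P0] is a lower bound for the valuation of [p] rather than its value, so that
    characteristic p, where the value is infinite, is covered too. *)
Lemma vge_frobenius_mixed x y q r B : vge x q -> vge y r ->
  (forall i, (0 < i < p)%N -> B <= (p - i)%N%:R * q + i%:R * r) ->
  vge ((x + y) ^+ p - x ^+ p - y ^+ p) (P0 + B).
Proof.
move=> xq yr hB; rewrite exprDn.
have [k pk] : exists k, p = k.+1 by exists p.-1; rewrite prednK // prime_gt0.
have k_pr : prime k.+1 by rewrite -pk.
have vk : vge k.+1%:R P0 by rewrite -pk.
rewrite pk in hB *.
rewrite big_ord_recr big_ord_recl /= subn0 subnn !expr0 mul1r mulr1 bin0 binn !mulr1n.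
set S := \sum_(i < k) _.
have -> : x ^+ k.+1 + S + y ^+ k.+1 - x ^+ k.+1 - y ^+ k.+1 = S by ring.
apply: vge_sum => i _; rewrite /bump /= add1n.
have /dvdnP[c ->] : (k.+1 %| 'C(k.+1, i.+1))%N.
  by apply: prime_dvd_bin => //=; rewrite ltnS ltn_ord.
rewrite -mulr_natl natrM -mulrA; apply: vge_natM; apply: vgeM => //.
have ik : (0 < i.+1 < k.+1)%N by rewrite /= ltnS ltn_ord.
by apply: vgeW (hB _ ik); apply: vgeM; exact: vgeX.
Qed.

Lemma vge_frobenius x y q : vge x q -> vge y q ->
  vge ((x + y) ^+ p - x ^+ p - y ^+ p) (P0 + p%:R * q).
Proof.
move=> xq yq; apply: vge_frobenius_mixed xq yq _ => i /andP[_ ip].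
by rewrite -mulrDl -natrD subnK // ltnW.
Qed.

(** For [q <= 0] and integral [y] the worst mixed monomial is [x^(p-1) y], whence the factor
    [p - 1]. *)
Lemma vge_frobenius_integral x y q : vge x q -> q <= 0 -> vge y 0 ->
  vge ((x + y) ^+ p - x ^+ p - y ^+ p) (P0 + (p%:R - 1) * q).
Proof.
move=> xq q0 y0; apply: vge_frobenius_mixed xq y0 _ => i /andP[i0 ip].
have i1 : 1 <= i%:R :> rat by rewrite ler1n.
rewrite [i%:R * 0]mulr0 addr0 natrB; last exact: ltnW.
by apply: ler_wnM2r => //; rewrite lerD2l lerN2.
Qed.

(** The loss does not accumulate: the p-th power of the error [R] multiplies its excess [P0 >= 0] by
    p, and the new cross terms again gain a factor [p]. *)
Lemma vge_frobeniusX e x y q : vge x q -> vge y q ->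
  vge ((x + y) ^+ (p ^ e) - x ^+ (p ^ e) - y ^+ (p ^ e)) (P0 + (p ^ e)%:R * q).
Proof.
move=> xq yq; elim: e => [|e IH].
  by rewrite expn0 !expr1 [x + y]addrC addrK subrr; exact: vge0.
rewrite expnSr !exprM; move: IH.
set X := x ^+ _; set Y := y ^+ _; set Z := (x + y) ^+ _ => ZXY.
have -> : Z = X + Y + (Z - X - Y) by ring.
move: (Z - X - Y) ZXY => R vR.
have hX : vge X ((p ^ e)%:R * q) by exact: vgeX.
have hY : vge Y ((p ^ e)%:R * q) by exact: vgeX.
have hR : vge R ((p ^ e)%:R * q) by apply: vgeW vR _; rewrite lerDr.
have h1 := vge_frobenius hX hY.
have h2 := vge_frobenius (vgeD hX hY) hR.
have h3 : vge (R ^+ p) (P0 + p%:R * ((p ^ e)%:R * q)).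
  apply: vgeW (vgeX p vR) _; rewrite mulrDr lerD2r ler_peMl //.
  by rewrite ler1n prime_gt0.
rewrite natrM [(p ^ e)%:R * _]mulrC -mulrA.
have -> : (X + Y + R) ^+ p - X ^+ p - Y ^+ p =
  ((X + Y + R) ^+ p - (X + Y) ^+ p - R ^+ p) + ((X + Y) ^+ p - X ^+ p - Y ^+ p)
  + R ^+ p by ring.
by apply: vgeD => //; apply: vgeD.
Qed.

Lemma vge_frobeniusXB e x y q : vge x q -> vge y q ->
  vge ((x - y) ^+ (p ^ e) - (x ^+ (p ^ e) - y ^+ (p ^ e))) (P0 + (p ^ e)%:R * q).
Proof.
move=> xq yq; have h1 := vge_frobeniusX e xq (vgeN yq).
(* Applied to y + (-y) = 0, the estimate compares (-y)^(p^e) with -y^(p^e), which may differ when p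
   = 2. *)
have h2 := vge_frobeniusX e yq (vgeN yq).
rewrite subrr expr0n expn_eq0 (gtn_eqF (prime_gt0 p_pr)) /= sub0r in h2.
set A := x ^+ _; set B := y ^+ _; set D := (x - y) ^+ _; set E := (- y) ^+ (p ^ e).
have -> : D - (A - B) = (D - A - E) - (- B - E) by ring.
exact: vgeB.
Qed.

Lemma vge_frobeniusB x y q : vge x q -> vge y q ->
  vge ((x - y) ^+ p - (x ^+ p - y ^+ p)) (P0 + p%:R * q).
Proof. by move=> xq yq; have := vge_frobeniusXB 1 xq yq; rewrite expn1. Qed.

End ResidueCharacteristic.

End Valuation.

(** * Totally ramified extensions *)

Section TotallyRamified.

Variables (F : fieldType) (L : splittingFieldType F).
Variables (v0 : F -> \bar rat) (vn : L -> \bar rat).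
Hypotheses (v0_val : normalized_valuation v0) (vn_val : normalized_valuation vn).
Hypothesis vn_ram : totally_ramified v0 vn.

Local Notation gT := (gal_of {:L}).
Local Notation N := (\dim {:L}).
Local Notation vge := (val_ge vn).
Local Notation vgt := (val_gt vn).
Local Notation veq := (val_is vn).

Lemma dimL_gt0 : (0 < N)%N. Proof. by rewrite adim_gt0. Qed.

Lemma veq_scalar a q : val_is v0 a q -> veq a%:A (N%:R * q).
Proof. by rewrite /val_is vn_ram => ->. Qed.

Lemma scalar_cases (a : F) : a = 0 \/ exists m : int, veq a%:A (N%:Z * m)%:~R.
Proof.
case: (val_cases v0_val a) => [|[m am]]; [by left | right; exists m].
by rewrite intrM; exact: veq_scalar.
Qed.

Lemma veqZ (a : F) x q r : veq a%:A q -> veq x r -> veq (a *: x) (q + r).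
Proof. by move=> aq xr; rewrite -mulr_algl; exact: veqM. Qed.

Lemma vgeZ (a : F) x q r : vge a%:A q -> vge x r -> vge (a *: x) (q + r).
Proof. by move=> aq xr; rewrite -mulr_algl; exact: vgeM. Qed.

(** * Families with distinct valuations modulo the degree *)

Section Family.

Variables (I : finType) (e : I -> L) (t : I -> int).
Hypothesis et : forall i, veq (e i) (t i)%:~R.
Hypothesis t_inj : forall i j, (t i = t j %[mod N])%Z -> i = j.

(** Scalars have valuations divisible by [N], so the nonzero terms have pairwise distinct valuations
    and the least of them is the valuation of the sum. *)
Lemma vge_family (a : I -> F) q :
  vge (\sum_i a i *: e i) q -> forall i, vge (a i *: e i) q.
Proof.
move=> sq i; case: (vge_or_lt vn_val (a i *: e i) q) => // -[m aim mq].
have tE j : a j = 0 \/ exists m : int, veq (a j *: e j) (N%:Z * m + t j)%:~R.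
  case: (scalar_cases (a j)) => [|[k ak]]; [by left | right; exists k].
  by rewrite intrD; exact: veqZ.
pose k := [arg min_(j < i) vn (a j *: e j)]%O.
have [_ kmin] : xpredT k /\ forall j, (vn (a k *: e k) <= vn (a j *: e j))%E.
  by rewrite /k; case: arg_minP => // j _ jmin; split => // l; exact: jmin.
have := kmin i; rewrite aim; case: (tE k) => [->|[c kc]].
  by rewrite scale0r val0.
rewrite kc lee_fin => cm.
suff /veq_vge/(_ sq) : veq (\sum_i a i *: e i) (N%:Z * c + t k)%:~R by lra.
rewrite (bigD1 k) //=; apply: veqD => //; apply: vgt_sum => // j jk.
have := kmin j; rewrite kc; case: (tE j) => [->|[c' jc]].
  by rewrite scale0r => _; exact: vgt0.
rewrite jc lee_fin => le; rewrite /val_gt jc lte_fin lt_neqAle le andbT.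
apply: contraNneq jk => /intr_inj kj; apply/eqP/t_inj.
by rewrite -(modzMDl c' (t j)) -(modzMDl c (t k)) [c' * _]mulrC -kj [c * _]mulrC.
Qed.

Lemma family_free : free [seq e i | i <- enum I].
Proof.
rewrite -(in_tupleE [seq e i | i <- enum I]); apply/freeP => a.
have sz : size [seq e i | i <- enum I] = #|I| by rewrite size_map -cardE.
move=> s0.
have h (i : I) : a (cast_ord (esym sz) (enum_rank i)) = 0.
  pose a' (j : I) := a (cast_ord (esym sz) (enum_rank j)).
  have s0' : \sum_j a' j *: e j = 0.
    rewrite -[RHS]s0 (reindex (cast_ord (esym sz))) /=; last first.
      by exists (cast_ord sz) => j _; rewrite ?cast_ordK ?cast_ordKV.
    rewrite (reindex (@enum_rank I)) /=; last first.
      by exists enum_val => j _; rewrite ?enum_rankK ?enum_valK.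
    apply: eq_bigr => j _; congr (_ *: _).
    by rewrite (nth_map j) ?nth_enum_rank // -cardE.
  (* A vanishing sum satisfies every bound, hence so does each of its terms. *)
  have a'q q : vge (a' i *: e i) q by apply: vge_family; rewrite s0'; exact: vge0.
  case: (scalar_cases (a' i)) => // -[c ac].
  have := veq_vge (veqZ ac (et i)) (a'q ((N%:Z * c)%:~R + (t i)%:~R + 1)).
  by rewrite gerDl ler10.
move=> j; rewrite -[j](cast_ordK sz) -(enum_valK (cast_ord sz j)); exact: h.
Qed.

Hypothesis card_I : #|I| = N.

Lemma family_span y : exists a : I -> F, y = \sum_i a i *: e i.
Proof.
have sz : size [seq e i | i <- enum I] = #|I| by rewrite size_map -cardE.
have : basis_of fullv (in_tuple [seq e i | i <- enum I]).
  by rewrite basisEfree family_free subvf /= size_map -cardE card_I.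
move=> /coord_basis/(_ (memvf y)) yE.
exists (fun i => coord (in_tuple [seq e i | i <- enum I])
                       (cast_ord (esym sz) (enum_rank i)) y).
rewrite {1}yE (reindex (cast_ord (esym sz))) /=; last first.
  by exists (cast_ord sz) => j _; rewrite ?cast_ordK ?cast_ordKV.
rewrite (reindex (@enum_rank I)) /=; last first.
  by exists enum_val => j _; rewrite ?enum_rankK ?enum_valK.
apply: eq_bigr => j _; congr (_ *: _).
by rewrite (nth_map j) ?nth_enum_rank // -cardE.
Qed.

Lemma family_expansion y q : vge y q ->
  exists2 a : I -> F, y = \sum_i a i *: e i & forall i, vge (a i *: e i) q.
Proof.
move=> yq; have [a ya] := family_span y.
by exists a => //; apply: vge_family; rewrite -ya.
Qed.

End Family.

(** * Expansions in powers of a prime and the Galois action *)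

Variable pin : L.
Hypothesis pin_prime : veq pin 1.

Lemma veq_pinX k : veq (pin ^+ k) k%:~R.
Proof. by have := veqX vn_val k pin_prime; rewrite mulr1. Qed.

Lemma pin_expansion y q : vge y q ->
  exists2 a : 'I_N -> F, y = \sum_(k < N) a k *: pin ^+ k &
    forall k, vge (a k *: pin ^+ k) q.
Proof.
apply: (@family_expansion _ _ (fun k : 'I_N => Posz k)).
- by move=> k; exact: veq_pinX.
- by move=> i j; rewrite !modz_nat !modn_small // => -[] /val_inj.
- exact: card_ord.
Qed.

Lemma gal_1 (s : gT) (a : F) : s a%:A = a%:A.
Proof. by rewrite linearZ /= rmorph1. Qed.

(* Expanding in powers of pin bounds vn (s x) below up to a constant; applying  *)
(* this to all powers of x removes the constant.                              *)
Lemma vge_gal (s : gT) x q : vge x q -> vge (s x) q.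
Proof.
move=> xq.
have [d pd] : exists d : int, veq (s pin) d%:~R.
  case: (val_cases vn_val (s pin)) => // /eqP.
  by rewrite fmorph_eq0 (negPf (veq_neq0 vn_val pin_prime)).
pose c : rat := N%:R * `|d%:~R - 1|.
have bound y r : vge y r -> vge (s y) (r - c).
  case/pin_expansion => a -> ar; rewrite linear_sum /=; apply: vge_sum => // k _.
  rewrite linearZ rmorphXn /=; case: (scalar_cases (a k)) => [->|[m am]].
    by rewrite scale0r; exact: vge0.
  have le1 := veq_vge (veqZ am (veq_pinX k)) (ar k).
  apply: vgeW (veq_ge (veqZ am (veqX vn_val k pd))) _.
  suff : k%:R - c <= k%:R * d%:~R by move: le1; rewrite -pmulrn; lra.
  have kN : k%:R * `|d%:~R - 1| <= c.
    by rewrite ler_wpM2r // ler_nat ltnW.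
  have : - `|d%:~R - 1| <= d%:~R - 1 :> rat by rewrite lerNnormlW.
  move=> /(ler_wpM2l (ler0n rat k)); move: kN; lra.
case: (val_cases vn_val x) => [->|[m xm]]; first by rewrite rmorph0; exact: vge0.
suff : vge (s x) m%:~R by move=> h; apply: vgeW h (veq_vge xm xq).
case: (vge_or_lt vn_val (s x) m%:~R) => // -[m' sxm mm].
have h k : k%:R * m%:~R - c <= k%:R * m'%:~R.
  apply: veq_vge (veqX vn_val k sxm) _.
  by rewrite -rmorphXn; apply: bound; exact/veq_ge/veqX.
have mm1 : (m' + 1)%:~R <= m%:~R :> rat.
  by move: mm; rewrite ler_int ltr_int lezD1.
have [k kc] : exists k : nat, c < k%:R.
  by exists (Num.truncn c).+1; rewrite truncnS_gt.
have := h k; rewrite -subr_ge0 => h1.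
have : k%:R <= k%:R * (m%:~R - m'%:~R) :> rat.
  by rewrite ler_peMr // lerBrDr addrC -[1]/(1%:~R) -intrD.
by move: h1 kc; lra.
Qed.

Lemma val_gal (s : gT) x : vn (s x) = vn x.
Proof.
case: (val_cases vn_val x) => [->|[m xm]]; first by rewrite rmorph0.
rewrite xm; apply: (veq_of_ge_ngt vn_val); first exact/vge_gal/veq_ge.
move=> sxm; case: (vgtP vn_val sxm) => [/eqP|[k sxk mk]].
  by rewrite fmorph_eq0 (negPf (veq_neq0 vn_val xm)).
have := vge_gal (s^-1)%g (veq_ge sxk).
rewrite -galM ?memvf // mulgV gal_id => /(veq_vge xm).
by rewrite leNgt mk.
Qed.

Lemma veq_gal (s : gT) x q : veq x q -> veq (s x) q.
Proof. by rewrite /val_is val_gal. Qed.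

Lemma scalar_vge0 (a : F) (k : nat) : (k < N)%N -> vge (a *: pin ^+ k) 0 ->
  vge a%:A 0.
Proof.
move=> kN; case: (scalar_cases a) => [-> _|[m am]].
  by rewrite scale0r; exact: vge0.
move=> /(veq_vge (veqZ am (veq_pinX k))); rewrite -intrD (ler_int _ 0) => h.
apply: vgeW (veq_ge am) _; rewrite (ler_int _ 0).
have N0 := dimL_gt0.
by rewrite pmulr_rge0 ?ltz_nat //; nia.
Qed.

(** Total ramification leaves the residue field unchanged: in the expansion of an integral element
    only the constant term can have valuation below 1. *)
Lemma residue_scalar y : vge y 0 ->
  exists2 a : F, vge a%:A 0 & vge (y - a%:A) 1.
Proof.
move=> /pin_expansion[a yE ya].
pose o : 'I_N := Ordinal dimL_gt0.
exists (a o); first exact: (scalar_vge0 (ltn_ord o)).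
rewrite yE (bigD1 o) //= expr0 addrAC subrr add0r; apply: vge_sum => // k ko.
have k0 : (0 < k)%N by rewrite lt0n; apply: contraNneq ko => k0; exact/eqP/val_inj.
have := ya k; case: (scalar_cases (a k)) => [->|[m am]].
  by rewrite scale0r => _; exact: vge0.
have h := veqZ am (veq_pinX k).
move=> /(veq_vge h); rewrite -intrD (ler_int _ 0) => h1.
apply: vgeW (veq_ge h) _; rewrite -intrD -[1]/(1%:~R) ler_int.
have kN := ltn_ord k; have N0 := dimL_gt0.
have [m0|m0] : m <= -1 \/ 0 <= m by lia.
  have : N%:Z * m <= N%:Z * -1 by rewrite ler_pM2l.
  by lia.
have : 0 <= N%:Z * m by rewrite mulr_ge0.
by lia.
Qed.

Lemma pin_generates (s t : gT) : s pin = t pin -> s = t.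
Proof.
move=> st; apply/eqP/gal_eqP => y _.
have [q yq] : exists q, vge y q.
  by case: (val_cases vn_val y) => [->|[m /veq_ge]]; [exists 0; exact: vge0 | exists m%:~R].
have [a -> _] := pin_expansion yq.
by rewrite !linear_sum; apply: eq_bigr => k _; rewrite !linearZ !rmorphXn /= st.
Qed.

End TotallyRamified.

(** * Ramification numbers in quotients *)

Section IntegralPoly.

Variables (K : fieldType) (v : K -> \bar rat).
Hypothesis v_val : normalized_valuation v.

Definition integral_poly (q : {poly K}) : Prop := forall k, val_ge v q`_k 0.

Lemma integral_polyM q r : integral_poly q -> integral_poly r -> integral_poly (q * r).
Proof.
by move=> hq hr k; rewrite coefM; apply: vge_sum => // i _; apply: vgeMl.
Qed.

Lemma integral_polyB q r : integral_poly q -> integral_poly r -> integral_poly (q - r).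
Proof. by move=> hq hr k; rewrite coefB; apply: vgeB. Qed.

Lemma integral_polyC c : val_ge v c 0 -> integral_poly c%:P.
Proof. by move=> hc k; rewrite coefC; case: eqP => // _; exact: vge0. Qed.

Lemma integral_polyX : integral_poly 'X.
Proof.
by move=> k; rewrite coefX; case: eqP => // _; [exact/veq_ge/veq1 | exact: vge0].
Qed.

Lemma integral_poly_horner q z : integral_poly q -> val_ge v z 0 -> val_ge v q.[z] 0.
Proof.
move=> hq hz; rewrite horner_coef; apply: vge_sum => // i _; apply: vgeMl => //.
by have := vgeX v_val i hz; rewrite mulr0.
Qed.

(** Synthetic division, read from the leading coefficient down: each coefficient of [q] is a
    coefficient of the product plus [r] times the next one. *)
Lemma integral_poly_div q r : val_ge v r 0 ->
  integral_poly (q * ('X - r%:P)) -> integral_poly q.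
Proof.
move=> hr hqr.
have rec k : q`_k = (q * ('X - r%:P))`_k.+1 + r * q`_k.+1.
  by rewrite mulrBr coefB coefMX coefMC /=; ring.
suff h m k : (size q <= k + m)%N -> val_ge v q`_k 0.
  by move=> k; apply: (h (size q)); exact: leq_addl.
elim: m k => [|m IH] k km.
  by rewrite nth_default; [exact: vge0 | rewrite -[k]addn0].
by rewrite rec; apply: vgeD => //; apply: vgeMl => //; apply: IH; rewrite addSnnS.
Qed.

(** Splitting off X - r keeps the cofactor integral, so every root contributes one factor of
    valuation at least [t]. *)
Lemma vge_horner_roots (rs : seq K) (q : {poly K}) z t :
  integral_poly q -> uniq rs -> all (root q) rs ->
  (forall r, r \in rs -> val_ge v r 0) -> val_ge v z 0 ->
  (forall r, r \in rs -> val_ge v (z - r) t) ->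
  val_ge v q.[z] ((size rs)%:R * t).
Proof.
move=> hq + + + hz; elim: rs q hq => [|r rs IH] q hq.
  by move=> _ _ _ _; rewrite mul0r; exact: integral_poly_horner.
case/andP=> rrs urs /andP[/factor_theorem[q' qE] qrs] irs zrs.
have hq' : integral_poly q'.
  by apply: (@integral_poly_div _ r); [apply: irs; exact: mem_head | rewrite -qE].
rewrite qE hornerM hornerXsubC /= mulrSr mulrDl mul1r; apply: vgeM => //.
  apply: IH => //; last 2 first.
  - by move=> x xrs; apply: irs; rewrite inE xrs orbT.
  - by move=> x xrs; apply: zrs; rewrite inE xrs orbT.
  apply/allP => x xrs; have := allP qrs _ xrs.
  rewrite qE rootM root_XsubC => /orP[//|/eqP xr].
  by rewrite -xr xrs in rrs.
by apply: zrs; exact: mem_head.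
Qed.

End IntegralPoly.

(** * Displacement of elements of a fixed field *)

Section Herbrand.

Variables (F : fieldType) (L : splittingFieldType F).
Variables (v0 : F -> \bar rat) (vn : L -> \bar rat).
Hypotheses (v0_val : normalized_valuation v0) (vn_val : normalized_valuation vn).
Hypothesis vn_ram : totally_ramified v0 vn.
Variable pin : L.
Hypothesis pin_prime : val_is vn pin 1.

Local Notation gT := (gal_of {:L}).
Local Notation N := (\dim {:L}).
Local Notation vge := (val_ge vn).
Local Notation vgt := (val_gt vn).
Local Notation veq := (val_is vn).
Local Notation veq_gal := (veq_gal v0_val vn_val vn_ram pin_prime).
Local Notation vge_gal := (vge_gal v0_val vn_val vn_ram pin_prime).

Variable A : {group gT}.
Local Notation E := [aspace of fixedField A].

Lemma fixed_gal_id y (s : gT) : y \in E -> s \in A -> s y = y.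
Proof. by move=> /mem_fixedFieldP[_]; apply. Qed.

Lemma gal_pin_ge0 (s : gT) : vge (s pin) 0.
Proof. by apply: vgeW (veq_ge (veq_gal s pin_prime)) _; rewrite ler01. Qed.

(* y = g(pin) for an integral polynomial g over F, and g - y vanishes at the  *)
(* A-conjugates of pin, hence is divisible by the product of X - t(pin).      *)
Lemma herbrand_ge (s : gT) c y :
  (forall t, t \in A -> vge (s pin - t pin) c) ->
  y \in E -> vge y 0 -> vge (s y - y) (#|A|%:R * c).
Proof.
move=> sA yE y0; have [a ya a0] := pin_expansion v0_val vn_val vn_ram pin_prime y0.
pose g : {poly L} := \sum_(k < N) (a k)%:A *: 'X^k.
have gE (t : gT) : g.[t pin] = t y.
  rewrite horner_sum ya linear_sum; apply: eq_bigr => k _.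
  by rewrite hornerZ hornerXn linearZ rmorphXn /= mulr_algl.
have -> : s y - y = (g - y%:P).[s pin] by rewrite !hornerE gE.
rewrite cardE -(size_map (fun t : gT => t pin)); apply: vge_horner_roots => //.
- apply: integral_polyB => //; last exact: integral_polyC.
  move=> i; rewrite coef_sum; apply: vge_sum => // k _; rewrite coefZ coefXn.
  rewrite mulrC; apply: vge_natM => //.
  exact: (scalar_vge0 v0_val vn_val vn_ram pin_prime (ltn_ord k)).
- rewrite map_inj_uniq ?enum_uniq // => t t'.
  exact: (pin_generates v0_val vn_val vn_ram pin_prime).
- apply/allP => _ /mapP[t + ->]; rewrite mem_enum => tA.
  by rewrite /root !hornerE gE (fixed_gal_id yE tA) subrr.
- by move=> _ /mapP[t _ ->]; exact: gal_pin_ge0.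
- exact: gal_pin_ge0.
- by move=> _ /mapP[t + ->]; rewrite mem_enum; exact: sA.
Qed.

(** The minimal polynomial of [pin] over the fixed field of [A]. *)
Definition conj_poly : {poly L} := \prod_(t in A) ('X - (t pin)%:P).

Lemma conj_poly_fixed k : conj_poly`_k \in E.
Proof.
apply/fixedFieldP; rewrite ?memvf // => s sA.
have e : map_poly s conj_poly = conj_poly.
  rewrite rmorph_prod /= [RHS](reindex_inj (mulIg s)) /=.
  apply: eq_big => t; first by rewrite groupMr.
  by move=> _; rewrite map_polyXsubC /= galM ?memvf.
by rewrite -{2}e coef_map.
Qed.

Lemma conj_poly_integral : integral_poly vn conj_poly.
Proof.
rewrite /conj_poly; elim/big_ind: _ => //.
- exact/integral_polyC/veq_ge/veq1.
- by move=> q r; exact: integral_polyM.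
move=> t _; apply: integral_polyB => //; first exact: integral_polyX.
by apply: integral_polyC => //; exact: gal_pin_ge0.
Qed.

(** The conjugate of [conj_poly] under [s] vanishes at [s pin], while [conj_poly] itself takes there
    the value prod (s pin - t pin), of valuation exactly |A| c. The difference of the two is a
    combination of the displacements of the coefficients, so these cannot all have larger
    valuation. *)
Lemma herbrand_attained (s : gT) c :
  (forall t, t \in A -> veq (s pin - t pin) c) ->
  exists2 y, y \in E /\ vge y 0 & ~ vgt (s y - y) (#|A|%:R * c).
Proof.
move=> sA; set f := conj_poly.
have fs : veq f.[s pin] (#|A|%:R * c).
  rewrite /f /conj_poly horner_prod mulr_natl -sumr_const.
  by apply: veq_prod => // t tA; rewrite hornerXsubC; exact: sA.
have fpin : f.[pin] = 0.
  by rewrite /f /conj_poly horner_prod (bigD1 1%g) //= hornerXsubC gal_id subrr mul0r.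
have [all_gt|] := boolP [forall k : 'I_(size f),
    ((#|A|%:R * c)%:E < vn (s f`_k - f`_k)%R)%E]; last first.
  rewrite negb_forall => /existsP[k /negP k_gt]; exists f`_k => //.
  by split; [exact: conj_poly_fixed | exact: conj_poly_integral].
have : f.[s pin] = \sum_(k < size f) (s pin) ^+ k * - (s f`_k - f`_k).
  have fs0 : (map_poly s f).[s pin] = 0 by rewrite horner_map fpin rmorph0.
  rewrite -[LHS]subr0 -[X in _ - X = _]fs0.
  rewrite !horner_coef size_map_poly -sumrB; apply: eq_bigr => k _.
  by rewrite coef_map /=; ring.
move=> fE; suff /(veq_vgt fs) : vgt f.[s pin] (#|A|%:R * c) by rewrite ltxx.
rewrite fE; apply: vgt_sum => // k _; rewrite -[_ * c]add0r; apply: vgeM_gt => //.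
  by have := vgeX vn_val k (gal_pin_ge0 s); rewrite mulr0.
by apply: vgtN => //; exact: (forallP all_gt).
Qed.

Definition conj_norm : L := \prod_(t in A) t pin.

Lemma conj_norm_fixed : conj_norm \in E.
Proof.
apply/fixedFieldP; rewrite ?memvf // => s sA; rewrite rmorph_prod /=.
rewrite /conj_norm [RHS](reindex_inj (mulIg s)) /=.
by apply: eq_big => t; [rewrite groupMr | rewrite galM ?memvf].
Qed.

Lemma veq_conj_norm : veq conj_norm #|A|%:R.
Proof.
by rewrite /conj_norm -sumr_const; apply: veq_prod => // t _; exact: veq_gal.
Qed.

Variable w : L -> \bar rat.
Hypothesis w_norm : normalized_on vn E w.

Lemma normalized_on_veq x (e : nat) q : (0 < e)%N ->
  vn x = (e%:R%:E * w x)%E -> veq x (e%:R * q) -> w x = q%:E.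
Proof.
rewrite /val_is => e0 ->; have e1 : e%:R != 0 :> rat by rewrite pnatr_eq0 -lt0n.
case: (w x) => [r [] /(mulfI e1) -> //||].
- by rewrite gt0_muley // lte_fin ltr0n.
- by rewrite gt0_muleNy // lte_fin ltr0n.
Qed.

Lemma normalized_on_cases x : x \in E -> x = 0 \/ exists m : int, w x = m%:~R%:E.
Proof.
case: w_norm => hw _ xE; case: (val_cases hw (Subvs xE)) => [x0|]; [left|by right].
by have /= -> := congr1 (@vsval _ _ _) x0.
Qed.

(** The norm of [pin] shows that [e] divides |A|, say |A| = e m. The powers of a prime of [E] with
    exponent below N/e have distinct valuations modulo [N], so they are independent over F. Hence
    N/e <= dim E = N/|A|, and m = 1. *)
Lemma normalized_on_card x : x \in E -> vn x = (#|A|%:R%:E * w x)%E.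
Proof.
case: w_norm => hw [e e0 we].
suff -> : #|A| = e by exact: we.
have vE z : z \in E -> z = 0 \/ exists m : int, veq z (e%:Z * m)%:~R.
  move=> zE; case: (normalized_on_cases zE) => [|[m xm]]; [by left | right].
  by exists m; rewrite /val_is we // xm intrM.
have [m Am] : exists m : nat, #|A| = (e * m)%N.
  case: (vE _ conj_norm_fixed) => [h|[m h]].
    by have := veq_neq0 vn_val veq_conj_norm; rewrite h eqxx.
  have /eqP := veq_inj veq_conj_norm h; rewrite pmulrn eqr_int => /eqP.
  case: m {h} => m hm; first by exists m; apply/eqP; rewrite -eqz_nat hm PoszM.
  by exfalso; move: hm; rewrite NegzE; nia.
have [a a1] := val_onto v0_val.
have aN := veq_scalar vn_ram a1; rewrite mulr1 in aN.
have [m2 Nm] : exists m : nat, N = (e * m)%N.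
  have : a%:A \in E by rewrite rpredZ // rpred1.
  case/vE => [h|[m' h]].
    by have := veq_neq0 vn_val aN; rewrite h eqxx.
  have /eqP := veq_inj aN h; rewrite pmulrn eqr_int => /eqP.
  case: m' {h} => m' hm; first by exists m'; apply/eqP; rewrite -eqz_nat hm PoszM.
  by exfalso; move: hm; rewrite NegzE; nia.
have [pw pw1] := val_onto hw.
have pwE : veq (vsval pw) e%:R.
  by rewrite /val_is we ?subvsP // pw1 -EFinM mulr1.
have fr : free [seq (vsval pw) ^+ (nat_of_ord i) | i <- enum 'I_m2].
  apply: (family_free v0_val vn_val vn_ram (t := fun i : 'I_m2 => (e * i)%N%:Z)).
    by move=> i; have := veqX vn_val i pwE; rewrite -natrM mulnC.
  move=> i j; rewrite Nm !modz_nat !modn_small ?ltn_pmul2l // => -[] /eqP.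
  by rewrite eqn_pmul2l // => /eqP/val_inj.
have le : (m2 <= \dim (fixedField A))%N.
  move: fr; rewrite /free size_map size_enum_ord => /eqP <-.
  apply/dimvS/span_subvP => _ /mapP[i _ ->]; apply: rpredX; exact: subvsP.
have dimE : (#|A| * \dim (fixedField A))%N = N.
  by rewrite dim_fixedField divnK // field_dimS // subvf.
have d0 : (0 < \dim (fixedField A))%N := adim_gt0 E.
have m0 : (0 < m)%N by have := cardG_gt0 A; rewrite Am muln_gt0 => /andP[].
move: dimE le; rewrite Am Nm -mulnA => /eqP; rewrite eqn_pmul2l // => /eqP <-.
by rewrite -{2}[\dim _]mul1n leq_pmul2r // => m1; rewrite (_ : m = 1%N) ?muln1 //; lia.
Qed.

Lemma fixed_cases y : y \in E ->
  y = 0 \/ exists m : int, veq y (#|A|%:R * m%:~R).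
Proof.
move=> yE; case: (normalized_on_cases yE) => [|[m ym]]; [by left | right].
by exists m; rewrite /val_is normalized_on_card // ym.
Qed.

Section Shift.

Variables (s : gT) (b : rat).

Local Notation B := (#|A|%:R * b).

(** The bound of [herbrand_ge] ignores the valuation of [y] and has the right size only at primes of
    [E]. The relative form is stable under products and inverses, which carries it from primes to
    all nonzero elements. *)
Definition shifted y := exists2 q, veq y q & vge (s y - y) (q + B).

Lemma shiftedP y q : veq y q -> shifted y -> vge (s y - y) (q + B).
Proof. by move=> yq [r yr]; rewrite (veq_inj yq yr). Qed.

Lemma shiftedM y z : shifted y -> shifted z -> shifted (y * z).
Proof.
move=> [q yq sy] [r zr sz]; exists (q + r); first exact: veqM.
rewrite rmorphM /=.
have -> : s y * s z - y * z = (s y - y) * s z + y * (s z - z) by ring.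
apply: vgeD => //; last by rewrite -addrA; apply: vgeM => //; exact: veq_ge.
by rewrite addrAC; apply: vgeM => //; exact/veq_ge/veq_gal.
Qed.

Lemma shiftedV y : shifted y -> shifted y^-1.
Proof.
move=> [q yq sy]; have y0 := veq_neq0 vn_val yq; exists (- q); first exact: veqV.
have sy0 : s y != 0 by rewrite fmorph_eq0.
have -> : s y^-1 - y^-1 = - (s y - y) * (s y^-1 * y^-1).
  by rewrite fmorphV; field; rewrite sy0 y0.
have -> : - q + B = q + B + (- q + - q) by ring.
apply: vgeM => //; first exact: vgeN.
by apply/veq_ge/veqM => //; [apply: veq_gal|]; exact: veqV.
Qed.

Lemma shiftedX y k : shifted y -> shifted (y ^+ k).
Proof.
move=> sy; elim: k => [|k IH]; last by rewrite exprS; exact: shiftedM.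
exists 0; first by rewrite expr0; exact: veq1.
by rewrite expr0 rmorph1 subrr; exact: vge0.
Qed.

Hypothesis sA_ge : forall t, t \in A -> vge (s pin - t pin) (b + 1).

Lemma shifted_prime y : y \in E -> veq y #|A|%:R -> shifted y.
Proof.
move=> yE y1; exists #|A|%:R => //.
have -> : #|A|%:R + B = #|A|%:R * (b + 1) :> rat by ring.
by apply: herbrand_ge => //; apply: vgeW (veq_ge y1) _; rewrite ler0n.
Qed.

Lemma fixed_shifted y : y \in E -> y != 0 -> shifted y.
Proof.
move=> yE y0; case: (fixed_cases yE) => [/eqP|[m ym]]; first by rewrite (negPf y0).
have [k [l mkl]] : exists k l : nat, m = (k.+1)%:Z - l%:Z.
  case: m {ym} => m; first by exists m, 1%N; lia.
  by exists 0%N, m.+2; rewrite NegzE; lia.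
set P := conj_norm; have P0 : P != 0 := veq_neq0 vn_val veq_conj_norm.
have sP : shifted P := shifted_prime conj_norm_fixed veq_conj_norm.
(* With [y] of valuation |A| m and m = k + 1 - l, the element [y'] has valuation |A|, as a prime of
   [E] should. *)
pose y' := y * P ^+ l * P^-1 ^+ k.
have -> : y = y' * P ^+ k * P^-1 ^+ l.
  by rewrite /y' !exprVn divfK ?expf_neq0 // mulfK ?expf_neq0.
do 2?apply: shiftedM; [|exact: shiftedX | exact/shiftedX/shiftedV].
apply: shifted_prime.
  have PE := conj_norm_fixed.
  by rewrite /y'; do 2?apply: rpredM => //; rewrite rpredX // rpredV.
have -> : #|A|%:R = #|A|%:R * m%:~R + l%:R * #|A|%:R + k%:R * - #|A|%:R :> rat.
  by rewrite mkl rmorphB /= -!pmulrn mulrSr; ring.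
do 2?apply: veqM => //; apply: veqX => //; first exact: veq_conj_norm.
exact: (veqV vn_val veq_conj_norm).
Qed.

End Shift.

(** * Exact displacement when the valuation is prime to p *)

Section ExactShift.

Variables (p : nat) (p_pr : prime p) (vp0 : vgt p%:R 0).
Variables (s : gT) (b : rat).
Hypotheses (b_gt0 : 0 < b)
  (sA : forall t, t \in A -> veq (s pin - t pin) (b + 1)).

Local Notation B := (#|A|%:R * b).

Let sA_ge t : t \in A -> vge (s pin - t pin) (b + 1).
Proof. by move=> tA; exact/veq_ge/sA. Qed.

Let cardA_gt0 : 0 < #|A|%:R :> rat. Proof. by rewrite ltr0n cardG_gt0. Qed.

Lemma fixed_shift_gt y : y \in E -> vge y 1 -> vge (s y - y) (#|A|%:R + B).
Proof.
move=> yE y1; case: (fixed_cases yE) => [->|[m ym]].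
  by rewrite rmorph0 subr0; exact: vge0.
have := fixed_shifted sA_ge yE (veq_neq0 vn_val ym).
move=> /(shiftedP ym) h; apply: vgeW h _; rewrite lerD2r.
have := veq_vge ym y1 => m1.
suff m_ge1 : 1 <= m%:~R :> rat by rewrite ler_peMr // ltW.
rewrite -[1]/(1%:~R) ler_int -gtz0_ge1 -(ltr_int rat).
by rewrite -(pmulr_rgt0 _ cardA_gt0); apply: lt_le_trans m1.
Qed.

(** Subtracting from an extremal element the scalar with the same residue leaves the displacement
    unchanged and makes the valuation positive. The relative bound then forces this valuation to be
    the least positive one, |A|. *)
Lemma exact_prime : exists2 r, r \in E /\ veq r #|A|%:R & veq (s r - r) (#|A|%:R + B).
Proof.
have [a [aE a0] not_gt] := herbrand_attained sA.
have [c c0 ac] := residue_scalar v0_val vn_val vn_ram pin_prime a0.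
have cE : c%:A \in E by rewrite rpredZ // rpred1.
have rE : a - c%:A \in E by rewrite rpredB.
have [r r_def] : exists r, r = a - c%:A by exists (a - c%:A).
rewrite -r_def in rE ac.
have sr : s r - r = s a - a.
  by rewrite r_def rmorphB /= gal_1; ring.
rewrite -sr in not_gt.
have e : #|A|%:R * (b + 1) = #|A|%:R + B :> rat by ring.
rewrite e in not_gt.
have srB : veq (s r - r) (#|A|%:R + B).
  by apply: (veq_of_ge_ngt vn_val) => //; exact: fixed_shift_gt.
exists r => //; split => //.
case: (fixed_cases rE) => [r0|[m rm]].
  by move: srB; rewrite r0 rmorph0 subr0 /val_is (val0 vn_val).
have := fixed_shifted sA_ge rE (veq_neq0 vn_val rm).
move=> /(shiftedP rm) /(veq_vge srB); rewrite lerD2r => h1.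
have h2 := veq_vge rm ac.
suff m1 : m = 1 by rewrite m1 mulr1 in rm.
have : m <= 1.
  by rewrite -(ler_int rat); rewrite -(ler_pM2l cardA_gt0) mulr1.
have : 0 < m.
  by rewrite -(ltr_int rat) -(pmulr_rgt0 _ cardA_gt0); apply: lt_le_trans h2.
lia.
Qed.

(** Write y = r^m u with [u] a unit and s r = r (1 + d). Then r^m moves by m r^m d up to terms of
    order d^2, and m is a unit; since [b > 0], these are of larger valuation. The unit [u]
    contributes less than d does. *)
Lemma fixed_shift_exact y (m : nat) : coprime m p -> y \in E ->
  veq y (#|A|%:R * m%:R) -> veq (s y - y) (#|A|%:R * m%:R + B).
Proof.
move=> cop yE ym; have [r [rE r1] sr] := exact_prime.
have B0 : 0 < B by rewrite mulr_gt0.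
have r0 := veq_neq0 vn_val r1.
pose d := s r / r - 1.
have dB : veq d B.
  have -> : d = (s r - r) * r^-1 by rewrite /d mulrBl divff.
  have -> : B = #|A|%:R + B + - #|A|%:R by ring.
  by apply: veqM => //; exact: veqV.
have srE : s r = r * (1 + d) by rewrite /d; field.
have rX k : vgt (s (r ^+ k) - r ^+ k - k%:R * r ^+ k * d) (#|A|%:R * k%:R + B).
  elim: k => [|k IH].
    by rewrite expr0 rmorph1 subrr !mul0r subr0; exact: vgt0.
  set Ak := s (r ^+ k) - _ - _ in IH.
  have -> : s (r ^+ k.+1) - r ^+ k.+1 - k.+1%:R * r ^+ k.+1 * d =
     k%:R * (r ^+ k.+1 * (d * d)) + r * (1 + d) * Ak.
    by rewrite /Ak !exprS rmorphM /= srE mulrSr; ring.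
  apply: vgtD => //.
    apply: (@vge_gt _ _ _ (k.+1%:R * #|A|%:R + (B + B))); last first.
      by rewrite mulrC ltrD2l ltrDl.
    apply: vge_natM => //; apply/veq_ge/veqM => //; last exact: veqM.
    exact: veqX.
  apply: (@vgtW _ _ _ (#|A|%:R + 0 + (#|A|%:R * k%:R + B))); last first.
    by rewrite mulrSr mulrDr mulr1 addr0 [_ + #|A|%:R]addrC addrA lexx.
  apply: vgeM_gt => //; apply: vgeM => //; first exact: veq_ge.
  by apply/veq_ge/veqD => //; [exact: veq1 | exact: vge_gt (veq_ge dB) B0].
have rXm : veq (s (r ^+ m) - r ^+ m) (#|A|%:R * m%:R + B).
  set x := s _ - _.
  have -> : x = m%:R * r ^+ m * d + (x - m%:R * r ^+ m * d) by ring.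
  apply: veqD => //; last exact: rX.
  apply: veqM => //; rewrite -[_ * m%:R]add0r [#|A|%:R * _]mulrC; apply: veqM => //.
    exact: (veq_nat vn_val p_pr).
  exact: veqX.
pose u := y * r ^- m.
have u0 : veq u 0.
  have -> : 0 = #|A|%:R * m%:R + - (m%:R * #|A|%:R) :> rat by ring.
  by apply: veqM => //; apply: veqV => //; exact: veqX.
have uE : u \in E by rewrite rpredM // rpredV rpredX.
(* The displacement of [u] is that of [u] minus its scalar residue, which has positive valuation. *)
have su : vgt (s u - u) B.
  have [c c0 uc] := residue_scalar v0_val vn_val vn_ram pin_prime (veq_ge u0).
  have cE : c%:A \in E by rewrite rpredZ // rpred1.
  have ucE : u - c%:A \in E by rewrite rpredB.
  have -> : s u - u = s (u - c%:A) - (u - c%:A).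
    by rewrite rmorphB /= gal_1; ring.
  by apply: vge_gt (fixed_shift_gt ucE uc) _; rewrite ltrDr.
have yu : y = r ^+ m * u by rewrite /u mulrC divfK // expf_neq0.
have -> : s y - y = (s (r ^+ m) - r ^+ m) * s u + r ^+ m * (s u - u).
  by rewrite yu rmorphM /=; ring.
apply: veqD => //.
  by rewrite -[X in veq _ X]addr0; apply: veqM => //; exact: veq_gal.
by apply: vgeM_gt => //; rewrite [#|A|%:R * _]mulrC; exact/veq_ge/veqX.
Qed.

Lemma fixed_shift_exactV y (m : nat) : coprime m p -> y \in E ->
  veq y (- (#|A|%:R * m%:R)) -> veq (s y - y) (#|A|%:R * (b - m%:R)).
Proof.
move=> cop yE ym; have y0 := veq_neq0 vn_val ym.
have yV : veq y^-1 (#|A|%:R * m%:R) by have := veqV vn_val ym; rewrite opprK.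
have := fixed_shift_exact cop (rpredVr yE) yV.
have sy0 : s y != 0 by rewrite fmorph_eq0.
have -> : s y - y = - (s y^-1 - y^-1) * (s y * y).
  by rewrite fmorphV; field; rewrite sy0 y0.
move=> h; have -> : #|A|%:R * (b - m%:R) =
  #|A|%:R * m%:R + B + (- (#|A|%:R * m%:R) + - (#|A|%:R * m%:R)) by ring.
by apply: veqM => //; [exact: veqN | apply: veqM => //; exact: veq_gal].
Qed.

End ExactShift.

End Herbrand.

(** * Binomials and digits *)

Section FieldBinomial.

Variable K : fieldType.
Implicit Types (x y : K) (k : nat).

(** The binomial coefficient of [x] over [k], meaningful for [k < p]. The product of fractions lets
    both its valuation and its variation with [x] be bounded factor by factor. *)
Definition fbin x k : K := \prod_(l < k) ((x - l%:R) / l.+1%:R).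

Lemma fbin0 x : fbin x 0 = 1. Proof. by rewrite /fbin big_ord0. Qed.

Lemma fbinS x k : fbin x k.+1 = fbin x k * ((x - k%:R) / k.+1%:R).
Proof. by rewrite /fbin big_ord_recr. Qed.

Lemma fbin_absorb x k : k.+1%:R != 0 :> K ->
  k.+1%:R * fbin x k.+1 = (x - k%:R) * fbin x k.
Proof. by move=> k0; rewrite fbinS mulrC -mulrA divfK // mulrC. Qed.

(** After multiplication by k + 1 = l + (k + 1 - l), the absorption identity lowers one of the two
    binomials in each term, and the two resulting sums recombine to the case [k]. *)
Lemma fbin_vandermonde x y k : (forall l, (l < k)%N -> l.+1%:R != 0 :> K) ->
  fbin (x + y) k = \sum_(l < k.+1) fbin x l * fbin y (k - l).
Proof.
elim: k => [|k IH] nz; first by rewrite big_ord1 !fbin0 mulr1.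
have k0 : k.+1%:R != 0 :> K by exact: nz.
apply: (mulfI k0); rewrite fbin_absorb // {}IH; last by move=> l lk; apply: nz; exact: ltnW.
have e : \sum_(l < k.+2) k.+1%:R * (fbin x l * fbin y (k.+1 - l)) =
   \sum_(l < k.+2) l%:R * (fbin x l * fbin y (k.+1 - l)) +
   \sum_(l < k.+2) (k.+1 - l)%:R * (fbin x l * fbin y (k.+1 - l)).
  rewrite -big_split; apply: eq_bigr => l _ /=.
  by rewrite -mulrDl -natrD subnKC // -ltnS.
rewrite !mulr_sumr e [X in _ = X + _]big_ord_recl [X in _ = _ + X]big_ord_recr /= mul0r add0r.
rewrite subnn mul0r addr0 -big_split; apply: eq_bigr => l _ /=.
have lk : (l <= k)%N by rewrite -ltnS.
have xl := fbin_absorb x (nz l (ltn_ord l)).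
have yl := fbin_absorb y (nz (k - l)%N (leq_ltn_trans (leq_subr _ _) (ltnSn _))).
rewrite /bump /= add1n subSS [l.+1%:R * _]mulrA xl subSn //.
rewrite [(k - l).+1%:R * _]mulrCA yl natrB //.
ring.
Qed.

Lemma fbin_pascal x k : (forall l, (l <= k)%N -> l.+1%:R != 0 :> K) ->
  fbin (x + 1) k.+1 = fbin x k.+1 + fbin x k.
Proof.
move=> nz; have k0 : k.+1%:R != 0 :> K by exact: nz.
suff -> : fbin (x + 1) k.+1 = fbin x k * ((x + 1) / k.+1%:R).
  rewrite fbinS -[X in _ = _ + X]mulr1 -mulrDr -[X in _ / _ + X](divff k0) -mulrDl.
  by rewrite -natr1; congr (_ * (_ / _)); ring.
elim: k nz k0 => [|k IH] nz k0.
  by rewrite fbinS !fbin0 subr0.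
have k1 : k.+1%:R != 0 :> K by exact: nz.
rewrite fbinS IH // ?fbinS; last by move=> l lk; apply: nz; exact: leqW.
have -> : x + 1 - k.+1%:R = x - k%:R by rewrite -natr1; ring.
by move: k.+1%:R^-1 k.+2%:R^-1 => c d; ring.
Qed.

Variable v : K -> \bar rat.
Hypothesis v_val : normalized_valuation v.
Variable p : nat.
Hypotheses (p_pr : prime p) (vp0 : val_gt v p%:R 0).

Lemma natS_neq0 l : (l.+1 < p)%N -> l.+1%:R != 0 :> K.
Proof. by move=> lp; apply: (veq_neq0 v_val (veq_nat_lt v_val p_pr vp0 _)); rewrite lp. Qed.

Lemma veq_natSV l : (l.+1 < p)%N -> val_is v l.+1%:R^-1 0.
Proof.
by move=> lp; rewrite -oppr0; apply: veqV => //; apply: (veq_nat_lt v_val p_pr vp0); rewrite lp.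
Qed.

Lemma vge_fbin_factor x q l : (l.+1 < p)%N -> q <= 0 -> val_ge v x q ->
  val_ge v ((x - l%:R) / l.+1%:R) q.
Proof.
move=> lp q0 xq; rewrite -[q]addr0; apply: vgeM => //; last exact/veq_ge/veq_natSV.
by apply: vgeB => //; exact: vgeW (vge_nat v_val l) q0.
Qed.

Lemma vge_fbin x q k : (k < p)%N -> q <= 0 -> val_ge v x q ->
  val_ge v (fbin x k) (k%:R * q).
Proof.
move=> kp q0 xq; rewrite mulr_natl -{2}[k]card_ord -sumr_const.
apply: vge_prod => // l _; apply: vge_fbin_factor => //.
exact: leq_ltn_trans (ltn_ord l) kp.
Qed.

Lemma veq_fbin x q k : (k < p)%N -> q < 0 -> val_is v x q ->
  val_is v (fbin x k) (k%:R * q).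
Proof.
move=> kp q0 xq; rewrite mulr_natl -{2}[k]card_ord -sumr_const.
apply: veq_prod => // l _; rewrite -[q]addr0; apply: veqM => //; last first.
  by apply: veq_natSV; exact: leq_ltn_trans (ltn_ord l) kp.
by apply: veqD => //; apply: vgtN => //; exact: vge_gt (vge_nat v_val l) q0.
Qed.

Lemma vge_fbinB x y q R k : (k < p)%N -> q <= 0 -> val_ge v x q -> val_ge v y q ->
  val_ge v (x - y) (q + R) -> val_ge v (fbin x k - fbin y k) (k%:R * q + R).
Proof.
move=> kp q0 xq yq xyR; rewrite mulr_natl -{3}[k]card_ord -sumr_const.
have lp (l : 'I_k) : (l.+1 < p)%N by exact: leq_ltn_trans (ltn_ord l) kp.
apply: vge_prodB => // l _; try exact: vge_fbin_factor.
rewrite -mulrBl opprB addrA addrNK -[_ + R]addr0; apply: vgeM => //.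
exact/veq_ge/veq_natSV.
Qed.

End FieldBinomial.

(** * Base p digits *)

Section Digits.

Lemma digit_expansion p n a : (a < p ^ n)%N ->
  (\sum_(1 <= i < n.+1) digit p a (n - i) * p ^ (n - i))%N = a.
Proof.
move=> an; rewrite big_add1 /= big_mkord.
rewrite (reindex_inj rev_ord_inj) /=.
have -> : (\sum_(j < n) digit p a (n - (n - j.+1).+1) * p ^ (n - (n - j.+1).+1) =
          \sum_(j < n) digit p a j * p ^ j)%N.
  by apply: eq_bigr => j _; congr (digit p a _ * p ^ _)%N; have := ltn_ord j; lia.
rewrite -[RHS](modn_small an) => {an}.
elim: n => [|n IH]; first by rewrite big_ord0 expn0 modn1.
rewrite big_ord_recr /= IH /digit addnC.
rewrite [RHS](divn_eq _ (p ^ n)) modn_dvdm ?expnS ?dvdn_mull //.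
by rewrite modn_divl mulnC.
Qed.

Lemma digit_lt p a k : (0 < p)%N -> (digit p a k < p)%N.
Proof. by move=> p0; rewrite /digit ltn_mod. Qed.

(** As the digit at [m] is nonzero, the subtraction needs no borrow and no other digit changes. *)
Lemma digit_sub p a m k : (1 < p)%N -> (1 <= digit p a m)%N ->
  (p ^ m <= a)%N /\ digit p (a - p ^ m) k = (digit p a k - (k == m))%N.
Proof.
move=> p1; rewrite /digit => d1.
have p0 : (0 < p)%N by exact: ltnW.
have pm0 : (0 < p ^ m)%N by rewrite expn_gt0 p0.
have c0 : (0 < a %/ p ^ m)%N by case: (a %/ _)%N d1 => //; rewrite mod0n.
have ma : (p ^ m <= a)%N by rewrite -divn_gt0.
split=> //.
have sub1 : ((a - p ^ m) %/ p ^ m)%N = (a %/ p ^ m).-1.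
  by rewrite -{1}[(p ^ m)%N]mul1n divnBMl // subn1.
have pc : ~~ (p %| a %/ p ^ m)%N by rewrite /dvdn -lt0n.
case: (ltngtP k m) => [km|mk|->].
- rewrite subn0 -(subnKC (ltnW km)) expnD [(p ^ k * _)%N]mulnC divnBMl.
  have /dvdnP[q qE] : (p %| p ^ (m - k))%N by rewrite dvdn_exp // subn_gt0.
  have le : (q * p <= a %/ p ^ k)%N.
    by rewrite -qE leq_divRL ?expn_gt0 ?p0 // -expnD subnK // ltnW.
  by rewrite qE -[in RHS](subnK le) addnC modnMDl.
- rewrite subn0 -(subnKC (ltnW mk)) expnD !divnMA sub1 divn_pred.
  rewrite (_ : (_ %| _)%N = false) ?subn0 //; apply/negbTE; apply: contra pc.
  by apply: dvdn_trans; rewrite dvdn_exp // subn_gt0.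
- rewrite sub1 modn_pred ?(gtn_eqF p1) // (negPf pc).
  by rewrite subn1.
Qed.

End Digits.

(** * Scaffolds from triangular generators *)

Lemma finite_choice (A : Type) (a0 : A) (P : nat -> A -> Prop) n :
  (forall i, (1 <= i <= n)%N -> exists x, P i x) ->
  exists f, forall i, (1 <= i <= n)%N -> P i (f i).
Proof.
elim: n => [|n IH] hP; first by exists (fun=> a0) => i; lia.
have [f hf] : exists f, forall i, (1 <= i <= n)%N -> P i (f i).
  by apply: IH => i i1; apply: hP; lia.
have [x hx] : exists x, P n.+1 x by apply: hP; lia.
exists (fun i => if i == n.+1 then x else f i) => i i1.
by case: eqP => [->//|ni]; apply: hf; lia.
Qed.

Lemma rmorph_fbin (K K' : fieldType) (f : {rmorphism K -> K'}) x k :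
  f (fbin x k) = fbin (f x) k.
Proof.
rewrite /fbin rmorph_prod; apply: eq_bigr => l _.
by rewrite fmorph_div rmorphB !rmorph_nat.
Qed.

(** * Operators given by the group algebra *)

Section GroupAlgebra.

Variables (F : fieldType) (L : splittingFieldType F).
Local Notation gT := (gal_of {:L}).
Implicit Types f g : L -> L.

(** Working with operators instead of coefficients replaces the convolution product by
    composition. *)
Definition in_group_algebra f : Prop :=
  exists Psi : {ffun gT -> F}, f =1 group_algebra_act Psi.

Lemma in_group_algebraD f g : in_group_algebra f -> in_group_algebra g ->
  in_group_algebra (fun x => f x + g x).
Proof.
move=> [P fP] [Q gQ]; exists [ffun s => P s + Q s] => x.
rewrite fP gQ /group_algebra_act -big_split; apply: eq_bigr => s _ /=.
by rewrite ffunE scalerDl.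
Qed.

Lemma in_group_algebraZ a f : in_group_algebra f ->
  in_group_algebra (fun x => a *: f x).
Proof.
move=> [P fP]; exists [ffun s => a * P s] => x.
rewrite fP /group_algebra_act scaler_sumr; apply: eq_bigr => s _ /=.
by rewrite ffunE scalerA.
Qed.

Lemma in_group_algebra0 : in_group_algebra (fun=> 0).
Proof.
exists [ffun=> 0] => x; rewrite /group_algebra_act big1 // => s _.
by rewrite ffunE scale0r.
Qed.

Lemma in_group_algebra_sum I (r : seq I) (P : pred I) (f : I -> L -> L) :
  (forall i, P i -> in_group_algebra (f i)) ->
  in_group_algebra (fun x => \sum_(i <- r | P i) f i x).
Proof.
move=> fP; elim: r => [|i r IH].
  by have [Q hQ] := in_group_algebra0; exists Q => x; rewrite big_nil -hQ.
case Pi : (P i); last by have [Q hQ] := IH; exists Q => x; rewrite big_cons Pi -hQ.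
have [Q hQ] := in_group_algebraD (fP i Pi) IH.
by exists Q => x; rewrite big_cons Pi -hQ.
Qed.

Lemma in_group_algebra_gal (s : gT) : s \in 'Gal({:L} / 1)%g ->
  in_group_algebra s.
Proof.
move=> sG; exists [ffun t => (t == s)%:R] => x.
rewrite /group_algebra_act (bigD1 s) //= ffunE eqxx scale1r big1 ?addr0 // => t.
by move=> /andP[_ /negPf ts]; rewrite ffunE ts scale0r.
Qed.

Lemma in_group_algebra_gal_comp (s : gT) f : s \in 'Gal({:L} / 1)%g ->
  in_group_algebra f -> in_group_algebra (fun x => s (f x)).
Proof.
move=> sG [P fP]; exists [ffun t => P (t * s^-1)%g] => x.
rewrite fP /group_algebra_act linear_sum [RHS](reindex_inj (mulIg s)) /=.
apply: eq_big => t; first by rewrite groupMr.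
by move=> _; rewrite linearZ ffunE mulgK galM ?memvf.
Qed.

Lemma in_group_algebra_comp f g : in_group_algebra f -> in_group_algebra g ->
  in_group_algebra (fun x => f (g x)).
Proof.
move=> [P fP] hg.
have [Q hQ] : in_group_algebra
    (fun x => \sum_(s in 'Gal({:L} / 1)%g) P s *: s (g x)).
  by apply: in_group_algebra_sum => s sG; exact/in_group_algebraZ/in_group_algebra_gal_comp.
by exists Q => x; rewrite fP -hQ.
Qed.

Lemma in_group_algebra_iter f k : in_group_algebra f -> in_group_algebra (iter k f).
Proof.
move=> hf; elim: k => [|k IH]; last exact: (in_group_algebra_comp hf IH).
by have [P hP] := in_group_algebra_gal (group1 'Gal({:L} / 1)%G); exists P => x; rewrite -hP gal_id.
Qed.

Section Linearity.

Variable f : L -> L.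
Hypothesis f_in : in_group_algebra f.

Lemma group_algebra_linD x y : f (x + y) = f x + f y.
Proof.
have [P fP] := f_in; rewrite !fP -big_split; apply: eq_bigr => s _ /=.
by rewrite linearD scalerDr.
Qed.

Lemma group_algebra_linZ a x : f (a *: x) = a *: f x.
Proof.
have [P fP] := f_in; rewrite !fP scaler_sumr; apply: eq_bigr => s _ /=.
by rewrite linearZ /= !scalerA mulrC.
Qed.

Lemma group_algebra_lin0 : f 0 = 0.
Proof. by rewrite -[X in f X](scale0r 0) group_algebra_linZ scale0r. Qed.

Lemma group_algebra_linB x y : f (x - y) = f x - f y.
Proof. by rewrite group_algebra_linD -scaleN1r group_algebra_linZ scaleN1r. Qed.

Lemma group_algebra_lin_sum I (r : seq I) (P : pred I) (g : I -> L) :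
  f (\sum_(i <- r | P i) g i) = \sum_(i <- r | P i) f (g i).
Proof. exact: (big_morph f group_algebra_linD group_algebra_lin0). Qed.

End Linearity.

End GroupAlgebra.

(** * Lowering operators on products of binomials *)

Section Scaffold.

Variables (F : fieldType) (L : splittingFieldType F).
Variables (v0 : F -> \bar rat) (vn : L -> \bar rat).
Hypotheses (v0_val : normalized_valuation v0) (vn_val : normalized_valuation vn).
Hypothesis vn_ram : totally_ramified v0 vn.
Variable pin : L.
Hypothesis pin_prime : val_is vn pin 1.

Local Notation gT := (gal_of {:L}).
Local Notation vge := (val_ge vn).
Local Notation vgt := (val_gt vn).
Local Notation veq := (val_is vn).

Variables (p n : nat).
Hypotheses (p_pr : prime p) (vp0 : vgt p%:R 0).
Hypothesis dimL : \dim {:L} = (p ^ n)%N.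

Variables (b : nat -> int) (T : nat) (Tol : nat -> rat).
Hypothesis b_gt0 : forall i, (1 <= i <= n)%N -> 0 < b i.
Hypothesis b_le : forall i j, (1 <= i)%N -> (i <= j)%N -> (j <= n)%N -> b i <= b j.
Hypothesis b_mod : forall i, (1 <= i <= n)%N -> (b i = b 1%N %[mod (p ^ n)%N])%Z.
Hypothesis b1_p : ~~ (p%:Z %| b 1%N)%Z.

Let s i : rat := (p ^ (n - i))%:R * (b i)%:~R.
Let c i j : rat := (p ^ (n - j))%:R * (b i)%:~R.

Hypothesis Tol_ge : forall i, (1 <= i <= n)%N -> T%:R <= Tol i.
Hypothesis Tol_step : forall i j, (1 <= i)%N -> (i < j)%N -> (j <= n)%N ->
  s i + Tol i <= c i j + Tol j.

Variables (sigma : nat -> gT) (X : nat -> L) (mu : nat -> nat -> F)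
  (eps : nat -> nat -> L).
Hypothesis sigmaG : forall i, (1 <= i <= n)%N -> sigma i \in 'Gal({:L} / 1)%g.
Hypothesis vX : forall j, (1 <= j <= n)%N -> veq (X j) (- s j).
Hypothesis sigmaX : forall i j, (1 <= i <= n)%N -> (1 <= j <= n)%N ->
  sigma i (X j) = X j + (mu i j)%:A + eps i j.
Hypothesis v_mu : forall i j, (1 <= i <= n)%N -> (1 <= j <= n)%N ->
  vge (mu i j)%:A (c i j - s j).
Hypothesis v_eps : forall i j, (1 <= i <= n)%N -> (1 <= j <= n)%N ->
  vge (eps i j) (s i + Tol i - s j).
Hypothesis mu_diag : forall i, (1 <= i <= n)%N -> mu i i = 1.
Hypothesis mu_lower : forall i j, (j < i)%N -> mu i j = 0.

Let p_gt0 : (0 < p)%N := prime_gt0 p_pr.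
Let p_gt1 : (1 < p)%N := prime_gt1 p_pr.

Let pX_gt0 k : 0 < (p ^ k)%:R :> rat.
Proof. by rewrite ltr0n expn_gt0 p_gt0. Qed.

Let s_gt0 i : (1 <= i <= n)%N -> 0 < s i.
Proof. by move=> i1; rewrite mulr_gt0 // (ltr_int _ 0); exact: b_gt0. Qed.

Let c_ge0 i j : (1 <= i <= n)%N -> 0 <= c i j.
Proof. by move=> i1; rewrite ltW // mulr_gt0 // (ltr_int _ 0); exact: b_gt0. Qed.

Let Tol_ge0 i : (1 <= i <= n)%N -> 0 <= Tol i.
Proof. by move=> i1; apply: le_trans (Tol_ge i1); rewrite ler0n. Qed.

Implicit Types (d : nat -> nat) (z : nat -> F).

Definition bounded_digits d := forall j, (1 <= j <= n)%N -> (d j < p)%N.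

Definition wt d : rat := - \sum_(1 <= j < n.+1) (d j)%:R * s j.

(** The translations [z] model the action of the group: [sigma i] moves [X j] by [mu i j] up to a
    small error, so it acts almost as the translation by [mu i]. *)
Definition shifted_monomial z d : L :=
  \prod_(1 <= j < n.+1) fbin (X j + (z j)%:A) (d j).

Local Notation E z d := (shifted_monomial z d).
Local Notation E0 d := (shifted_monomial (fun=> 0) d).

Definition dec d i k : nat -> nat := fun j => if j == i then (d j - k)%N else d j.

Lemma dec_bounded d i k : bounded_digits d -> bounded_digits (dec d i k).
Proof.
move=> hd j j1; rewrite /dec; case: eqP => _; last exact: hd.
by apply: leq_ltn_trans (hd j j1); exact: leq_subr.
Qed.

Lemma eq_shifted_monomial z z' d d' :
  (forall j, (1 <= j <= n)%N -> z j = z' j) ->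
  (forall j, (1 <= j <= n)%N -> d j = d' j) -> E z d = E z' d'.
Proof.
by move=> zz dd; apply: eq_big_nat => j j1; rewrite zz ?dd.
Qed.

Let mem_range i : (1 <= i <= n)%N -> i \in index_iota 1 n.+1.
Proof. by rewrite mem_index_iota ltnS. Qed.

Lemma wt_dec d i k : (1 <= i <= n)%N -> (k <= d i)%N ->
  wt (dec d i k) = wt d + k%:R * s i.
Proof.
move=> i1 kd; rewrite /wt !(bigD1_seq i) ?mem_range ?iota_uniq //=.
rewrite {1}/dec eqxx natrB //; set S := \sum_(_ <- _ | _) (d _)%:R * _.
rewrite (_ : \sum_(_ <- _ | _) _ = S); first by ring.
by apply: eq_bigr => j /negPf ji; rewrite /dec ji.
Qed.

Lemma veq_monomial d : bounded_digits d -> veq (E0 d) (wt d).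
Proof.
move=> hd; rewrite /wt -sumrN /shifted_monomial big_nat [X in veq _ X]big_nat.
apply: veq_prod => // j; rewrite ltnS => j1; rewrite scale0r addr0 -mulrN.
apply: (veq_fbin vn_val p_pr vp0); [exact: hd | | exact: vX].
by rewrite oppr_lt0 s_gt0.
Qed.

Lemma vge_shifted_monomial z d : bounded_digits d ->
  (forall j, (1 <= j <= n)%N -> vge (z j)%:A (- s j)) -> vge (E z d) (wt d).
Proof.
move=> hd hz; rewrite /wt -sumrN /shifted_monomial big_nat [X in vge _ X]big_nat.
apply: vge_prod => // j; rewrite ltnS => j1; rewrite -mulrN.
apply: (vge_fbin vn_val p_pr vp0); first exact: hd.
  by rewrite oppr_le0 ltW // s_gt0.
by apply: vgeD => //; [exact/veq_ge/vX | exact: hz].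
Qed.

Lemma mu_ge i j : (1 <= i <= n)%N -> (1 <= j <= n)%N -> vge (mu i j)%:A (- s j).
Proof.
by move=> i1 j1; apply: vgeW (v_mu i1 j1) _; rewrite lerDr c_ge0.
Qed.

(** In each factor the error [eps i j] lies [s i + Tol i] above the valuation of [X j]; telescoping
    a product preserves such a relative gain. *)
Lemma sigma_monomial i d : (1 <= i <= n)%N -> bounded_digits d ->
  vge (sigma i (E0 d) - E (mu i) d) (wt d + (s i + Tol i)).
Proof.
move=> i1 hd; rewrite rmorph_prod /wt -sumrN /shifted_monomial.
rewrite big_nat [X in vge (_ - X)]big_nat [X in vge _ (X + _)]big_nat.
apply: vge_prodB => // j; rewrite ltnS => j1 /=.
all: rewrite -[- (_ * s j)]mulrN ?rmorph_fbin ?scale0r ?addr0.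
- apply: (vge_fbin vn_val p_pr vp0); first exact: hd.
    by rewrite oppr_le0 ltW // s_gt0.
  exact/(veq_ge (veq_gal v0_val vn_val vn_ram pin_prime _ (vX j1))).
- apply: (vge_fbin vn_val p_pr vp0); first exact: hd.
    by rewrite oppr_le0 ltW // s_gt0.
  by apply: vgeD => //; [exact/veq_ge/vX | exact: mu_ge].
apply: (vge_fbinB vn_val p_pr vp0); first exact: hd.
- by rewrite oppr_le0 ltW // s_gt0.
- exact/(veq_ge (veq_gal v0_val vn_val vn_ram pin_prime _ (vX j1))).
- by apply: vgeD => //; [exact/veq_ge/vX | exact: mu_ge].
have /= -> := sigmaX i1 j1; rewrite addrAC subrr add0r addrC; exact: v_eps.
Qed.

Let natS_L l d i : bounded_digits d -> (1 <= i <= n)%N -> (l < d i)%N ->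
  l.+1%:R != 0 :> L.
Proof.
move=> hd i1 ld; apply: (natS_neq0 vn_val p_pr vp0).
by apply: leq_ltn_trans (hd i i1).
Qed.

Lemma scalar_fbin (a : F) k : (fbin a k)%:A = fbin (a%:A : L) k.
Proof. exact: (rmorph_fbin (in_alg L)). Qed.

(** By Vandermonde, translating one variable by [m] amounts to the truncated power with exponent [m]
    of the operator 1 + (lowering of the i-th digit). This is why truncated powers can undo the
    unwanted translations. *)
Lemma monomial_translate i m z d : (1 <= i <= n)%N -> bounded_digits d ->
  E (fun j => if j == i then z j + m else z j) d =
  \sum_(k < p) fbin m k *: (if (k <= d i)%N then E z (dec d i k) else 0).
Proof.
move=> i1 hd.
pose R := \prod_(j <- index_iota 1 n.+1 | j != i) fbin (X j + (z j)%:A) (d j).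
have dR k : E z (dec d i k) = fbin (X i + (z i)%:A) (d i - k) * R.
  rewrite /shifted_monomial (bigD1_seq i) ?mem_range ?iota_uniq //= {1}/dec eqxx.
  by congr (_ * _); apply: eq_bigr => j /negPf ji; rewrite /dec ji.
rewrite {1}/shifted_monomial (bigD1_seq i) ?mem_range ?iota_uniq //= eqxx.
rewrite (_ : \prod_(_ <- _ | _) _ = R); last first.
  by apply: eq_bigr => j /negPf ->.
have -> : X i + (z i + m)%:A = m%:A + (X i + (z i)%:A) by rewrite scalerDl; ring.
rewrite fbin_vandermonde; last by move=> l; exact: natS_L.
rewrite (big_ord_widen p (fun k => fbin m%:A k * fbin (X i + (z i)%:A) (d i - k))); last exact: hd.
rewrite big_mkcond mulr_suml; apply: eq_bigr => k _; rewrite ltnS.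
by case: ifP => _; rewrite ?mul0r ?scaler0 // dR -scalar_fbin mulr_algl scalerAl.
Qed.

Lemma monomial_succ i d : (1 <= i <= n)%N -> bounded_digits d ->
  E (fun j => if j == i then 1 else 0) d =
  E0 d + (if (1 <= d i)%N then E0 (dec d i 1) else 0).
Proof.
move=> i1 hd.
pose R := \prod_(j <- index_iota 1 n.+1 | j != i) fbin (X j) (d j).
have E0E d' : (forall j, j != i -> d' j = d j) -> E0 d' = fbin (X i) (d' i) * R.
  move=> dd; rewrite /shifted_monomial (bigD1_seq i) ?mem_range ?iota_uniq //=.
  congr (_ * _); first by rewrite scale0r addr0.
  by apply: eq_bigr => j ji; rewrite dd // scale0r addr0.
rewrite !E0E //; last by move=> j /negPf ji; rewrite /dec ji.
rewrite /shifted_monomial (bigD1_seq i) ?mem_range ?iota_uniq //= eqxx scale1r.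
rewrite (_ : \prod_(_ <- _ | _) _ = R); last first.
  by apply: eq_bigr => j /negPf ->; rewrite scale0r addr0.
rewrite /dec eqxx.
have := @natS_L _ _ _ hd i1; case: (d i) => [|k] nz.
  by rewrite !fbin0 addr0.
by rewrite subn1 /= fbin_pascal ?mulrDl // => l lk; exact: nz.
Qed.

(** Modulo p^n every b_i may be replaced by b_1, which leaves b_1 times the number with the given
    digits. As b_1 is prime to p, the values of [frak_b] therefore run through all residues. *)
Lemma frak_b_mod a : (a < p ^ n)%N ->
  (frak_b p n b a = b 1%N * a%:Z %[mod (p ^ n)%N])%Z.
Proof.
move=> an; apply/eqP; rewrite eqz_mod_dvd -[X in _ * X%:Z](digit_expansion an).
rewrite (big_morph Posz PoszD (erefl 0%:Z)) mulr_sumr /frak_b -sumrB big_nat.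
apply: rpred_sum => i; rewrite ltnS => i1; rewrite [b 1%N * _]mulrC -mulrBr.
by apply: dvdz_mull; rewrite -eqz_mod_dvd; apply/eqP/b_mod.
Qed.

Lemma coprime_b1 : coprimez (p ^ n)%N (b 1%N).
Proof.
by rewrite coprimezE /= coprimeXl // prime_coprime.
Qed.

Lemma frak_b_inj a a' : (a < p ^ n)%N -> (a' < p ^ n)%N ->
  (frak_b p n b a = frak_b p n b a' %[mod (p ^ n)%N])%Z -> a = a'.
Proof.
move=> an an'; rewrite !frak_b_mod // => /eqP; rewrite eqz_mod_dvd -mulrBr.
rewrite Gauss_dvdzr ?coprime_b1 // -eqz_mod_dvd !modz_nat !modn_small //.
by move=> /eqP[].
Qed.

Lemma frak_a_spec (t : int) : (frak_a p n b t < p ^ n)%N /\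
  (t = - frak_b p n b (frak_a p n b t) %[mod (p ^ n)%N])%Z.
Proof.
set P := fun a => (t == - frak_b p n b a %[mod (p ^ n)%N])%Z.
have N0 : (p ^ n)%N%:Z != 0 by rewrite -lt0n expn_gt0 p_gt0.
have hasP : has P (iota 0 (p ^ n)).
  (* [w] inverts b_1 modulo p^n, so the required number is the residue of -w t. *)
  have /coprimezP[[u w] /= uw] := coprime_b1.
  have r0 : 0 <= (- (w * t) %% (p ^ n)%N)%Z by rewrite modz_ge0.
  have rN : (- (w * t) %% (p ^ n)%N)%Z < (p ^ n)%N by rewrite ltz_pmod // ltz_nat expn_gt0 p_gt0.
  have [a aE] : exists a : nat, a%:Z = (- (w * t) %% (p ^ n)%N)%Z.
    by case: (_ %% _)%Z r0 => // a _; exists a.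
  rewrite -aE ltz_nat in rN; apply/hasP; exists a; first by rewrite mem_iota.
  have := frak_b_mod rN; move/eqP; rewrite /P !eqz_mod_dvd opprK => h1.
  have : ((p ^ n)%N %| a%:Z - - (w * t))%Z.
    by rewrite -eqz_mod_dvd aE modz_mod.
  rewrite opprK => h2.
  have -> : t + frak_b p n b a = (frak_b p n b a - b 1%N * a%:Z) +
      (b 1%N * (a%:Z + w * t) + (p ^ n)%N%:Z * (u * t)).
    by rewrite -[t in LHS]mul1r -uw; ring.
  by apply: rpredD => //; apply: rpredD; [exact: dvdz_mull | apply: dvdz_mulr; exact: dvdzz].
have lt : (find P (iota 0 (p ^ n)) < p ^ n)%N.
  by move: hasP; rewrite has_find size_iota.
split=> //; have := nth_find 0%N hasP; rewrite nth_iota // add0n.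
by move/eqP.
Qed.

Lemma frak_a_unique (t : int) a : (a < p ^ n)%N ->
  (t = - frak_b p n b a %[mod (p ^ n)%N])%Z -> frak_a p n b t = a.
Proof.
move=> an ta; have [fn tf] := frak_a_spec t; apply: frak_b_inj => //.
by apply/eqP; move: ta; rewrite tf => /eqP; rewrite !eqz_mod_dvd opprK addrC -opprB rpredN.
Qed.

Definition digits a : nat -> nat := fun j => digit p a (n - j).

Lemma digits_bounded a : bounded_digits (digits a).
Proof. by move=> j _; exact: digit_lt. Qed.

Lemma wt_digits a : wt (digits a) = (- frak_b p n b a)%:~R.
Proof.
rewrite /wt /frak_b mulrNz rmorph_sum; congr (- _); apply: eq_bigr => j _.
by rewrite /s /= rmorphM /= -pmulrn natrM mulrA.
Qed.

Lemma monomial_expansion y q : vge y q -> exists2 a : 'I_(p ^ n) -> F,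
  y = \sum_i a i *: E0 (digits i) & forall i, vge (a i *: E0 (digits i)) q.
Proof.
apply: (family_expansion v0_val vn_val vn_ram
  (t := fun i : 'I_(p ^ n) => - frak_b p n b i)).
- by move=> i; rewrite -wt_digits; apply: veq_monomial; exact: digits_bounded.
- move=> i j; rewrite dimL => /eqP; rewrite eqz_mod_dvd opprK addrC => h.
  apply/val_inj/(frak_b_inj (ltn_ord i) (ltn_ord j))/esym/eqP.
  by rewrite eqz_mod_dvd.
- by rewrite card_ord dimL.
Qed.

(** No term in the expansion of [y] falls below the bound for [y], so a relative estimate on the
    basis extends to all of L by F-linearity. *)
Lemma vge_operator f r : in_group_algebra f ->
  (forall d, bounded_digits d -> vge (f (E0 d)) (wt d + r)) ->
  forall y q, vge y q -> vge (f y) (q + r).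
Proof.
move=> f_in hf y q /monomial_expansion[a -> aq].
rewrite group_algebra_lin_sum //; apply: vge_sum => // i _.
rewrite group_algebra_linZ //; have dig := digits_bounded i.
have := aq i; case: (scalar_cases v0_val vn_ram (a i)) => [->|[m am]].
  by rewrite !scale0r => _; exact: vge0.
move=> /(veq_vge (veqZ vn_val am (veq_monomial dig))) le.
by apply: vgeW (vgeZ vn_val (veq_ge am) (hf _ dig)) _; rewrite addrA lerD2r.
Qed.

Definition lowering i (f : L -> L) : Prop :=
  [/\ in_group_algebra f, f 1 = 0 & forall d, bounded_digits d ->
      vge (f (E0 d) - (if (1 <= d i)%N then E0 (dec d i 1) else 0))
          (wt d + (s i + Tol i))].

Section Lowering.

Variables (i : nat) (f : L -> L).
Hypotheses (i1 : (1 <= i <= n)%N) (f_low : lowering i f).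

Let f_in : in_group_algebra f. Proof. by case: f_low. Qed.

Lemma vge_lowering y q : vge y q -> vge (f y) (q + s i).
Proof.
apply: vge_operator => // d hd; case: f_low => _ _ /(_ d hd).
case: ifP => [d1|_] h; last first.
  by rewrite subr0 in h; apply: vgeW h _; rewrite lerD2l lerDl Tol_ge0.
rewrite -[f _](subrK (E0 (dec d i 1))); apply: vgeD => //.
  by apply: vgeW h _; rewrite lerD2l lerDl Tol_ge0.
apply: vgeW (veq_ge (veq_monomial (dec_bounded i 1 hd))) _.
by rewrite wt_dec // mul1r.
Qed.

(** Each further application raises the earlier error by [s i], just as it raises the monomial, so
    the tolerance is not eroded. *)
Lemma iter_lowering d k : bounded_digits d ->
  vge (iter k f (E0 d) - (if (k <= d i)%N then E0 (dec d i k) else 0))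
      (wt d + (k%:R * s i + Tol i)).
Proof.
move=> hd; elim: k => [|k IH].
  rewrite /= (_ : E0 (dec d i 0) = E0 d) ?subrr; first exact: vge0.
  by apply: eq_shifted_monomial => // j _; rewrite /dec subn0 if_same.
rewrite iterS; set y := iter k f (E0 d) in IH *.
have := vge_lowering IH; rewrite group_algebra_linB // => h1.
have e : k.+1%:R * s i = k%:R * s i + s i by rewrite mulrSr mulrDl mul1r.
case: (leqP k (d i)) h1 => [kd|dk] h1; last first.
  rewrite group_algebra_lin0 // subr0 in h1; rewrite leqNgt ltnW //= subr0.
  by apply: vgeW h1 _; rewrite e; lra.
case: f_low => _ _ /(_ _ (dec_bounded i k hd)); rewrite wt_dec //.
rewrite (_ : dec d i k i = d i - k)%N; last by rewrite /dec eqxx.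
rewrite subn_gt0 (_ : E0 (dec (dec d i k) i 1) = E0 (dec d i k.+1)); last first.
  apply: eq_shifted_monomial => // j _; rewrite /dec; case: eqP => // _.
  by rewrite -subnDA addn1.
move=> h2; set a := (if _ then _ else _) in h2 *.
rewrite (_ : f y - a = f y - f (E0 (dec d i k)) + (f (E0 (dec d i k)) - a)); last by ring.
apply: vgeD => //; first by apply: vgeW h1 _; rewrite e; lra.
by apply: vgeW h2 _; rewrite e; lra.
Qed.

End Lowering.

(* With f = Theta - 1, this is Byott and Elder's truncated power Theta^[m]. *)
Definition truncated_power (f : L -> L) (m : F) (x : L) : L :=
  \sum_(k < p) fbin m k *: iter k f x.

Lemma in_group_algebra_truncated f m :
  in_group_algebra f -> in_group_algebra (truncated_power f m).
Proof.
move=> hf; apply: in_group_algebra_sum => k _.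
exact/in_group_algebraZ/in_group_algebra_iter.
Qed.

Definition partial_shift i j : nat -> F := fun k => if (k < j)%N then mu i k else 0.

(** The variables from [j] on have already been corrected. For [j = n + 1] the operator is [sigma i]
    itself; for [j = i + 1] only the translation of [X i] by [mu i i = 1] is left, because
    [mu i k = 0] for [k < i]. *)
Definition partial_translation i j (Q : L -> L) : Prop :=
  [/\ in_group_algebra Q, Q 1 = 1 & forall d, bounded_digits d ->
      vge (Q (E0 d) - E (partial_shift i j) d) (wt d + (s i + Tol i))].

Lemma vge_partial_translation i j Q : (1 <= i <= n)%N ->
  partial_translation i j Q -> forall y q, vge y q -> vge (Q y) q.
Proof.
move=> i1 [Q_in _ hQ] y q yq; rewrite -[q]addr0; apply: vge_operator yq => // d hd.
rewrite addr0 -[Q _](subrK (E (partial_shift i j) d)); apply: vgeD => //.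
  apply: vgeW (hQ d hd) _; rewrite lerDl addr_ge0 ?Tol_ge0 //.
  exact/ltW/s_gt0.
apply: vge_shifted_monomial => // k k1; rewrite /partial_shift.
case: ifP => _; first exact: mu_ge.
by rewrite scale0r; exact: vge0.
Qed.

Lemma partial_translation_step i j Q f : (1 <= i)%N -> (i < j)%N -> (j <= n)%N ->
  partial_translation i j.+1 Q -> lowering j f ->
  partial_translation i j (fun x => Q (truncated_power f (- mu i j) x)).
Proof.
move=> i_ge1 ij jn hQ hf.
have i1 : (1 <= i <= n)%N by lia.
have j1 : (1 <= j <= n)%N by lia.
have vQ := vge_partial_translation i1 hQ; case: hQ => Q_in Q1 QE.
have f_in : in_group_algebra f by case: hf.
have t_in := in_group_algebra_truncated (- mu i j) f_in.
split; first exact: in_group_algebra_comp.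
  rewrite -[RHS]Q1; congr (Q _); rewrite /truncated_power.
  have [k pk] : exists k, p = k.+1 by exists p.-1; rewrite prednK.
  rewrite pk big_ord_recl /= fbin0 scale1r big1 ?addr0 // => l _.
  rewrite /bump /= add1n; case: hf => _ f1 _.
  rewrite (_ : f _ = 0) ?scaler0 // => {}.
  elim: (nat_of_ord l) => [//|m IH]; rewrite iterS IH.
  exact: group_algebra_lin0.
move=> d hd.
(* Freezing the variable [j] means translating it back by [- mu i j], to which [monomial_translate]
   applies. *)
have zE : E (partial_shift i j) d =
    E (fun k => if k == j then partial_shift i j.+1 k + - mu i j
                else partial_shift i j.+1 k) d.
  apply: eq_shifted_monomial => // k _; rewrite /partial_shift ltnS.
  case: (ltngtP k j) => [||->]; rewrite ?subrr //.
rewrite zE monomial_translate // group_algebra_lin_sum // -sumrB.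
apply: vge_sum => // k _; rewrite group_algebra_linZ // -scalerBr.
have kp := ltn_ord k.
have cs : c i j - s j <= 0.
  by rewrite subr_le0 ler_pM2l // ler_int; apply: b_le => //; exact: ltnW.
have vb : vge (fbin (- mu i j) k)%:A (k%:R * (c i j - s j)).
  rewrite scalar_fbin; apply: (vge_fbin vn_val p_pr vp0) => //.
  by rewrite scaleNr; apply: vgeN => //; exact: v_mu.
have [k0|k0] := posnP k.
  rewrite k0 fbin0 scale1r /= (_ : E _ (dec d j 0) = E (partial_shift i j.+1) d).
    exact: QE.
  by apply: eq_shifted_monomial => // l _; rewrite /dec subn0 if_same.
(* A term with [k >= 1] has a coefficient of valuation at least [k (c i j - s j)], and the error of
   the k-th iterate gains [k s j + Tol j]. In total this is at least [c i j + Tol j], which must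
   reach [s i + Tol i]. *)
have step := Tol_step i_ge1 ij jn.
have c0 : 0 <= k%:R * c i j by rewrite mulr_ge0 ?ler0n ?c_ge0.
have c1 : c i j <= k%:R * c i j by rewrite ler_peMl ?c_ge0 // ler1n.
have h1 := vQ _ _ (iter_lowering j1 hf k hd).
rewrite group_algebra_linB // in h1.
have e1 : wt d + (s i + Tol i) <=
   k%:R * (c i j - s j) + (wt d + (k%:R * s j + Tol j)) by lra.
case: (leqP k (d j)) h1 => [kd|dk] h1; last first.
  rewrite group_algebra_lin0 // in h1.
  exact: vgeW (vgeZ vn_val vb h1) e1.
have h2 := QE _ (dec_bounded j k hd); rewrite wt_dec // in h2.
set A := Q (iter _ _ _) in h1 *; set B := E (partial_shift i j.+1) _ in h2 *.
rewrite (_ : A - B = A - Q (E0 (dec d j k)) + (Q (E0 (dec d j k)) - B)); last by ring.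
rewrite scalerDr; apply: vgeD => //; first exact: vgeW (vgeZ vn_val vb h1) e1.
by apply: vgeW (vgeZ vn_val vb h2) _; lra.
Qed.

Lemma lowering_step i (Phi : nat -> L -> L) : (1 <= i <= n)%N ->
  (forall j, (i < j)%N -> (j <= n)%N -> lowering j (Phi j)) ->
  exists f, lowering i f.
Proof.
move=> i1 hPhi.
have trans m : (m <= n - i)%N -> exists Q, partial_translation i (n.+1 - m) Q.
  elim: m => [|m IH] mn.
    exists (sigma i); split; [exact/in_group_algebra_gal/sigmaG | exact: rmorph1 |].
    move=> d hd; rewrite subn0 (_ : E (partial_shift i n.+1) d = E (mu i) d).
      exact: sigma_monomial.
    by apply: eq_shifted_monomial => // j /andP[_ jn]; rewrite /partial_shift ltnS jn.
  have [Q hQ] := IH (ltnW mn).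
  exists (fun x => Q (truncated_power (Phi (n.+1 - m.+1)%N) (- mu i (n.+1 - m.+1)) x)).
  apply: partial_translation_step; try lia.
    by rewrite -subSn ?subSS //; lia.
  by apply: hPhi; lia.
have [Q] := trans (n - i)%N (leqnn _).
rewrite (_ : n.+1 - (n - i) = i.+1)%N; last by lia.
(* By Pascal's rule, translation of [X i] by 1 minus the identity is the lowering of the i-th
   digit. *)
move=> [Q_in Q1 hQ]; exists (fun x => Q x - x); split.
- have [P hP] := in_group_algebraD Q_in (in_group_algebraZ (-1)
    (in_group_algebra_gal (group1 'Gal({:L} / 1)%G))).
  by exists P => x; rewrite -hP gal_id scaleN1r.
- by rewrite Q1 subrr.
move=> d hd; have := hQ d hd.
rewrite (_ : E (partial_shift i i.+1) d = E (fun j => if j == i then 1 else 0) d).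
  by rewrite monomial_succ // opprD addrA.
apply: eq_shifted_monomial => // j j1; rewrite /partial_shift ltnS.
by case: (ltngtP j i) => [/mu_lower||->] //; rewrite mu_diag.
Qed.

Lemma lowering_exists : exists Phi : nat -> L -> L,
  forall i, (1 <= i <= n)%N -> lowering i (Phi i).
Proof.
have h m : (m <= n)%N -> exists Phi : nat -> L -> L,
    forall i, (n - m < i)%N -> (i <= n)%N -> lowering i (Phi i).
  elim: m => [|m IH] mn; first by exists (fun=> id) => i; lia.
  have [Phi hPhi] := IH (ltnW mn).
  have [f hf] : exists f, lowering (n - m)%N f.
    by apply: (@lowering_step _ Phi) => //; lia.
  exists (fun i => if i == (n - m)%N then f else Phi i) => i i1 i2.
  by case: eqP => [->//|ni]; apply: hPhi => //; lia.
have [Phi hPhi] := h n (leqnn n).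
by exists Phi => i i1; apply: hPhi; lia.
Qed.

Lemma digits_dec a i : (1 <= i <= n)%N -> (1 <= digits a i)%N ->
  (p ^ (n - i) <= a)%N /\
  forall j, (1 <= j <= n)%N -> digits (a - p ^ (n - i)) j = dec (digits a) i 1 j.
Proof.
move=> i1 d1; have [pa _] := digit_sub 0 p_gt1 d1; split=> // j j1.
rewrite /dec /digits; have [_ ->] := digit_sub (n - j) p_gt1 d1.
have -> : (n - j == n - i)%N = (j == i) by lia.
by case: eqP => _; rewrite ?subn0.
Qed.

Theorem scaffold_of_generators : galois_scaffold p n v0 vn b T.
Proof.
have b_p i : (1 <= i <= n)%N -> coprimez (b i) p.
  move=> i1; rewrite coprimez_sym coprimezE /= prime_coprime //.
  apply: contra b1_p => pbi.
  have : (p%:Z %| b i - b 1%N)%Z.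
    apply: (@dvdz_trans (p ^ n)%N); first by rewrite dvdzE /= dvdn_exp //; lia.
    by rewrite -eqz_mod_dvd; apply/eqP/b_mod.
  move=> pb; rewrite (_ : b 1%N = b i - (b i - b 1%N)); last by ring.
  by apply: rpredB.
split=> //.
have [Phi hPhi] := lowering_exists.
have [Psi hPsi] : exists Psi : nat -> {ffun gT -> F},
    forall i, (1 <= i <= n)%N -> Phi i =1 group_algebra_act (Psi i).
  apply: (finite_choice [ffun=> 0] (P := fun i Q => Phi i =1 group_algebra_act Q)).
  by move=> i /hPhi[].
have [pi0 v_pi0] := val_onto v0_val.
have N0 : (p ^ n)%N%:Z != 0 by rewrite -lt0n expn_gt0 p_gt0.
(* The power of [pi0] that corrects the valuation [- frak_b (frak_a t)] of the monomial to [t]. *)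
pose K t := ((t + frak_b p n b (frak_a p n b t)) %/ (p ^ n)%N)%Z.
have KE t : (p ^ n)%N%:Z * K t = t + frak_b p n b (frak_a p n b t).
  rewrite mulrC divzK // -[X in _ + X]opprK -eqz_mod_dvd.
  by apply/eqP; have [] := frak_a_spec t.
pose lambda t : L := (pi0 ^ K t) *: E0 (digits (frak_a p n b t)).
have pi0_neq0 : pi0 != 0 := veq_neq0 v0_val v_pi0.
have v_piz (k : int) : veq (pi0 ^ k)%:A ((p ^ n)%:R * k%:~R).
  rewrite -dimL; apply: (veq_scalar vn_ram).
  case: k => k; first by have := veqX v0_val k v_pi0; rewrite mulr1.
  have := veqV v0_val (veqX v0_val k.+1 v_pi0).
  by rewrite mulr1 NegzE mulrNz -pmulrn.
have v_lambda t : veq (lambda t) t%:~R.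
  have := veqZ vn_val (v_piz (K t)) (veq_monomial (digits_bounded (frak_a p n b t))).
  rewrite wt_digits [(p ^ n)%:R]pmulrn -intrM KE -intrD addrK.
  by [].
exists lambda, Psi, pi0; split=> //.
- move=> t.
  have aE : frak_a p n b (t + (p ^ n)%N%:Z) = frak_a p n b t.
    have [fn tf] := frak_a_spec t.
    by apply: frak_a_unique => //; rewrite addrC modzDl.
  rewrite /lambda scalerA aE -{2}[pi0]expr1z -expfzDr //; congr (_ ^ _ *: _).
  by apply: (mulfI N0); rewrite KE aE addrAC -KE; ring.
- by move=> i i1; rewrite -hPsi //; case: (hPhi i i1).
move=> i j i1 /=; set a := frak_a p n b j.
set l := lambda (j + _); set cond := (1 <= _)%N.
have vl : veq l (j%:~R + s i).
  have := v_lambda (j + (p ^ (n - i))%N%:Z * b i).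
  by rewrite intrD intrM -pmulrn.
have l0 := veq_neq0 vn_val vl.
set r := _ - _; exists (l^-1 * r); last by rewrite mulrA mulfV // mul1r.
(* As [l] has valuation [j + s i], a relative error of order T is an absolute one of order
   [j + s i + T]. *)
suff vr : vge r (j%:~R + (s i + Tol i)).
  apply: vgeW (vgeM vn_val (veq_ge (veqV vn_val vl)) vr) _.
  by have := Tol_ge i1; lra.
have [low_in _ low] := hPhi i i1; have dig := digits_bounded a.
have lowa := low _ dig.
have -> : r = (pi0 ^ K j) *: (Phi i (E0 (digits a)) -
    (if (1 <= digits a i)%N then E0 (dec (digits a) i 1) else 0)).
  rewrite /r -hPsi // {1}/lambda group_algebra_linZ // scalerBr; congr (_ - _).
  rewrite -/(digits a i) -/cond; case: ifP => // d1; last by rewrite scaler0.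
  have [pa digE] := digits_dec i1 d1.
  have [an ja] := frak_a_spec j; rewrite -/a in an ja.
  have fb : frak_b p n b (a - p ^ (n - i))%N = frak_b p n b a - (p ^ (n - i))%N%:Z * b i.
    apply: (@intr_inj rat); apply: oppr_inj; rewrite -mulrNz -wt_digits.
    rewrite (_ : wt _ = wt (dec (digits a) i 1)); last first.
      by rewrite /wt; congr (- _); apply: eq_big_nat => k k1; rewrite digE.
    by rewrite wt_dec // wt_digits mul1r intrB intrM /s -pmulrn mulrNz; ring.
  (* Raising [j] by p^(n-i) b_i lowers the i-th digit without borrow. The changes of [j] and of
     [frak_b] cancel, so the exponent [K] is the same. *)
  have aE : frak_a p n b (j + (p ^ (n - i))%N%:Z * b i) = (a - p ^ (n - i))%N.
    apply: frak_a_unique; first by apply: leq_ltn_trans an; exact: leq_subr.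
    by rewrite fb opprB addrC -modzDmr ja modzDmr.
  rewrite /l /lambda aE; congr (_ ^ _ *: _).
    apply: (mulfI N0); rewrite !KE aE fb -/a; ring.
  by apply: eq_shifted_monomial.
rewrite (_ : j%:~R + _ = (p ^ n)%:R * (K j)%:~R + (wt (digits a) + (s i + Tol i))).
  exact: vgeZ (veq_ge (v_piz _)) lowa.
rewrite [(p ^ n)%:R]pmulrn -intrM KE -/a wt_digits [RHS]addrA; congr (_ + _).
by rewrite -intrD addrK.
Qed.

End Scaffold.

(** * Arithmetic of the breaks *)

Section ArtinSchreierMap.

Variables (F : fieldType) (L : splittingFieldType F) (vn : L -> \bar rat).
Hypothesis vn_val : normalized_valuation vn.
Variable p : nat.
Hypothesis p_pr : prime p.

Let p_gt1 : 1 < p%:R :> rat. Proof. by rewrite ltr1n prime_gt1. Qed.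

Lemma veq_wp y q : q < 0 -> val_is vn y q -> val_is vn (wp p y) (p%:R * q).
Proof.
move=> q0 yq; apply: veqD => //; first exact: veqX.
apply: vgtN => //; apply: vge_gt (veq_ge yq) _.
by rewrite -subr_gt0 -{1}[q]mul1r -mulrBl nmulr_lgt0 // subr_lt0.
Qed.

Lemma wp_vgt y q : q < 0 -> val_gt vn (wp p y) (p%:R * q) -> val_gt vn y q.
Proof.
move=> q0 wq; have [//|/negP/(vgeNgt vn_val)[m ym mq]] := boolP (q%:E < vn y)%E.
have m0 : m%:~R < 0 :> rat by exact: le_lt_trans q0.
have := veq_vgt (veq_wp m0 ym) wq.
by rewrite ltr_pM2l ?(lt_trans ltr01) // ltNge mq.
Qed.

(** [wp] preserves integrality, so [y] must have negative valuation, where the p-th power dominates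
    and the valuation of [wp y] determines that of [y]. *)
Lemma wp_veq y q : q < 0 -> val_is vn (wp p y) (p%:R * q) -> val_is vn y q.
Proof.
move=> q0 wq; have p0 : p%:R != 0 :> rat by rewrite gt_eqF // (lt_trans ltr01).
case: (val_cases vn_val y) => [y0|[m ym]].
  move: wq; rewrite /wp y0 expr0n (gtn_eqF (prime_gt0 p_pr)) subr0 /val_is.
  by rewrite (val0 vn_val).
have [m0|m0] := ltP (m%:~R : rat) 0.
  by have /(mulfI p0) <- := veq_inj (veq_wp m0 ym) wq.
have y0 : val_ge vn y 0 by exact: vgeW (veq_ge ym) m0.
have : val_ge vn (wp p y) 0.
  by apply: vgeB => //; have := vgeX vn_val p y0; rewrite mulr0.
by move=> /(veq_vge wq); rewrite leNgt pmulr_rlt0 ?q0 // (lt_trans ltr01).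
Qed.

Lemma vgtX0 y k : (0 < k)%N -> val_gt vn y 0 -> val_gt vn (y ^+ k) 0.
Proof.
case: k => // k _ y0; rewrite exprSr -[0]addr0; apply: vgeM_gt => //.
by have := vgeX vn_val k (vgt_ge y0); rewrite mulr0.
Qed.

Variable P0 : rat.
Hypotheses (vp : val_ge vn p%:R P0) (P0_ge0 : 0 <= P0).

(* Expanding wp (x + a) = wp x, the binomial terms bound a^p - a, hence eta.  *)
Lemma vge_wp_translation x x' q : val_ge vn x q -> q <= 0 ->
  wp p x' = wp p x -> val_gt vn (x' - x - 1) 0 ->
  val_ge vn (x' - x - 1) (P0 + (p%:R - 1) * q).
Proof.
move=> xq q0 wpE eta0; set eta := x' - x - 1 in eta0 *.
have e0 := vgt_ge eta0; have v1 := veq_ge (veq1 vn_val).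
have x'E : x' = x + (1 + eta) by rewrite /eta; ring.
have h1 := vge_frobenius_integral vn_val p_pr vp xq q0 (vgeD vn_val v1 e0).
have h2 := vge_frobenius vn_val p_pr vp v1 e0.
rewrite mulr0 addr0 expr1n in h2.
have h3 : val_ge vn (eta ^+ p - eta) (P0 + (p%:R - 1) * q).
  have -> : eta ^+ p - eta =
    - ((x + (1 + eta)) ^+ p - x ^+ p - (1 + eta) ^+ p)
    - ((1 + eta) ^+ p - 1 - eta ^+ p).
    have := wpE; rewrite /wp x'E => w.
    have -> : (x + (1 + eta)) ^+ p = x ^+ p - x + (x + (1 + eta)) by rewrite -w; ring.
    by ring.
  apply: vgeB => //; first exact: vgeN.
  apply: vgeW h2 _; rewrite gerDl; apply: mulr_ge0_le0 => //.
  by rewrite subr_ge0 ltW.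
case: (vgtP vn_val eta0) => [->|[m em m0]]; first exact: vge0.
apply: vgeW (veq_ge em) _; apply: veq_vge h3.
rewrite addrC; apply: veqD => //; first exact: veqN.
apply: vge_gt (veq_ge (veqX vn_val p em)) _.
by rewrite ltr_pMl.
Qed.

End ArtinSchreierMap.

(** * Identities and inequalities between the breaks *)

Section Breaks.

Variables (p n : nat) (b : nat -> int).
Hypothesis p_gt1 : (1 < p)%N.
Hypothesis b_le : forall i j, (1 <= i)%N -> (i <= j)%N -> (j <= n)%N -> b i <= b j.
Hypothesis b_gt0 : forall i, (1 <= i <= n)%N -> 0 < b i.

Local Notation u := (upper_break p b).
Local Notation C := (Cbound p b).

(** In the valuation of L, [level_break i] is the pole order of X_i, [sub_u i] that of x_i, and
    [scaled_u i] that of wp(x_i). *)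
Definition level_break i : rat := (p ^ (n - i))%:R * (b i)%:~R.
Local Notation s := level_break.
Definition scaled_C i : rat := (p ^ n)%:R * C i.
Definition scaled_u i : rat := (p ^ n)%:R * u i.
Definition sub_u i : rat := (p ^ n.-1)%:R * u i.
(** This equals p^(n-1) C_(i-1), the excess of the pole order of x_i over that of X_i. *)
Definition tol_sum i : rat :=
  (p%:R - 1) * \sum_(1 <= k < i) (p ^ (n - k - 1))%:R * (b k)%:~R.

Let pX_gt0 k : 0 < (p ^ k)%:R :> rat.
Proof. by rewrite ltr0n expn_gt0 (ltnW p_gt1). Qed.

Let pX_neq0 k : (p ^ k)%:R != 0 :> rat.
Proof. by rewrite gt_eqF. Qed.

Let p_ge1 : 1 <= p%:R :> rat. Proof. by rewrite ler1n ltnW. Qed.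

Lemma upper_break1 : u 1 = (b 1%N)%:~R.
Proof. by rewrite /upper_break big_geq // addr0. Qed.

Lemma upper_breakS i : (1 <= i)%N ->
  u i.+1 = u i + ((b i.+1)%:~R - (b i)%:~R) / (p ^ i)%:R.
Proof. by move=> i1; rewrite /upper_break big_nat_recr //= addrA. Qed.

Lemma CboundE i : (1 <= i)%N -> C i = u i - (b i)%:~R / (p ^ i)%:R.
Proof. by case: i. Qed.

Lemma upper_break_Cbound i : (1 <= i)%N ->
  u i = C i.-1 + (b i)%:~R / (p ^ i.-1)%:R.
Proof.
case: i => // -[|i] _; first by rewrite upper_break1 /Cbound add0r expn0 divr1.
by rewrite upper_breakS // CboundE //= mulrBl; ring.
Qed.

Lemma level_breakE i : (i <= n)%N -> s i = (p ^ n)%:R * ((b i)%:~R / (p ^ i)%:R).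
Proof.
move=> ni; rewrite -[n in (p ^ n)%:R](subnK ni) expnD natrM -mulrA.
by rewrite [X in _ = _ * X]mulrC divfK.
Qed.

Lemma scaled_u_C i : (1 <= i <= n)%N -> scaled_u i = scaled_C i + s i.
Proof.
by move=> /andP[i1 ni]; rewrite /scaled_u /scaled_C level_breakE // CboundE //; ring.
Qed.

Lemma scaled_u_pred i : (1 <= i <= n)%N -> scaled_u i = scaled_C i.-1 + p%:R * s i.
Proof.
move=> /andP[i1 ni]; rewrite /scaled_u /scaled_C level_breakE // upper_break_Cbound //.
have p0 : p%:R != 0 :> rat by have := pX_neq0 1; rewrite expn1.
have -> : (p ^ i)%:R = p%:R * (p ^ i.-1)%:R :> rat by rewrite -natrM -expnS prednK.
rewrite invfM mulrDr; congr (_ + _); rewrite [RHS]mulrCA; congr (_ * _).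
by rewrite mulrCA mulVKf.
Qed.

Lemma p_sub_u i : (0 < n)%N -> p%:R * sub_u i = scaled_u i.
Proof.
by move=> n0; rewrite /sub_u /scaled_u mulrA -natrM -expnS prednK.
Qed.

Lemma s_gt0 i : (1 <= i <= n)%N -> 0 < s i.
Proof. by move=> i1; rewrite mulr_gt0 // (ltr_int _ 0); exact: b_gt0. Qed.

Lemma scaled_C_step i : (1 <= i <= n)%N -> scaled_C i = scaled_C i.-1 + (p%:R - 1) * s i.
Proof. by move=> i1; have := scaled_u_C i1; rewrite (scaled_u_pred i1); lra. Qed.

Lemma scaled_C_le i j : (i <= j)%N -> (j <= n)%N -> scaled_C i <= scaled_C j.
Proof.
elim: j => [|j IH]; first by rewrite leqn0 => /eqP ->.
rewrite leq_eqVlt => /orP[/eqP -> //|]; rewrite ltnS => ij jn.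
apply: le_trans (IH ij (ltnW jn)) _; rewrite (@scaled_C_step j.+1) //= lerDl.
by rewrite mulr_ge0 ?subr_ge0 // ltW // s_gt0.
Qed.

Lemma scaled_C_ge0 i : (i <= n)%N -> 0 <= scaled_C i.
Proof. by move=> ni; have := scaled_C_le (leq0n i) ni; rewrite {1}/scaled_C mulr0. Qed.

Lemma upper_break_le i j : (1 <= i)%N -> (i <= j)%N -> (j <= n)%N -> u i <= u j.
Proof.
move=> i1; elim: j => [|j IH]; first by case: i i1.
rewrite leq_eqVlt => /orP[/eqP -> //|]; rewrite ltnS => ij jn.
apply: le_trans (IH ij (ltnW jn)) _; rewrite upper_breakS ?(leq_trans i1) // lerDl.
apply: divr_ge0; last exact: ltW.
by rewrite subr_ge0 ler_int; apply: b_le => //; lia.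
Qed.

Lemma pX_sub_mul i j : (1 <= i)%N -> (i <= j)%N -> (j < n)%N ->
  ((p ^ (n - j))%:R - (p ^ (n - j.+1))%:R) * (b i)%:~R =
  (p%:R - 1) * ((p ^ (n - j.+1))%:R * (b i)%:~R) :> rat.
Proof.
by move=> i1 ij jn; rewrite -{1}(subnSK jn) expnS natrM; ring.
Qed.

(** The left side telescopes into the terms (p-1) p^(n-k) b_i for i < k <= j; replacing b_i by b_k
    in each gives the increments of C on the right. *)
Lemma scaled_C_gap i j : (1 <= i)%N -> (i <= j)%N -> (j <= n)%N ->
  s i - (p ^ (n - j))%:R * (b i)%:~R <= scaled_C j - scaled_C i.
Proof.
move=> i1; elim: j => [|j IH]; first by case: i i1.
rewrite leq_eqVlt => /orP[/eqP -> jn|]; first by rewrite !subrr.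
rewrite ltnS => ij jn; have := IH ij (ltnW jn); rewrite (@scaled_C_step j.+1) //=.
have e := pX_sub_mul i1 ij jn.
have : (p%:R - 1) * ((p ^ (n - j.+1))%:R * (b i)%:~R) <= (p%:R - 1) * s j.+1.
  rewrite ler_wpM2l ?subr_ge0 // ler_pM2l // ler_int.
  by apply: b_le => //; exact: leqW.
by move: e; lra.
Qed.

(** The same telescoping, compared with the increments (p-1) p^(n-k-1) b_k. It yields the
    compatibility of tolerances between levels that the scaffold requires. *)
Lemma tol_sum_gap i j : (1 <= i)%N -> (i <= j)%N -> (j <= n)%N ->
  s i - (p ^ (n - j))%:R * (b i)%:~R <= tol_sum j - tol_sum i.
Proof.
move=> i1; elim: j => [|j IH]; first by case: i i1.
rewrite leq_eqVlt => /orP[/eqP -> jn|]; first by rewrite !subrr.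
rewrite ltnS => ij jn; have := IH ij (ltnW jn).
rewrite {3}/tol_sum big_nat_recr ?(leq_trans i1) //= mulrDr -/(tol_sum j).
have e := pX_sub_mul i1 ij jn.
have : (p%:R - 1) * ((p ^ (n - j.+1))%:R * (b i)%:~R) <=
       (p%:R - 1) * ((p ^ (n - j - 1))%:R * (b j)%:~R) :> rat.
  rewrite ler_wpM2l ?subr_ge0 // -subnDA addn1 ler_pM2l // ler_int.
  by apply: b_le => //; exact: ltnW.
by move: e; lra.
Qed.

Lemma p_tol_sum i : (1 <= i <= n)%N -> p%:R * tol_sum i = scaled_C i.-1.
Proof.
elim: i => // -[|i] IH i1.
  by rewrite /tol_sum big_geq // !mulr0 /scaled_C mulr0.
have i2 : (1 <= i.+1 <= n)%N by lia.
rewrite [RHS](scaled_C_step i2) -(IH i2) {1}/tol_sum big_nat_recr //=.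
rewrite !mulrDr -/(tol_sum i.+1); congr (_ + _).
rewrite mulrCA; congr (_ * _); rewrite mulrA -natrM -expnS /level_break.
by congr ((p ^ _)%:R * _); lia.
Qed.

Lemma sub_uE i : (1 <= i <= n)%N -> sub_u i = tol_sum i + s i.
Proof.
move=> i1; have p0 : p%:R != 0 :> rat by have := pX_neq0 1; rewrite expn1.
apply: (mulfI p0); rewrite p_sub_u ?mulrDr ?p_tol_sum ?scaled_u_pred //; lia.
Qed.

Lemma tol_sum_ge0 i : (i <= n)%N -> 0 <= tol_sum i.
Proof.
move=> ni; rewrite mulr_ge0 ?subr_ge0 // big_nat sumr_ge0 // => k /andP[k1 ki].
rewrite mulr_ge0 ?ltW // (ltr_int _ 0); apply: b_gt0.
by rewrite k1 (leq_trans (ltnW ki)).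
Qed.

(** Consecutive upper breaks differ by (b_(i+1) - b_i)/p^i with i >= 1; this denominator improves
    the modulus p^(n-1) to at least p^n. *)
Lemma breaks_congr : (forall i, (1 <= i <= n)%N -> congq (p ^ n.-1) (u i) (u 1%N)) ->
  forall i, (1 <= i <= n)%N -> (b i = b 1%N %[mod (p ^ n)%N])%Z.
Proof.
move=> hu; elim=> // -[//|i] IH i1.
have i2 : (1 <= i.+1 <= n)%N by lia.
rewrite -(IH i2); apply/eqP; rewrite eqz_mod_dvd.
have /intrP[k1 k1E] := hu _ i1; have /intrP[k2 k2E] := hu _ i2.
have e : b i.+2 - b i.+1 = (p ^ n)%N%:Z * ((p ^ i)%N%:Z * (k1 - k2)).
  apply: (@intr_inj rat); rewrite !intrM !intrB -k1E -k2E -!pmulrn.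
  rewrite upper_breakS // -mulrBl.
  rewrite (_ : (p ^ n)%:R = p%:R * (p ^ n.-1)%:R); last first.
    by rewrite -natrM -expnS prednK //; lia.
  rewrite (_ : (p ^ i.+1)%:R = p%:R * (p ^ i)%:R); last by rewrite -natrM -expnS.
  have p0 : p%:R != 0 :> rat by have := pX_neq0 1; rewrite expn1.
  move: (pX_neq0 i) (pX_neq0 n.-1) => h1 h2.
  by field; rewrite p0 h1 h2.
by rewrite e; apply: dvdz_mulr; exact: dvdzz.
Qed.

Lemma break1_coprime : u 1%N / p%:R \isn't a Num.int -> ~~ (p%:Z %| b 1%N)%Z.
Proof.
apply: contra => /dvdzP[k kE]; rewrite upper_break1 kE intrM -pmulrn mulfK.
  by apply/intrP; exists k.
by have := pX_neq0 1; rewrite expn1.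
Qed.

End Breaks.

(** * Construction of the generators *)

Section Main.

Variables (p n : nat) (F : fieldType) (L : splittingFieldType F).
Variables (v0 : F -> \bar rat) (v : {subfield L} -> L -> \bar rat).
Variables (vn : L -> \bar rat) (pin : L).
Variables (H : nat -> {group gal_of {:L}}) (sigma : nat -> gal_of {:L}).
Variables (b : nat -> int) (T : nat).

Local Notation gT := (gal_of {:L}).
Local Notation vge := (val_ge vn).
Local Notation vgt := (val_gt vn).
Local Notation veq := (val_is vn).
Local Notation G := 'Gal({:L} / 1)%G.
Local Notation u := (upper_break p b).
Local Notation C := (Cbound p b).

Hypothesis v0_val : normalized_valuation v0.
Hypothesis v0_residue : perfect_residue_field p v0.
Hypothesis n_gt1 : (1 < n)%N.
Hypothesis galL : galois 1%VS {:L}%VS.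
Hypothesis dimL : \dim {:L} = (p ^ n)%N.
Hypothesis abelemG : (p.-abelem 'Gal({:L} / 1))%g.
Hypothesis vn_val : normalized_valuation vn.
Hypothesis vn_ram : totally_ramified v0 vn.
Hypothesis v_norm : forall E, normalized_on vn E (v E).
Hypothesis pin_prime : vn pin = 1%:E.
Hypothesis H_chain : ramification_chain p n vn pin H.
Hypothesis sigmaH : forall i, (1 <= i <= n)%N -> sigma i \in H i.-1 :\: H i.
Hypothesis bE : forall i, (1 <= i <= n)%N ->
  (vn (sigma i pin - pin)%R - 1%:E)%E = (b i)%:~R%:E.

Let pin_prime' : veq pin 1 := pin_prime.
Let p_pr : prime p. Proof. by case: v0_residue. Qed.
Let p_gt0 : (0 < p)%N := prime_gt0 p_pr.
Let p_gt1 : (1 < p)%N := prime_gt1 p_pr.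

(** * The ramification chain and its lower breaks *)

Lemma card_gal : #|G| = (p ^ n)%N.
Proof. by rewrite -(galois_dim galL) dimL dimv1 divn1. Qed.

Lemma chain_sub i j : (i <= j)%N -> (j <= n)%N -> H j \subset H i.
Proof.
case: H_chain => _ _ Hs _; elim: j => [|j IH]; first by rewrite leqn0 => /eqP ->.
rewrite leq_eqVlt => /orP[/eqP -> //|]; rewrite ltnS => ij jn.
by apply: subset_trans (IH ij (ltnW jn)); have [] := Hs j.+1 jn.
Qed.

Lemma chain_gal i : (i <= n)%N -> H i \subset G.
Proof. by move=> ni; have := chain_sub (leq0n i) ni; case: H_chain => ->. Qed.

Lemma card_chain i : (i <= n)%N -> #|H i| = (p ^ (n - i))%N.
Proof.
move=> ni; rewrite -{1}(subKn ni); move: (n - i)%N (leq_subr i n) => m.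
case: H_chain => _ Hn Hs _; elim: m => [|m IH] mn.
  by rewrite subn0 Hn cards1 expn0.
have hm : (1 <= n - m <= n)%N by lia.
have [sub ind] := Hs _ hm.
rewrite (_ : n - m.+1 = (n - m).-1)%N; last by lia.
by rewrite -(Lagrange sub) ind IH 1?ltnW // expnSr.
Qed.

Lemma sigma_gal i : (1 <= i <= n)%N -> sigma i \in G.
Proof.
move=> i1; have := sigmaH i1; rewrite inE => /andP[_].
by apply/subsetP/chain_gal; lia.
Qed.

Lemma veq_sigma_pin i : (1 <= i <= n)%N -> veq (sigma i pin - pin) ((b i)%:~R + 1).
Proof.
move=> i1; rewrite /val_is; have := bE i1; case: (vn _) => // r [] <-.
by rewrite subrK.
Qed.

Lemma ramification_groupE (t : int) s : s \in G ->
  (s \in ramification_group vn pin t) = ((t%:~R + 1)%:E <= vn (s pin - pin)%R)%E.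
Proof. by move=> sG; rewrite inE sG. Qed.

Lemma chain_mem_lt i k s : (k <= n)%N -> (1 <= i <= n)%N ->
  s \in H k -> s \notin H i -> (k < i)%N.
Proof.
move=> kn i1 sk; apply: contraNltn => ik.
by apply: (subsetP (chain_sub ik kn)).
Qed.

(** The ramification group of index b_i is some H_k that contains [sigma i]. Since [sigma i] is not
    in H_i, k < i, and so this group contains H_(i-1). *)
Lemma chain_vge i s : (1 <= i <= n)%N -> s \in H i.-1 ->
  vge (s pin - pin) ((b i)%:~R + 1).
Proof.
move=> i1 si; have [_ _ _ /(_ (b i))[k kn Gk]] := H_chain.
have := sigmaH i1; rewrite inE => /andP[sn _].
have sk : sigma i \in H k.
  by rewrite -Gk ramification_groupE ?sigma_gal // (veq_sigma_pin i1).
have ki := chain_mem_lt kn i1 sk sn.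
have sG : s \in G by apply: (subsetP (chain_gal _)) si; lia.
have : s \in ramification_group vn pin (b i).
  rewrite Gk; apply: (subsetP (chain_sub _ _)) si; lia.
by rewrite ramification_groupE.
Qed.

(** If [s] lay in the next ramification group, this group would contain H_(i-1) and with it
    [sigma i], whose break is b_i. Thus the break does not depend on the choice of [sigma i]. *)
Lemma chain_veq i s : (1 <= i <= n)%N -> s \in H i.-1 -> s \notin H i ->
  veq (s pin - pin) ((b i)%:~R + 1).
Proof.
move=> i1 si sni; apply: (veq_of_ge_ngt vn_val); first exact: chain_vge.
move=> s_gt; have [_ _ _ /(_ (b i + 1))[k kn Gk]] := H_chain.
have sG : s \in G by apply: (subsetP (chain_gal _)) si; lia.
have s_ge : vge (s pin - pin) ((b i + 1)%:~R + 1).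
  case: (vgtP vn_val s_gt) => [->|[m sm]]; first exact: vge0.
  move=> bm; apply: vgeW (veq_ge sm) _; move: bm.
  rewrite -[1 in X in X -> _]/(1%:~R) -[1 in X in _ -> X]/(1%:~R) -!intrD ltr_int ler_int.
  by lia.
have sk : s \in H k by rewrite -Gk ramification_groupE.
have ki := chain_mem_lt kn i1 sk sni.
have := sigmaH i1; rewrite inE => /andP[_ sig].
have : sigma i \in ramification_group vn pin (b i + 1).
  rewrite Gk; apply: (subsetP (chain_sub _ _)) sig; lia.
rewrite ramification_groupE ?sigma_gal // => /(veq_vge (veq_sigma_pin i1)).
by rewrite lerD2r ler_int; lia.
Qed.

Lemma break_le i j : (1 <= i)%N -> (i <= j)%N -> (j <= n)%N -> b i <= b j.
Proof.
move=> i1 ij jn; have j1 : (1 <= j <= n)%N by lia.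
have i2 : (1 <= i <= n)%N by lia.
have := sigmaH j1; rewrite inE => /andP[_ sj].
have : sigma j \in H i.-1 by apply: (subsetP (chain_sub _ _)) sj; lia.
move=> /(chain_vge i2)/(veq_vge (veq_sigma_pin j1)).
by rewrite lerD2r ler_int.
Qed.

Hypothesis b1_p : ~~ (p%:Z %| b 1%N)%Z.

Lemma break_gt0 i : (1 <= i <= n)%N -> 0 < b i.
Proof.
move=> i1; have n1 : (1 <= 1 <= n)%N by lia.
apply: lt_le_trans (@break_le 1 i _ _ _); try lia.
rewrite lt_neqAle eq_sym; apply/andP; split.
  by apply: contraNneq b1_p => ->; rewrite dvdz0.
have : vge (sigma 1%N pin - pin) 1.
  apply: (vgeB vn_val); last exact: (veq_ge pin_prime').
  exact: (veq_ge (veq_gal v0_val vn_val vn_ram pin_prime' _ pin_prime')).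
move=> /(veq_vge (veq_sigma_pin n1)).
by rewrite lerDr (ler_int _ 0).
Qed.

Lemma gal_diff_pin (s t : gT) : s pin - t pin = t ((s * t^-1)%g pin - pin).
Proof. by rewrite rmorphB /= -galM ?memvf // mulgKV. Qed.

Let sigma_p i : (1 <= i <= n)%N -> (sigma i ^+ p)%g = 1%g.
Proof.
move=> i1; have /abelemP-/(_ p_pr)[_] := abelemG; apply; exact: sigma_gal.
Qed.

Let gal_comm (s t : gT) : s \in G -> t \in G -> (s * t)%g = (t * s)%g.
Proof. by move=> sG tG; have /centsP := abelem_abelian abelemG; apply. Qed.

(** Descending the index, each inclusion H_i < H_(i-1) has prime index, so a subgroup containing H_i
    and one element outside it contains H_(i-1). *)
Lemma chain_generated r (K : {group gT}) : (r <= n)%N ->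
  (forall j, (r < j)%N -> (j <= n)%N -> sigma j \in K) -> H r \subset K.
Proof.
case: H_chain => _ Hn Hs _.
move=> rn; rewrite -(subKn rn); move: (n - r)%N (leq_subr r n) => m {r rn}.
elim: m => [|m IH] mn hK; first by rewrite subn0 Hn sub1G.
have sub1 : H (n - m) \subset K.
  by apply: IH => [|j jm jn]; [exact: ltnW | apply: hK => //; lia].
have hm : (1 <= n - m <= n)%N by lia.
have [sub ind] := Hs _ hm.
rewrite (_ : n - m.+1 = (n - m).-1)%N; last by lia.
set A := H (n - m) in sub ind sub1 *; set B := H (n - m).-1 in sub ind *.
have := sigmaH hm; rewrite inE => /andP[sA sB].
have sK : sigma (n - m) \in K.
  by apply: hK (leq_subr _ _); rewrite subnS prednK // subn_gt0.
have ABK : A \subset B :&: K by rewrite subsetI sub.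
have e := Lagrange_index (subsetIl B K) ABK.
have : (#|B : B :&: K|%g %| p)%N by rewrite -ind -e dvdn_mulr.
case/primeP: p_pr => _ pr /pr /orP[/eqP|/eqP h].
  by move/eqP; rewrite indexg_eq1 subsetI => /andP[].
move: e; rewrite h ind => /eqP; rewrite -{2}[p]muln1 eqn_pmul2l //.
rewrite indexg_eq1 => sub2; case/negP: sA.
by apply: (subsetP sub2); rewrite inE sB.
Qed.

(** * The groups fixing the fields K_(i) *)

Definition complement_group i : {group gT} :=
  <<\bigcup_(1 <= j < n.+1 | j != i) [set sigma j]>>%G.
Local Notation D := complement_group.

Lemma sigma_complement i j : (1 <= j <= n)%N -> j != i -> sigma j \in D i.
Proof.
move=> j1 ji; apply: mem_gen; rewrite big_mkcond (bigD1_seq j) ?iota_uniq //=.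
  by rewrite ji inE set11.
by rewrite mem_index_iota ltnS.
Qed.

Lemma complement_gal i : D i \subset G.
Proof.
rewrite gen_subG big_nat_cond; elim/big_ind: _ => [|A B sA sB|j].
- exact: sub0set.
- by rewrite subUset sA.
by rewrite ltnS => /andP[j1 _]; rewrite sub1set; exact: sigma_gal.
Qed.

Lemma chain_complement r k : (1 <= k <= n)%N -> (k <= r)%N -> (r <= n)%N ->
  H r \subset D k.
Proof.
move=> k1 kr rn; apply: chain_generated => // j rj jn.
apply: sigma_complement; first by rewrite (leq_trans _ rj).
by rewrite gtn_eqF // (leq_ltn_trans kr).
Qed.

Lemma gal_sub_complement i : (1 <= i <= n)%N -> (G \subset D i <*> <[sigma i]>)%g.
Proof.
move=> i1; have [H0 _ _ _] := H_chain; rewrite -H0.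
apply: chain_generated => // j j1 jn.
have [->|ji] := eqVneq j i.
  by apply: (subsetP (joing_subr _ _)); exact: cycle_id.
by apply: (subsetP (joing_subl _ _)); apply: sigma_complement => //; rewrite j1.
Qed.

(** Together with [sigma i], of order dividing p, the group [D i] generates G, so its index is at
    most p; it is not 1 because [sigma i] lies outside. *)
Lemma card_complement i : (1 <= i <= n)%N -> sigma i \notin D i ->
  #|D i| = (p ^ n.-1)%N.
Proof.
move=> i1 si.
have cD : (#|G| <= #|D i| * p)%N.
  apply: leq_trans (subset_leq_card (gal_sub_complement i1)) _.
  have comm : commute (D i) <[sigma i]>%g.
    apply: centC; apply: (centSS (complement_gal i) _ (abelem_abelian abelemG)).
    by rewrite cycle_subG; exact: sigma_gal.
  rewrite comm_joingE //; apply: leq_trans (_ : (#|D i| * #|<[sigma i]>%g| <= _)%N).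
    by rewrite mul_cardG leq_pmulr // cardG_gt0.
  rewrite leq_mul2l; apply/orP; right; apply: dvdn_leq => //.
  by rewrite -orderE order_dvdn; apply/eqP/sigma_p.
have /dvdn_pfactor[//|m mn cE] : (#|D i| %| p ^ n)%N.
  by rewrite -card_gal; exact: cardSg (complement_gal i).
have m_neq : m != n.
  apply: contraNneq si => mn'; have /eqP DG : D i == G :> {set gT}; last first.
    by rewrite DG; exact: sigma_gal.
  by rewrite eqEcard complement_gal /= cE mn' card_gal.
rewrite cE; congr (p ^ _)%N; apply/eqP; rewrite eqn_leq; apply/andP; split; first by lia.
move: cD; rewrite card_gal cE -expnSr leq_exp2l //.
by rewrite -[in X in X -> _](prednK (ltnW n_gt1)).
Qed.

(** * Valuations attached to the Artin-Schreier generators *)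

Section Data.

Variables (x : nat -> L) (beta : F) (omega eps : nat -> F).
Hypothesis data : artin_schreier_data p n v0 v sigma b x beta omega eps.

Local Notation eta i := (sigma i (x i) - x i - 1).

Lemma generator_fixed i : (1 <= i <= n)%N -> x i \in fixedField (D i).
Proof.
move=> i1; have := memv_adjoin 1%VS (x i); rewrite (as_gen data i1).
by [].
Qed.

Lemma complement_generator i s : (1 <= i <= n)%N -> s \in D i -> s (x i) = x i.
Proof. by move=> i1 sD; have /mem_fixedFieldP[_] := generator_fixed i1; apply. Qed.

Lemma chain_generator r k s : (1 <= k <= n)%N -> (k <= r)%N -> (r <= n)%N ->
  s \in H r -> s (x k) = x k.
Proof.
move=> k1 kr rn sr; apply: complement_generator => //.
exact: (subsetP (chain_complement k1 kr rn)).
Qed.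

Lemma gal_fixedField (A : {group gT}) (s : gT) y : A \subset G -> s \in G ->
  y \in fixedField A -> s y \in fixedField A.
Proof.
move=> AG sG yA; apply/fixedFieldP; rewrite ?memvf // => t tA.
have tG := subsetP AG t tA.
rewrite -galM ?memvf // gal_comm // galM ?memvf //; congr (s _).
by have /mem_fixedFieldP[_] := yA; apply.
Qed.

Lemma eta_fixed i : (1 <= i <= n)%N -> eta i \in fixedField (D i).
Proof.
move=> i1; rewrite !rpredB ?rpred1 ?generator_fixed //.
by apply: gal_fixedField; rewrite ?complement_gal ?sigma_gal ?generator_fixed.
Qed.

Lemma vgt_normalized (A : {group gT}) y q : y \in fixedField A ->
  vgt y (#|A|%:R * q) <-> (q%:E < v [aspace of fixedField A] y)%E.
Proof.
move=> yA.
rewrite /val_gt (normalized_on_card v0_val vn_val vn_ram pin_prime' (v_norm _) yA).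
by rewrite EFinM lte_pmul2l // lte_fin ltr0n cardG_gt0.
Qed.

Lemma vgt_eta0 i : (1 <= i <= n)%N -> vgt (eta i) 0.
Proof.
move=> i1; have /vgt_normalized := eta_fixed i1 => /(_ 0).
rewrite mulr0 => -[_]; apply; exact: (as_galois data i1).
Qed.

Lemma veq_eta1 i : (1 <= i <= n)%N -> veq (1 + eta i) 0.
Proof. by move=> i1; apply: veqD => //; [exact: veq1 | exact: vgt_eta0]. Qed.

Lemma sigma_notin_complement i : (1 <= i <= n)%N -> sigma i \notin D i.
Proof.
move=> i1; apply/negP => sD; have := veq_neq0 vn_val (veq_eta1 i1).
by rewrite complement_generator // subrr sub0r subrr eqxx.
Qed.

Lemma veq_generator i : (1 <= i <= n)%N -> veq (x i) (- sub_u p n b i).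
Proof.
move=> i1; rewrite /val_is.
have := normalized_on_card v0_val vn_val vn_ram pin_prime' (v_norm _) (generator_fixed i1).
by rewrite (as_val data i1) card_complement ?sigma_notin_complement // -EFinM mulrN.
Qed.

Lemma card_chain_complement r i : (r < n)%N -> (1 <= i <= n)%N ->
  (p ^ (n - r - 1) <= #|H r :&: D i|)%N.
Proof.
move=> rn i1; rewrite -(leq_pmul2l (_ : 0 < p ^ n)%N) ?expn_gt0 ?p_gt0 //.
rewrite -expnD -card_gal.
apply: leq_trans (_ : (#|(H r * D i)%g| * #|H r :&: D i| <= _)%N); last first.
  rewrite leq_mul2r; apply/orP; right; apply: subset_leq_card.
  by rewrite mul_subG ?complement_gal // chain_gal // ltnW.
rewrite -mul_cardG card_chain ?(ltnW rn) // card_complement ?sigma_notin_complement //.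
by rewrite -expnD leq_exp2l //; lia.
Qed.

Hypothesis T_ge1 : (1 <= T)%N.
Hypothesis eps_gt : forall i, (1 <= i <= n)%N ->
  ((- u i + C n.-1)%:E < v0 (eps i))%E.

Local Notation s := (level_break p n b).
Local Notation U := (scaled_u p n b).
Local Notation Cn := (scaled_C p n b).
Local Notation Y := (sub_u p n b).
Local Notation P0 := (Cn n + T%:R).

Hypothesis vp : vge p%:R P0.

Let N_gt0 : 0 < (p ^ n)%:R :> rat.
Proof. by rewrite ltr0n expn_gt0 p_gt0. Qed.

Let p_rat_gt0 : 0 < p%:R :> rat. Proof. by rewrite ltr0n. Qed.

Let P0_gt : Cn n.-1 < P0.
Proof.
have := scaled_C_le p_gt1 break_gt0 (leq_pred n) (leqnn n).
have : 1 <= T%:R :> rat by rewrite ler1n.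
by move=> t1 c1; apply: le_lt_trans c1 _; rewrite ltrDl (lt_le_trans ltr01).
Qed.

Let P0_ge0 : 0 <= P0.
Proof.
have h := scaled_C_ge0 p_gt1 break_gt0 (leq_pred n).
exact/ltW/(le_lt_trans h P0_gt).
Qed.

Lemma vgt_scalar a q : val_gt v0 a q -> vgt a%:A ((p ^ n)%:R * q).
Proof.
move=> /(vgtP v0_val)[->|[m am qm]]; first by rewrite scale0r; exact: vgt0.
apply: vge_gt (veq_ge (veq_scalar vn_ram am)) _.
by rewrite dimL ltr_pM2l.
Qed.

Lemma scalarX (a : F) k : (a ^+ k)%:A = a%:A ^+ k :> L.
Proof. exact: (rmorphXn (in_alg L)). Qed.

Lemma scalarM (a c : F) : (a * c)%:A = a%:A * c%:A :> L.
Proof. exact: (rmorphM (in_alg L)). Qed.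

Lemma vgt_eps i : (1 <= i <= n)%N -> vgt (eps i)%:A (- U i + Cn n.-1).
Proof.
by move=> i1; have := vgt_scalar (eps_gt i1); rewrite mulrDr mulrN.
Qed.

Let one_range : (1 <= 1 <= n)%N. Proof. exact: ltnW. Qed.

Lemma U_gt0 i : (1 <= i <= n)%N -> 0 < U i.
Proof.
move=> i1; rewrite (scaled_u_C b p_gt1 i1).
have := s_gt0 p_gt1 break_gt0 i1.
have : 0 <= Cn i by apply: (scaled_C_ge0 p_gt1 break_gt0); case/andP: i1.
by move: (s i) (Cn i) => c d; lra.
Qed.

Lemma p_Y i : p%:R * Y i = U i.
Proof. by rewrite p_sub_u // ltnW. Qed.

Lemma Y_gt0 i : (1 <= i <= n)%N -> 0 < Y i.
Proof. by move=> /U_gt0; rewrite -p_Y pmulr_rgt0. Qed.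

Lemma veq_wp_generator i : (1 <= i <= n)%N -> veq (wp p (x i)) (- U i).
Proof.
move=> i1; rewrite -p_Y -mulrN; apply: (veq_wp vn_val p_pr).
  by rewrite oppr_lt0 Y_gt0.
exact: veq_generator.
Qed.

(** [eps i] is too small to affect the valuation of wp(x_i), so omega_i^(p^(n-1)) has the valuation
    of wp(x_i)/beta. The factor is written [p ^ 1] to match [level] at r = 1. *)
Lemma veq_omega i : (1 <= i <= n)%N -> veq (omega i)%:A (- ((p ^ 1)%:R * (u i - u 1%N))).
Proof.
move=> i1; have wE := as_wp data i1; have bE' := veq_wp_generator one_range.
rewrite (as_beta data) in bE'.
have h : veq ((omega i)%:A ^+ (p ^ n.-1) * beta%:A) (- U i).
  have -> : (omega i)%:A ^+ (p ^ n.-1) * beta%:A = wp p (x i) - (eps i)%:A :> L.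
    by rewrite wE scalerDl addrK scalarM scalarX.
  apply: veqD => //; first exact: veq_wp_generator.
  apply: vgtN => //; apply: vgtW (vgt_eps i1) _; rewrite lerDl.
  exact: (scaled_C_ge0 p_gt1 break_gt0 (leq_pred n)).
case: (scalar_cases v0_val vn_ram (omega i)) => [o0|[m om]].
  have := veq_neq0 vn_val h; rewrite o0 scale0r expr0n expn_eq0.
  by rewrite (gtn_eqF p_gt0) mul0r eqxx.
have := veq_inj (veqM vn_val (veqX vn_val (p ^ n.-1) om) bE') h.
move: om; set k : rat := (_)%:~R => om e.
have q0 : (p ^ n.-1)%:R != 0 :> rat by rewrite pnatr_eq0 expn_eq0 (gtn_eqF p_gt0).
suff -> : - ((p ^ 1)%:R * (u i - u 1%N)) = k by [].
apply: (mulfI q0); rewrite -[RHS](addrK (- U 1%N)) e expn1 /scaled_u.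
rewrite -[n in RHS](prednK (ltnW n_gt1)) expnS natrM.
move: (u i) (u 1%N) (p%:R : rat) ((p ^ n.-1)%:R : rat) => c d f g; ring.
Qed.

Lemma sigma_combination i (c : nat -> F) : (1 <= i <= n)%N ->
  sigma i (\sum_(1 <= k < n.+1) c k *: x k) - \sum_(1 <= k < n.+1) c k *: x k =
  c i *: (1 + eta i).
Proof.
move=> i1; rewrite linear_sum -sumrB (bigD1_seq i) ?iota_uniq ?mem_index_iota //=.
rewrite linearZ /= -scalerBr big_seq_cond big1 ?addr0.
  by congr (_ *: _); ring.
move=> k /andP[]; rewrite mem_index_iota ltnS => k1 ki.
rewrite linearZ /= (complement_generator k1) ?subrr //.
by apply: sigma_complement => //; rewrite eq_sym.
Qed.

(** Besides x_i, only generators of index below [r] occur in y_i, so [sigma i] displaces y_i exactly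
    as it displaces x_i. The bound on the errors does not depend on [r]. *)
Definition level r (y : nat -> L) (w : nat -> F) (cf : nat -> nat -> F) : Prop :=
  [/\ w r = 1, veq (y r) (- s r) & forall i, (r <= i <= n)%N ->
   [/\ y i = \sum_(1 <= k < n.+1) cf i k *: x k,
       cf i i = 1 /\ (forall k, (r <= k)%N -> k != i -> cf i k = 0),
       veq (w i)%:A (- ((p ^ r)%:R * (u i - u r))) &
       vgt (wp p (y i) - (w i)%:A ^+ (p ^ (n - r)) * wp p (y r))
           (- U i + Cn n.-1)]].

Lemma level1 : level 1 x omega (fun i k => (k == i)%:R).
Proof.
split; first exact: (as_omega1 data).
- have -> : s 1%N = Y 1%N.
    rewrite (sub_uE b p_gt1 one_range) /tol_sum big_geq // mulr0 add0r //.
  exact: veq_generator.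
move=> i i1; split.
- rewrite (bigD1_seq i) ?iota_uniq ?mem_index_iota //= eqxx scale1r big1 ?addr0 //.
  by move=> k /negPf ->; rewrite scale0r.
- by split=> [|k _ /negPf ->]; rewrite ?eqxx.
- exact: veq_omega.
rewrite (as_beta data) (as_wp data i1) subn1 -scalarX -scalarM -scalerBl addrC addKr.
exact: vgt_eps.
Qed.

Section LevelStep.

Variables (r : nat) (y : nat -> L) (w : nat -> F) (cf : nat -> nat -> F).
Hypotheses (r_ge1 : (1 <= r)%N) (rn : (r < n)%N) (lev : level r y w cf).

Let e := (n - r.+1)%N.
Let W i := w i ^+ (p ^ e).
Let y' i := y i - W i *: y r.
Let z i := w i ^+ p - w i.
Let w' i := z i / z r.+1.
Let E' i := wp p (y' i) + (z i)%:A ^+ (p ^ e) * y r.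
Let r_range : (1 <= r <= n)%N. Proof. by rewrite r_ge1 ltnW. Qed.
Let range_of i : (r <= i <= n)%N -> (1 <= i <= n)%N.
Proof. by case/andP=> ri ni; rewrite ni (leq_trans r_ge1). Qed.

Let pe_gt0 : 0 < (p ^ e)%:R :> rat.
Proof. by rewrite ltr0n expn_gt0 p_gt0. Qed.

Let pnr : (p ^ (n - r) = p ^ e * p)%N.
Proof. by rewrite -expnSr /e subnSK. Qed.

Let vyr : veq (y r) (- s r). Proof. by case: lev. Qed.

Let sr_gt0 : 0 < s r := s_gt0 p_gt1 break_gt0 r_range.

Let U_le i : (r <= i <= n)%N -> U r <= U i.
Proof.
case/andP=> ri ni; rewrite ler_pM2l //.
exact: (upper_break_le p_gt1 break_le).
Qed.

Let v_wX i k : (r <= i <= n)%N ->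
  veq ((w i)%:A ^+ k) (- (k%:R * (p ^ r)%:R * (u i - u r))).
Proof.
move=> ri; case: lev => _ _ /(_ i ri)[_ _ wi _].
by have := veqX vn_val k wi; rewrite mulrN mulrA.
Qed.

Let pX_pred : (p ^ e * p ^ r)%N = (p ^ n.-1)%N.
Proof. by rewrite -expnD /e; congr (p ^ _)%N; lia. Qed.

Let v_W i : (r <= i <= n)%N -> veq (W i)%:A (- (Y i - Y r)).
Proof.
move=> ri; rewrite scalarX; have := v_wX (p ^ e) ri.
by rewrite -natrM pX_pred mulrBr.
Qed.

Let pe_w i : (p ^ e)%:R * (p%:R * ((p ^ r)%:R * (u i - u r))) = U i - U r.
Proof.
rewrite !mulrA -!natrM (_ : (p ^ e * p * p ^ r)%N = (p ^ n)%N) ?mulrBr //.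
by rewrite mulnAC pX_pred -expnSr prednK // ltnW.
Qed.

(** The relation of stage [r] determines wp(y_i): its error is smaller than the main term because
    U_r - p s_r = p^n C_(r-1) <= p^n C_(n-1). *)
Let v_y i : (r <= i <= n)%N -> veq (y i) (- (Y i - Y r) - s r).
Proof.
move=> ri; have i1 := range_of ri; have Ul := U_le ri.
have neg : - (Y i - Y r) - s r < 0.
  have : 0 <= Y i - Y r by rewrite -(pmulr_rge0 _ p_rat_gt0) mulrBr !p_Y subr_ge0.
  by move: sr_gt0; move: (Y i - Y r) (s r) => c d; lra.
apply: (wp_veq vn_val p_pr neg); case: lev => _ _ /(_ i ri)[_ _ _ err].
rewrite -(subrK ((w i)%:A ^+ (p ^ (n - r)) * wp p (y r)) (wp p (y i))) addrC.
have wr : veq (wp p (y r)) (p%:R * - s r).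
  by apply: (veq_wp vn_val p_pr) => //; rewrite oppr_lt0.
have q : p%:R * (- (Y i - Y r) - s r) = - (U i - U r) - p%:R * s r.
  by rewrite mulrBr mulrN mulrBr !p_Y.
rewrite q; apply: veqD => //.
  rewrite -[- (p%:R * s r)]mulrN; apply: veqM => //.
  by have := v_wX (p ^ (n - r)) ri; rewrite pnr natrM -!mulrA pe_w.
apply: vgtW err _.
have rn1 : (r.-1 <= n.-1)%N.
  by apply: (leq_trans (leq_pred r)); rewrite -ltnS prednK // ltnW.
have := scaled_C_le p_gt1 break_gt0 rn1 (leq_pred n).
have := scaled_u_pred b p_gt1 r_range.
by move: (U i) (U r) (Cn r.-1) (Cn n.-1) (p%:R * s r) => a1 a2 a3 a4 a5; lra.
Qed.

(* With X^p = X + wp X for X = y r, the p-th powers of the two summands of y' *)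
(* cancel up to terms divisible by p.                                         *)
Let E'_gt i : (r <= i <= n)%N -> vgt (E' i) (- U i + Cn n.-1).
Proof.
move=> ri; have i1 := range_of ri.
case: lev => _ _ /(_ i ri)[_ _ wi err].
set Ei := wp p (y i) - _ in err.
set Wi : L := (W i)%:A; set wL : L := (w i)%:A in wi.
have WE : Wi = wL ^+ (p ^ e) by rewrite /Wi scalarX.
have v_Wy : vge (Wi * y r) (- (Y i - Y r) - s r).
  by apply: vgeM => //; apply/veq_ge => //; exact: v_W.
have h1 := vge_frobeniusB vn_val p_pr vp P0_ge0 (veq_ge (v_y ri)) v_Wy.
have q : p%:R * (- (Y i - Y r) - s r) = - (U i - U r) - p%:R * s r.
  by rewrite mulrBr mulrN mulrBr !p_Y.
rewrite q in h1.
have ui : 0 <= u i - u r.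
  by rewrite subr_ge0; case/andP: ri => ri ni; exact: (upper_break_le p_gt1 break_le).
have d0 : 0 <= (p ^ r)%:R * (u i - u r) by rewrite mulr_ge0 ?ler0n.
have wp_ge : vge (wL ^+ p) (- (p%:R * ((p ^ r)%:R * (u i - u r)))).
  by apply/veq_ge; have := veqX vn_val p wi; rewrite mulrN.
have w_ge : vge wL (- (p%:R * ((p ^ r)%:R * (u i - u r)))).
  apply: vgeW (veq_ge wi) _; rewrite lerN2 ler_peMl //.
  by rewrite ler1n.
have h2 := vge_frobeniusXB vn_val p_pr vp P0_ge0 e wp_ge w_ge.
rewrite mulrN pe_w in h2.
have zE : (z i)%:A = wL ^+ p - wL by rewrite /z scalerBl scalarX.
have -> : E' i = Ei + ((y i - Wi * y r) ^+ p - (y i ^+ p - (Wi * y r) ^+ p)) +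
   ((wL ^+ p - wL) ^+ (p ^ e) - ((wL ^+ p) ^+ (p ^ e) - wL ^+ (p ^ e))) * y r.
  rewrite /E' /Ei zE /y' /wp pnr exprM -/wL -WE [wL ^+ p ^+ _]exprAC -WE.
  rewrite -mulr_algl -/Wi exprMn; ring.
have Cr0 := scaled_C_ge0 p_gt1 break_gt0 (_ : (r.-1 <= n)%N).
have := Cr0 (leq_trans (leq_pred r) (ltnW rn)).
have := scaled_u_pred b p_gt1 r_range.
have s_le : s r <= p%:R * s r by rewrite ler_peMl ?(ltW sr_gt0) // ler1n.
move: P0_gt => hP hu hC.
apply: vgtD => //; first apply: vgtD => //.
  apply: vge_gt h1 _; move: hP hu hC.
  by move: P0 (U i) (U r) (Cn r.-1) (Cn n.-1) (p%:R * s r) => a0 a1 a2 a3 a4 a5; lra.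
apply: vge_gt (vgeM vn_val h2 (veq_ge vyr)) _; move: hP hu hC s_le.
by move: P0 (U i) (U r) (Cn r.-1) (Cn n.-1) (p%:R * s r) (s r) => a0 a1 a2 a3 a4 a5 a6; lra.
Qed.

Let C_r : Cn r <= Cn n.-1.
Proof.
apply: (scaled_C_le p_gt1 break_gt0); last exact: leq_pred.
by rewrite -ltnS prednK // ltnW.
Qed.

Definition next_coef i k := cf i k - W i * cf r k.

Lemma next_coef_sum i : (r < i <= n)%N ->
  y' i = \sum_(1 <= k < n.+1) next_coef i k *: x k.
Proof.
case/andP=> ri ni; case: lev => _ _ h.
have [yi _ _ _] := h i (introT andP (conj (ltnW ri) ni)).
have [yr _ _ _] := h r (introT andP (conj (leqnn r) (ltnW rn))).
rewrite /y' yi yr scaler_sumr -sumrB; apply: eq_bigr => k _.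
by rewrite scalerA -scalerBl.
Qed.

Lemma next_coef_diag i : (r < i <= n)%N -> next_coef i i = 1 /\
  (forall k, (r.+1 <= k)%N -> k != i -> next_coef i k = 0).
Proof.
case/andP=> ri ni; case: lev => _ _ h.
have [_ [ci c0] _ _] := h i (introT andP (conj (ltnW ri) ni)).
have [_ [_ cr0] _ _] := h r (introT andP (conj (leqnn r) (ltnW rn))).
split; first by rewrite /next_coef ci (cr0 i) ?mulr0 ?subr0 ?gtn_eqF // ltnW.
move=> k rk ki; rewrite /next_coef c0 ?(ltnW rk) // cr0 ?(ltnW rk) ?gtn_eqF //.
by rewrite mulr0 subr0.
Qed.

(* If w i were congruent to an element of the prime field, y' i would have    *)
(* too large a valuation for the ramification break of sigma i on F(x_1, ..., *)
(* x_r, x_i).                                                                 *)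
Let residue_not_prime i : (r < i <= n)%N -> U i = U r -> ~ vgt (z i)%:A 0.
Proof.
move=> ri Ui z0; have rin : (r <= i <= n)%N by case/andP: ri => /ltnW -> ->.
have i1 := range_of rin.
have b0 := break_gt0 r_range.
have se : s r = p%:R * ((p ^ e)%:R * (b r)%:~R).
  by rewrite /level_break pnr natrM mulrAC mulrC.
have q0 : - ((p ^ e)%:R * (b r)%:~R) < 0 :> rat.
  by rewrite oppr_lt0 mulr_gt0 // (ltr_int _ 0).
(* If z_i had positive valuation, wp(y'_i) would have valuation above -s_r. Division by p gives the
   bound -p^(n-r-1) b_r for y'_i. *)
have y'_gt : vgt (y' i) (- ((p ^ e)%:R * (b r)%:~R)).
  apply: (wp_vgt vn_val p_pr q0); rewrite mulrN -se.
  have -> : wp p (y' i) = E' i - (z i)%:A ^+ (p ^ e) * y r by rewrite /E' addrK.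
  apply: vgtB => //.
    apply: vgtW (E'_gt rin) _; rewrite Ui (scaled_u_C b p_gt1 r_range).
    by move: C_r; move: (Cn r) (Cn n.-1) (s r) => a1 a2 a3; lra.
  rewrite mulrC -[- s r]addr0; apply: vgeM_gt => //; first exact: veq_ge.
  by apply: vgtX0 => //; rewrite expn_gt0 p_gt0.
have [nd n0] := next_coef_diag ri.
have shift : veq (sigma i (y' i) - y' i) 0.
  by rewrite next_coef_sum // sigma_combination // nd scale1r; exact: veq_eta1.
(* This group fixes x_1, ..., x_r and x_i, hence y'_i. Its order is at least p^(n-r-1), so moving
   y'_i raises the valuation by at least p^(n-r-1) b_r, to a positive value; but the displacement is
   a unit. *)
pose A := [group of H r :&: D i].
have yA : y' i \in fixedField A.
  apply/fixedFieldP; rewrite ?memvf // => t; rewrite inE => /andP[tr tD].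
  rewrite next_coef_sum // linear_sum !big_nat; apply: eq_bigr => k.
  rewrite ltnS => k1; rewrite linearZ /=.
  have [kr|rk] := leqP k r; first by rewrite (chain_generator k1 kr (ltnW rn) tr).
  have [->|ki] := eqVneq k i; first by rewrite (complement_generator i1 tD).
  by rewrite n0 // !scale0r.
have y0 : y' i != 0.
  by apply: contraTneq (veq_neq0 vn_val shift) => ->; rewrite rmorph0 subr0 eqxx.
have sA t : t \in A -> vge (sigma i pin - t pin) ((b r)%:~R + 1).
  rewrite inE => /andP[tr _]; rewrite gal_diff_pin.
  apply: (vge_gal v0_val vn_val vn_ram pin_prime').
  apply: chain_vge => //; apply: groupM.
    have := sigmaH i1; rewrite inE => /andP[_].
    apply: (subsetP (chain_sub _ _)); move: ri; clear; lia.
  by rewrite groupV; apply: (subsetP (chain_sub (leq_pred r) (ltnW rn))).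
have [q yq] := fixed_shifted v0_val vn_val vn_ram pin_prime' (v_norm _) sA yA y0.
move=> /(veq_vge shift); have := veq_vgt yq y'_gt.
have : (p ^ e)%:R * (b r)%:~R <= #|A|%:R * (b r)%:~R :> rat.
  rewrite ler_pM2r ?(ltr_int _ 0) // ler_nat /e subnS -subn1.
  exact: card_chain_complement.
move=> le1 lt1 le2; have := lt_le_trans (ltr_leD lt1 le1) le2.
by rewrite addNr ltxx.
Qed.

(** If u_r < u_i then w_i has a pole and the p-th power dominates. If u_i = u_r then w_i is a unit,
    and [residue_not_prime] makes z_i a unit as well. *)
Let v_z i : (r < i <= n)%N -> veq (z i)%:A (- ((p ^ r.+1)%:R * (u i - u r))).
Proof.
move=> ri; have rin : (r <= i <= n)%N by case/andP: ri => /ltnW -> ->.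
case: lev => _ _ /(_ i rin)[_ _ wi _].
have zE : (z i)%:A = (w i)%:A ^+ p - (w i)%:A :> L by rewrite /z scalerBl scalarX.
have wpi := veqX vn_val p wi.
rewrite expnS natrM -mulrA -mulrN.
have [ui|ui] := ltP (u r) (u i).
  rewrite zE; apply: veqD => //; apply: vgtN => //; apply: vge_gt (veq_ge wi) _.
  rewrite mulrN ltrN2 ltr_pMl ?ltr1n // mulr_gt0 ?subr_gt0 //.
  by rewrite ltr0n expn_gt0 p_gt0.
have Ui : U i = U r.
  by apply/eqP; rewrite eq_le U_le // andbT ler_pM2l.
have uE : u i - u r = 0.
  by have := mulfI (lt0r_neq0 N_gt0) Ui => ->; rewrite subrr.
rewrite uE mulr0 oppr0 mulr0 in wi wpi *.
apply: (veq_of_ge_ngt vn_val); last exact: residue_not_prime.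
by rewrite zE; apply: vgeB => //; exact: veq_ge.
Qed.

Lemma level_step : level r.+1 y' w' next_coef.
Proof.
have r1 : (r < r.+1 <= n)%N by rewrite ltnSn.
have r1' : (r <= r.+1 <= n)%N by rewrite leqnSn.
have r1n : (1 <= r.+1 <= n)%N by [].
have zr0 : z r.+1 != 0.
  by apply: contraTneq (veq_neq0 vn_val (v_z r1)) => ->; rewrite scale0r eqxx.
have Us := scaled_u_pred b p_gt1 r1n; rewrite /= in Us.
have Ur := scaled_u_C b p_gt1 r_range.
have pe_z i : (p ^ e)%:R * - ((p ^ r.+1)%:R * (u i - u r)) = - (U i - U r).
  by rewrite mulrN expnS natrM -mulrA pe_w.
split; first by rewrite /w' divff.
  have s0 : - s r.+1 < 0 by rewrite oppr_lt0 (s_gt0 p_gt1 break_gt0 r1n).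
  apply: (wp_veq vn_val p_pr s0).
  have -> : wp p (y' r.+1) = - ((z r.+1)%:A ^+ (p ^ e) * y r) + E' r.+1.
    by rewrite /E' addrC addrK.
  have q : p%:R * - s r.+1 = - (U r.+1 - U r) + - s r.
    rewrite mulrN; move: Us Ur.
    by move: (p%:R * s r.+1) (U r.+1) (U r) (Cn r) (s r) => a1 a2 a3 a4 a5; lra.
  apply: veqD => //.
    apply: veqN => //; rewrite q; apply: veqM => //.
    by rewrite -pe_z; apply: veqX => //; exact: v_z.
  (* The main term has valuation -p s_(r+1) = -U_(r+1) + p^n C_r, and C_r <= C_(n-1). *)
  apply: vgtW (E'_gt r1') _; rewrite mulrN.
  by move: C_r Us; move: (p%:R * s r.+1) (U r.+1) (Cn r) (Cn n.-1) => a1 a2 a3 a4; lra.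
move=> i ri; have ri' : (r <= i <= n)%N by case/andP: ri => /ltnW -> ->.
have v_w' : veq (w' i)%:A (- ((p ^ r.+1)%:R * (u i - u r.+1))).
  have -> : - ((p ^ r.+1)%:R * (u i - u r.+1)) =
     - ((p ^ r.+1)%:R * (u i - u r)) + - - ((p ^ r.+1)%:R * (u r.+1 - u r)).
    by move: (u i) (u r) (u r.+1) ((p ^ r.+1)%:R : rat) => a1 a2 a3 a4; ring.
  rewrite scalarM; apply: veqM => //; first exact: v_z.
  have -> : (z r.+1)^-1%:A = (z r.+1)%:A^-1 :> L by exact: (fmorphV (in_alg L)).
  by apply: veqV => //; exact: v_z.
split=> //; [exact: next_coef_sum | exact: next_coef_diag |].
(* Up to errors, wp(y'_i) is -z_i^(p^e) y_r. Since w'_i z_(r+1) = z_i, the terms in y_r cancel; this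
   dictates the quotient in [w']. *)
have -> : wp p (y' i) - (w' i)%:A ^+ (p ^ (n - r.+1)) * wp p (y' r.+1) =
   E' i - (w' i)%:A ^+ (p ^ e) * E' r.+1.
  have wz : (w' i)%:A * (z r.+1)%:A = (z i)%:A :> L.
    by rewrite -scalarM /w' divfK.
  rewrite /E' -wz exprMn -/e; ring.
apply: vgtB => //; first exact: E'_gt.
have -> : - U i + Cn n.-1 = - (U i - U r.+1) + (- U r.+1 + Cn n.-1) by ring.
apply: vgeM_gt => //; last exact: E'_gt.
apply/veq_ge; have := veqX vn_val (p ^ e) v_w'.
suff -> : (p ^ e)%:R * - ((p ^ r.+1)%:R * (u i - u r.+1)) = - (U i - U r.+1) by [].
have := pe_z i; have := pe_z r.+1.
move: (u i) (u r) (u r.+1) (U i) (U r) (U r.+1) ((p ^ e)%:R : rat) ((p ^ r.+1)%:R : rat).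
move=> a1 a2 a3 a4 a5 a6 a7 a8 h1 h2.
have -> : a7 * - (a8 * (a1 - a3)) = a7 * - (a8 * (a1 - a2)) - a7 * - (a8 * (a3 - a2)) by ring.
by rewrite h1 h2; ring.
Qed.

End LevelStep.

Lemma level_exists r : (1 <= r <= n)%N -> exists y w cf, level r y w cf.
Proof.
elim: r => // -[_ _|r IH rn]; first by exists x, omega; eexists; exact: level1.
have rn' : (1 <= r.+1 <= n)%N by case/andP: rn => _ /ltnW ->.
have [y [w [cf lev]]] := IH rn'.
by do 3 eexists; apply: level_step lev; case/andP: rn.
Qed.

(** [mu] has two roles: as [sigma k] moves only x_k, the coefficient of x_k in X_j is also the main
    part of (sigma_k - 1) X_j. *)
Definition triangular_generators (X : nat -> L) (mu : nat -> nat -> F) : Prop :=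
  (forall i j, (j < i)%N -> mu i j = 0) /\
  forall j, (1 <= j <= n)%N ->
    [/\ X j = \sum_(1 <= k < n.+1) mu k j *: x k, mu j j = 1 & veq (X j) (- s j)].

Lemma triangular_generators_exist : exists X mu, triangular_generators X mu.
Proof.
pose P j (Xc : L * (nat -> F)) :=
  [/\ Xc.1 = \sum_(1 <= k < n.+1) Xc.2 k *: x k, Xc.2 j = 1,
      forall k, (j < k)%N -> Xc.2 k = 0 & veq Xc.1 (- s j)].
have [f hf] : exists f, forall j, (1 <= j <= n)%N -> P j (f j).
  apply: (finite_choice (0, fun=> 0)) => j j1.
  have [y [w [cf [_ vy /(_ j)]]]] := level_exists j1.
  rewrite leqnn; case/andP: j1 => _ -> /(_ isT)[yE [c1 c0] _ _].
  exists (y j, cf j); split=> //= k jk.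
  by apply: c0; [exact: ltnW | rewrite gtn_eqF].
(* [mu i j] is set to 0 below the diagonal by definition, so that it vanishes there for all indices,
   also outside the range of the choice. *)
exists (fun j => (f j).1), (fun i j => if (j < i)%N then 0 else (f j).2 i).
split=> [i j -> //|j j1]; have [fE f1 f0 fv] := hf j j1; split=> //.
  rewrite {1}fE; apply: eq_bigr => k _; case: ifP => // jk.
  by rewrite f0.
by rewrite ltnn.
Qed.

(** The bound v(p) - (p-1) p^(n-1) u_i becomes p^n (C_n - C_i) + [tol_sum] i + T, since p^(n-1) u_i
    = [tol_sum] i + s_i, p [tol_sum] i = p^n C_(i-1) and p^n (C_i - C_(i-1)) = (p-1) s_i. Replacing
    C_n by the smaller C_j leaves the gap estimated in [scaled_C_gap]. *)
Lemma eta_ge i j : (1 <= i)%N -> (i <= j)%N -> (j <= n)%N ->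
  vge (eta i) (tol_sum p n b i + (s i - (p ^ (n - j))%:R * (b i)%:~R) + T%:R).
Proof.
move=> i_ge1 ij jn; have i1 : (1 <= i <= n)%N by rewrite i_ge1 (leq_trans ij).
have Y0 : - Y i <= 0 by rewrite oppr_le0 ltW // Y_gt0.
have wE : wp p (sigma i (x i)) = wp p (x i).
  transitivity (sigma i (wp p (x i))); first by rewrite /wp rmorphB rmorphXn.
  by rewrite (as_wp data i1) gal_1.
have h := vge_wp_translation vn_val p_pr vp (veq_ge (veq_generator i1)) Y0 wE (vgt_eta0 i1).
apply: vgeW h _.
have g1 := scaled_C_gap p_gt1 break_le i_ge1 ij jn.
have g2 := scaled_C_le p_gt1 break_gt0 jn (leqnn n).
have g3 := scaled_C_step b p_gt1 i1.
have g4 := p_tol_sum b p_gt1 i1.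
rewrite (sub_uE b p_gt1 i1).
move: g1 g2 g3 g4.
move: (tol_sum p n b i) (s i) ((p ^ (n - j))%:R * (b i)%:~R) (T%:R : rat).
move: (Cn n) (Cn j) (Cn i) (Cn i.-1) (p%:R : rat).
move=> a5 a6 a7 a8 q a1 a2 a3 a4 g1 g2 g3 g4.
have -> : (q - 1) * - (a1 + a2) = - (q * a1) + a1 - (q - 1) * a2 by ring.
by rewrite g4; move: g3; move: ((q - 1) * a2) => a9; lra.
Qed.

Hypothesis b_mod : forall i, (1 <= i <= n)%N -> (b i = b 1%N %[mod (p ^ n)%N])%Z.

Let vp0 : vgt p%:R 0.
Proof.
apply: vge_gt vp _; apply: le_lt_trans P0_gt.
exact: (scaled_C_ge0 p_gt1 break_gt0 (leq_pred n)).
Qed.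

Lemma break_coprime i : (1 <= i <= n)%N -> coprime `|b i|%N p.
Proof.
move=> i1; rewrite coprime_sym prime_coprime //; apply: contra b1_p => pbi.
have pb : (p%:Z %| b i - b 1%N)%Z.
  apply: (@dvdz_trans (p ^ n)%N); first by rewrite dvdzE /= dvdn_exp // ltnW.
  by rewrite -eqz_mod_dvd; apply/eqP/b_mod.
rewrite (_ : b 1%N = b i - (b i - b 1%N)); last by ring.
by apply: rpredB.
Qed.

(** * The displacement of the generators X_j and the scaffold *)

Section Triangular.

Variables (X : nat -> L) (mu : nat -> nat -> F).
Hypothesis tri : triangular_generators X mu.

Lemma triangular_fixed j : (1 <= j <= n)%N -> X j \in fixedField (H j).
Proof.
move=> j1; case: tri => mu0 /(_ j j1)[XE _ _].
apply/fixedFieldP; rewrite ?memvf // => t tj.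
rewrite XE linear_sum !big_nat; apply: eq_bigr => k; rewrite ltnS => k1.
rewrite linearZ /=; have [kj|jk] := leqP k j; last by rewrite mu0 // !scale0r.
by rewrite (chain_generator k1 kj _ tj) //; case/andP: j1.
Qed.

Lemma triangular_sigma i j : (1 <= i <= n)%N -> (1 <= j <= n)%N ->
  sigma i (X j) - X j = mu i j *: (1 + eta i).
Proof.
move=> i1 j1; case: tri => _ /(_ j j1)[XE _ _].
by rewrite XE (sigma_combination (fun k => mu k j)).
Qed.

(** Multiplying [sigma i] by elements of H_j, contained in H_i, keeps it in H_(i-1) outside H_i, so
    b_i is also its break on K_j. As the pole order b_j of X_j in K_j is prime to p, the
    displacement of X_j has an exact valuation, and 1 + eta_i is a unit. *)
Lemma triangular_veq_mu i j : (1 <= i)%N -> (i <= j)%N -> (j <= n)%N ->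
  veq (mu i j)%:A ((p ^ (n - j))%:R * ((b i)%:~R - (b j)%:~R)).
Proof.
move=> i_ge1 ij jn; have i1 : (1 <= i <= n)%N by rewrite i_ge1 (leq_trans ij).
have j1 : (1 <= j <= n)%N by rewrite (leq_trans i_ge1 ij).
case: tri => _ /(_ j j1)[_ _ vX].
have bj : `|b j|%N%:R = (b j)%:~R :> rat.
  by rewrite -[in RHS](gez0_abs (ltW (break_gt0 j1))) pmulrn.
have bi : 0 < (b i)%:~R :> rat by rewrite (ltr_int _ 0) break_gt0.
have sA t : t \in H j -> veq (sigma i pin - t pin) ((b i)%:~R + 1).
  move=> tj; rewrite gal_diff_pin; apply: (veq_gal v0_val vn_val vn_ram pin_prime').
  have := sigmaH i1; rewrite inE => /andP[sn si].
  have ti : t \in H i by apply: (subsetP (chain_sub ij jn)).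
  have ti' : t \in H i.-1.
    by apply: (subsetP (chain_sub (leq_pred i) _)) ti; case/andP: i1.
  apply: chain_veq => //; first by rewrite groupM // groupV.
  by rewrite groupMr // groupV.
have vX' : veq (X j) (- (#|H j|%:R * `|b j|%N%:R)) by rewrite card_chain // bj.
have := fixed_shift_exactV v0_val vn_val vn_ram pin_prime' (v_norm _) p_pr vp0 bi sA
  (break_coprime j1) (triangular_fixed j1) vX'.
rewrite triangular_sigma // card_chain // bj -[_ *: (1 + _)]mulr_algl => h.
have := veqM vn_val h (veqV vn_val (veq_eta1 i1)).
by rewrite oppr0 addr0 mulfK // (veq_neq0 vn_val (veq_eta1 i1)).
Qed.

Lemma triangular_scaffold : galois_scaffold p n v0 vn b T.
Proof.
case: (tri) => mu0 triX.
(* The tolerance of level i is [tol_sum] i + T, more than the T asked for: the surplus absorbs the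
   loss in the truncated powers of the higher levels. *)
apply: (@scaffold_of_generators _ _ _ _ v0_val vn_val vn_ram _ pin_prime' _ _ p_pr vp0
  dimL b T (fun i => tol_sum p n b i + T%:R) break_gt0 break_le b_mod b1_p _ _
  sigma X mu (fun i j => mu i j *: eta i)) => //.
- move=> i /andP[_ ni]; rewrite lerDr; exact: (tol_sum_ge0 p_gt1 break_gt0).
- move=> i j i1 ij jn; have := tol_sum_gap p_gt1 break_le i1 (ltnW ij) jn.
  rewrite -/(s i); move: (s i) (_ * _) (tol_sum p n b i) (tol_sum p n b j) (T%:R : rat).
  by move=> a1 a2 a3 a4 a5; lra.
- exact: sigma_gal.
- by move=> j j1; have [] := triX j j1.
- move=> i j i1 j1; rewrite -addrA -scalerDr.
  by rewrite -triangular_sigma // addrC subrK.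
- move=> i j i1 j1; have [ij|ji] := leqP i j; last by rewrite mu0 // scale0r; exact: vge0.
  apply: vgeW (veq_ge (triangular_veq_mu _ ij _)) _; [by case/andP: i1 | by case/andP: j1 |].
  by rewrite mulrBr.
- move=> i j i1 j1; have [ij|ji] := leqP i j; last by rewrite mu0 // scale0r; exact: vge0.
  have [i_ge1 _] := andP i1; have [_ jn] := andP j1.
  have h := vgeZ vn_val (veq_ge (triangular_veq_mu i_ge1 ij jn)) (eta_ge i_ge1 ij jn).
  apply: vgeW h _; rewrite mulrBr -/(s i) -/(s j).
  move: (s i) (s j) ((p ^ (n - j))%:R * (b i)%:~R) (tol_sum p n b i) (T%:R : rat).
  by move=> a1 a2 a3 a4 a5; lra.
- by move=> i i1; have [] := triX i i1.
Qed.

Lemma normalized_chain j y q : (1 <= j <= n)%N -> y \in fixedField (H j) ->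
  veq y ((p ^ (n - j))%:R * q) -> v [aspace of fixedField (H j)] y = q%:E.
Proof.
move=> j1 yj vy.
apply: (normalized_on_veq (vn := vn) (e := #|H j|)); first exact: cardG_gt0.
  exact: (normalized_on_card v0_val vn_val vn_ram pin_prime' (v_norm _)).
by rewrite card_chain //; case/andP: j1.
Qed.

Lemma triangular_properties :
  (forall j, (1 <= j <= n)%N ->
     [/\ X j \in [aspace of fixedField (H j)],
         v [aspace of fixedField (H j)] (X j) = (- (b j)%:~R)%:E &
         (0 < v [aspace of fixedField (H j)] (sigma j (X j) - X j - 1)%R)%E]) /\
  (exists (mu : nat -> nat -> F) (eps : nat -> nat -> L),
   forall i j, (1 <= i)%N -> (i <= j)%N -> (j <= n)%N ->
     [/\ sigma i (X j) - X j = (mu i j)%:A + eps i j,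
         mu j j = 1,
         v [aspace of fixedField (H j)] (mu i j)%:A = ((b i)%:~R - (b j)%:~R)%:E,
         (((b i)%:~R - (b j)%:~R)%:E < v [aspace of fixedField (H j)] (eps i j))%E &
         (((p%:R - 1) * \sum_(1 <= k < i) (p ^ (n - k - 1))%:R * (b k)%:~R
           + ((p ^ (n - i))%:R - (p ^ (n - j))%:R) * (b i)%:~R
           + T%:R)%:E
          <= vn (eps i j) - vn (mu i j)%:A)%E]).
Proof.
case: (tri) => mu0 triX.
have sF i j : (1 <= i <= n)%N -> (1 <= j <= n)%N ->
    sigma i (X j) \in fixedField (H j).
  move=> i1 j1; apply: gal_fixedField; rewrite ?sigma_gal ?triangular_fixed //.
  by apply: chain_gal; case/andP: j1.
split.
  move=> j j1; have [XE muj vX] := triX j j1; have XF := triangular_fixed j1.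
  split=> //; first by apply: normalized_chain => //; rewrite mulrN.
  have eE : sigma j (X j) - X j - 1 = eta j.
    by rewrite triangular_sigma // muj scale1r; ring.
  have eF : sigma j (X j) - X j - 1 \in fixedField (H j) by rewrite !rpredB ?rpred1 ?sF.
  apply/(vgt_normalized 0 eF); rewrite mulr0 eE; exact: vgt_eta0.
exists mu, (fun i j => mu i j *: eta i) => i j i_ge1 ij jn.
have i1 : (1 <= i <= n)%N by rewrite i_ge1 (leq_trans ij).
have j1 : (1 <= j <= n)%N by rewrite (leq_trans i_ge1 ij).
have vmu := triangular_veq_mu i_ge1 ij jn.
have [XE muj vX] := triX j j1.
have sE : sigma i (X j) - X j = (mu i j)%:A + mu i j *: eta i.
  by rewrite triangular_sigma // scalerDr.
have muF : (mu i j)%:A \in fixedField (H j) by rewrite rpredZ ?rpred1.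
split=> //.
- exact: normalized_chain.
- have eF : mu i j *: eta i \in fixedField (H j).
    have -> : mu i j *: eta i = sigma i (X j) - X j - (mu i j)%:A.
      by rewrite sE [RHS]addrAC subrr add0r.
    by rewrite !rpredB ?sF ?triangular_fixed.
  apply/(vgt_normalized _ eF); rewrite card_chain // -mulr_algl.
  rewrite -[(p ^ (n - j))%:R * _]addr0.
  by apply: vgeM_gt => //; [exact: veq_ge | exact: vgt_eta0].
rewrite vmu leeBrDr // -EFinD -/(tol_sum p n b i).
have h := vgeZ vn_val (veq_ge vmu) (eta_ge i_ge1 ij jn).
by apply: vgeW h _; rewrite mulrBl -/(s i) addrC.
Qed.

End Triangular.

End Data.

End Main.

Theorem theorem3p2
  (p n : nat) (F : fieldType) (L : splittingFieldType F)
  (v0 : F -> \bar rat) (v : {subfield L} -> L -> \bar rat)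
  (vn : L -> \bar rat) (pin : L)
  (H : nat -> {group gal_of {:L}}) (sigma : nat -> gal_of {:L})
  (b : nat -> int) (T : nat)
  (K := fun i : nat => [aspace of fixedField (H i)] : {subfield L})
  (u := upper_break p b) (C := Cbound p b)
  (v0_val : normalized_valuation v0)
  (v0_complete : val_complete v0)
  (v0_residue : perfect_residue_field p v0)
  (n_gt1 : (1 < n)%N)
  (galL : galois 1%VS {:L}%VS)
  (dimL : \dim {:L} = (p ^ n)%N)
  (abelemG : (p.-abelem 'Gal({:L} / 1))%g)
  (vn_val : normalized_valuation vn)
  (vn_ram : totally_ramified v0 vn)
  (v_norm : forall E, normalized_on vn E (v E))
  (pin_prime : vn pin = 1%:E)
  (H_chain : ramification_chain p n vn pin H)
  (sigmaH : forall i, (1 <= i <= n)%N -> sigma i \in H i.-1 :\: H i)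
  (bE : forall i, (1 <= i <= n)%N ->
          (vn (sigma i pin - pin)%R - 1%:E)%E = (b i)%:~R%:E)
  (T_ge1 : (1 <= T)%N)
  (A4 : u 1%N / p%:R \isn't a Num.int /\
        forall i, (1 <= i <= n)%N -> congq (p ^ n.-1) (u i) (u 1%N))
  (A5 : exists (x : nat -> L) (beta : F) (omega eps : nat -> F),
        artin_schreier_data p n v0 v sigma b x beta omega eps /\
        forall i, (1 <= i <= n)%N -> ((- u i + C n.-1)%:E < v0 (eps i))%E)
  (A6 : ((C n + T%:R / (p ^ n)%:R)%:E <= v0 p%:R)%E) :
  [/\ ~~ (p%:Z %| b 1%N)%Z,
      forall i, (1 <= i <= n)%N -> (b i = b 1%N %[mod (p ^ n)%N])%Z,
      exists X : nat -> L,
        (forall j, (1 <= j <= n)%N ->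
           [/\ X j \in K j,
               v (K j) (X j) = (- (b j)%:~R)%:E &
               (0 < v (K j) (sigma j (X j) - X j - 1)%R)%E]) /\
        (exists (mu : nat -> nat -> F) (eps : nat -> nat -> L),
         forall i j, (1 <= i)%N -> (i <= j)%N -> (j <= n)%N ->
           [/\ sigma i (X j) - X j = (mu i j)%:A + eps i j,
               mu j j = 1,
               v (K j) (mu i j)%:A = ((b i)%:~R - (b j)%:~R)%:E,
               (((b i)%:~R - (b j)%:~R)%:E < v (K j) (eps i j))%E &
               (((p%:R - 1) * \sum_(1 <= k < i) (p ^ (n - k - 1))%:R * (b k)%:~R
                 + ((p ^ (n - i))%:R - (p ^ (n - j))%:R) * (b i)%:~R
                 + T%:R)%:E
                <= vn (eps i j) - vn (mu i j)%:A)%E]) &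
      galois_scaffold p n v0 vn b T].
Proof.
have [p_pr vp_gt0 _] := v0_residue.
have p_gt1 := prime_gt1 p_pr.
case: A4 => u1 ui.
have b1_p := break1_coprime p_gt1 u1.
have b_mod := breaks_congr p_gt1 ui.
have N0 : 0 < (p ^ n)%:R :> rat by rewrite ltr0n expn_gt0 prime_gt0.
(* [A6] multiplied by the ramification index p^n. *)
have vp : val_ge vn p%:R (scaled_C p n b n + T%:R).
  have -> : p%:R = p%:R%:A :> L by rewrite scaler_nat.
  rewrite /val_ge vn_ram dimL.
  have -> : scaled_C p n b n + T%:R =
      (p ^ n)%:R * (Cbound p b n + T%:R / (p ^ n)%:R).
    by rewrite mulrDr /scaled_C [X in _ = _ + X]mulrC divfK // gt_eqF.
  by rewrite EFinM lee_pmul2l // lte_fin.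
case: A5 => x [beta [omega [eps [data eps_gt]]]].
have [X [mu tri]] := triangular_generators_exist v0_val v0_residue n_gt1 galL dimL
  abelemG vn_val vn_ram v_norm pin_prime H_chain sigmaH bE b1_p data T_ge1 eps_gt vp.
split=> //; last exact: (triangular_scaffold v0_val v0_residue n_gt1 galL dimL
  abelemG vn_val vn_ram v_norm pin_prime H_chain sigmaH bE b1_p data T_ge1 vp b_mod tri).
exists X; exact: (triangular_properties v0_val v0_residue n_gt1 galL dimL
  abelemG vn_val vn_ram v_norm pin_prime H_chain sigmaH bE b1_p data T_ge1 vp b_mod tri).
Qed.
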